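(* Let $\mathcal R$ be an o-minimal expansion of the real field in which all definable o-minimal groups are definably isomorphic and in which every abelian definable extension of $(\mathbb R,+)$ by $(\mathbb R,+)$ splits. Let $G$ be an $\mathcal R$-definable $2$-dimensional ordered group. Then $G$ is isomorphic, as a definable ordered group, to $\mathbb R^2=\mathbb R\times\mathbb R$, to $\mathbb R\rtimes_1\mathbb R$, or to $\mathbb R\rtimes_{-1}\mathbb R$, each ordered with the reverse lexicographical order (that is, the second coordinate is compared first).
   Context: All objects are definable in $\mathcal R$; $\mathbb R$ also denotes its additive group. An ordered group is a group with a definable linear order invariant under left and right translations. An o-minimal group is an infinite definable ordered group all of whose definable subsets are finite unions of open intervals and points. An abelian extension $1\to\mathbb R\to G\to\mathbb R\to1$ ($G$ abelian) splits if it has a definable homomorphic section. Dimension is the usual o-minimal dimension. For $\varepsilon\in\{1,-1\}$, $\mathbb R\rtimes_\varepsilon\mathbb R$ is $\mathbb R^2$ with $(x_1,y_1)(x_2,y_2)=(x_1+e^{\varepsilon y_1}x_2,\;y_1+y_2)$ (the exponential function is definable in $\mathcal R$). *)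

(* Defs.v *)
From mathcomp Require Import all_boot all_order all_algebra.
From mathcomp Require Import all_classical all_reals all_analysis.
Import Order.TTheory GRing.Theory Num.Theory.
Import numFieldNormedType.Exports.

Set Implicit Arguments.
Unset Strict Implicit.
Unset Printing Implicit Defensive.

Local Open Scope classical_set_scope.
Local Open Scope ring_scope.

(** * First-order expansions of the real field and definable sets *)

(* The symbols other than those of the ordered field, with their interpretation. *)
Record expansion (R : realType) := Expansion {
  fsym : Type;
  fsym_arity : fsym -> nat;
  fsym_interp : forall f, ('I_(fsym_arity f) -> R) -> R;
  rsym : Type;
  rsym_arity : rsym -> nat;
  rsym_interp : forall r, ('I_(rsym_arity r) -> R) -> Prop
}.
Arguments fsym_arity {R} e _.
Arguments fsym_interp {R} e _ _.
Arguments rsym_arity {R} e _.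
Arguments rsym_interp {R} e _ _.

(* Every real number is a constant symbol: "definable" means "definable with
   parameters". *)
Inductive term (R : realType) (S : expansion R) : Type :=
| TVar of nat
| TCst of R
| TAdd of term S & term S
| TMul of term S & term S
| TApp (f : fsym S) of ('I_(fsym_arity S f) -> term S).
Arguments TVar {R S} _.
Arguments TCst {R S} _.

Inductive formula (R : realType) (S : expansion R) : Type :=
| FEq of term S & term S
| FLt of term S & term S
| FRel (r : rsym S) of ('I_(rsym_arity S r) -> term S)
| FNot of formula S
| FAnd of formula S & formula S
| FEx of nat & formula S.

Fixpoint eval (R : realType) (S : expansion R) (e : seq R) (t : term S) : R :=
  match t with
  | TVar i => e`_i
  | TCst a => a
  | TAdd t1 t2 => eval e t1 + eval e t2
  | TMul t1 t2 => eval e t1 * eval e t2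
  | TApp f ts => fsym_interp S f (fun i => eval e (ts i))
  end.

(* Named variables, as in [GRing.holds]: [FEx i phi] binds the variable [i]. *)
Fixpoint holds (R : realType) (S : expansion R) (e : seq R) (phi : formula S)
    : Prop :=
  match phi with
  | FEq t1 t2 => eval e t1 = eval e t2
  | FLt t1 t2 => eval e t1 < eval e t2
  | FRel r ts => rsym_interp S r (fun i => eval e (ts i))
  | FNot phi1 => ~ holds e phi1
  | FAnd phi1 phi2 => holds e phi1 /\ holds e phi2
  | FEx i phi1 => exists a : R, holds (set_nth 0 e i a) phi1
  end.

(* Free variables with index at least [n] are read as 0, which defines no new
   sets, parameters being allowed. *)
Definition definable (R : realType) (S : expansion R) (n : nat)
    (A : set 'rV[R]_n) : Prop :=
  exists phi : formula S, A = [set x | holds [seq x 0 i | i <- enum 'I_n] phi].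

Definition definable_map (R : realType) (S : expansion R) (n m : nat)
    (A : set 'rV[R]_n) (f : 'rV[R]_n -> 'rV[R]_m) : Prop :=
  definable S
    [set z : 'rV[R]_(n + m) | A (lsubmx z) /\ rsubmx z = f (lsubmx z)].

(** * O-minimality *)

(* [None] is the endpoint -oo on the left and +oo on the right. *)
Definition open_interval (T : Type) (X : set T) (lt : T -> T -> Prop)
    (a b : option T) : set T :=
  [set x | [/\ X x, (if a is Some u then lt u x else True)
                  & (if b is Some v then lt x v else True)]].

Definition in_opt (T : Type) (X : set T) (a : option T) : Prop :=
  if a is Some u then X u else True.

Definition finite_union_of_intervals_and_points (T : Type) (X : set T)
    (lt : T -> T -> Prop) (A : set T) : Prop :=
  exists F : set (set T),
    [/\ finite_set F,
        (forall B, F B ->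
           (exists2 x, X x & B = [set x]) \/
           (exists a b, [/\ in_opt X a, in_opt X b
                          & B = open_interval X lt a b]))
      & A = \bigcup_(B in F) B].

Definition o_minimal (R : realType) (S : expansion R) : Prop :=
  forall A : set R, definable S [set x : 'rV[R]_1 | A (x 0 0)] ->
    finite_union_of_intervals_and_points setT (fun x y : R => x < y) A.

(** * Cells and dimension *)

(* The part of the cylinder R^n x R lying over [B] cut out by [P]; [col' ord_max]
   forgets the last coordinate. *)
Definition cylinder_part (R : realType) (n : nat) (B : set 'rV[R]_n)
    (P : 'rV[R]_n -> R -> Prop) : set 'rV[R]_n.+1 :=
  [set z | B (col' ord_max z) /\ P (col' ord_max z) (z 0 ord_max)].

Definition definable_continuous (R : realType) (S : expansion R) (n : nat)
    (B : set 'rV[R]_n) (f : 'rV[R]_n -> R) : Prop :=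
  definable S (cylinder_part B (fun x y => y = f x)) /\
  {within B, continuous f}.

(* The bounds of a band: a definable continuous function on [B], or [None] for the
   constant function -oo (lower bound) or +oo (upper bound). *)
Definition cell_bound (R : realType) (S : expansion R) (n : nat)
    (B : set 'rV[R]_n) (f : option ('rV[R]_n -> R)) : Prop :=
  if f is Some f1 then definable_continuous S B f1 else True.

Definition band (R : realType) (n : nat) (B : set 'rV[R]_n)
    (f g : option ('rV[R]_n -> R)) : set 'rV[R]_n.+1 :=
  cylinder_part B (fun x y =>
    (if f is Some f1 then f1 x < y else True) /\
    (if g is Some g1 then y < g1 x else True)).

(* [cell S C d]: [C] is an (i_1, ..., i_n)-cell with i_1 + ... + i_n = d. *)
Inductive cell (R : realType) (S : expansion R) :
    forall n : nat, set 'rV[R]_n -> nat -> Prop :=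
| Cell0 : @cell R S 0%N setT 0%N
| CellGraph n (B : set 'rV[R]_n) d (f : 'rV[R]_n -> R) :
    cell S B d -> definable_continuous S B f ->
    cell S (cylinder_part B (fun x y => y = f x)) d
| CellBand n (B : set 'rV[R]_n) d (f g : option ('rV[R]_n -> R)) :
    cell S B d -> cell_bound S B f -> cell_bound S B g ->
    (forall f1 g1, f = Some f1 -> g = Some g1 ->
       forall x, B x -> f1 x < g1 x) ->
    cell S (band B f g) d.+1.

Definition has_dim (R : realType) (S : expansion R) (n : nat)
    (X : set 'rV[R]_n) (d : nat) : Prop :=
  (exists2 C, C `<=` X & cell S C d) /\
  (forall C k, C `<=` X -> cell S C k -> (k <= d)%N).

(** * Definable groups *)

(* The operation and the relation only matter on the carrier. *)
Record groupData (R : realType) := GroupData {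
  gdim : nat;
  carrier : set 'rV[R]_gdim;
  gmul : 'rV[R]_gdim -> 'rV[R]_gdim -> 'rV[R]_gdim
}.
Arguments carrier {R} _.
Arguments gmul {R} {_} _ _.

Record orderedGroupData (R : realType) := OrderedGroupData {
  ogroup :> groupData R;
  olt : 'rV[R]_(gdim ogroup) -> 'rV[R]_(gdim ogroup) -> Prop
}.
Arguments olt {R} {_} _ _.

Record definable_group (R : realType) (S : expansion R) (G : groupData R)
    : Prop := DefinableGroup {
  definable_carrier : definable S (carrier G);
  definable_gmul :
    definable_map S
      [set w : 'rV[R]_(gdim G + gdim G) |
         carrier G (lsubmx w) /\ carrier G (rsubmx w)]
      (fun w => gmul (lsubmx w) (rsubmx w));
  gmul_closed : forall x y,
    carrier G x -> carrier G y -> carrier G (gmul x y);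
  gmulA : forall x y z, carrier G x -> carrier G y -> carrier G z ->
    gmul x (gmul y z) = gmul (gmul x y) z;
  gmul_unit_inverse : exists e, [/\ carrier G e,
    (forall x, carrier G x -> gmul e x = x /\ gmul x e = x)
  & (forall x, carrier G x ->
       exists2 y, carrier G y & gmul y x = e /\ gmul x y = e)]
}.

Record definable_ordered_group (R : realType) (S : expansion R)
    (G : orderedGroupData R) : Prop := DefinableOrderedGroup {
  ordered_definable_group : definable_group S G;
  definable_olt :
    definable S [set w : 'rV[R]_(gdim G + gdim G) |
      [/\ carrier G (lsubmx w), carrier G (rsubmx w)
        & olt (lsubmx w) (rsubmx w)]];
  olt_irr : forall x, carrier G x -> ~ olt x x;
  olt_trans : forall x y z, carrier G x -> carrier G y -> carrier G z ->
    olt x y -> olt y z -> olt x z;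
  olt_total : forall x y, carrier G x -> carrier G y ->
    [\/ olt x y, x = y | olt y x];
  olt_mull : forall z x y, carrier G z -> carrier G x -> carrier G y ->
    olt x y -> olt (gmul z x) (gmul z y);
  olt_mulr : forall z x y, carrier G z -> carrier G x -> carrier G y ->
    olt x y -> olt (gmul x z) (gmul y z)
}.

Definition o_minimal_group (R : realType) (S : expansion R)
    (G : orderedGroupData R) : Prop :=
  [/\ definable_ordered_group S G,
      infinite_set (carrier G)
    & forall A, A `<=` carrier G -> definable S A ->
        finite_union_of_intervals_and_points (carrier G) (@olt R G) A].

Definition definable_hom (R : realType) (S : expansion R) (G H : groupData R)
    (f : 'rV[R]_(gdim G) -> 'rV[R]_(gdim H)) : Prop :=
  [/\ definable_map S (carrier G) f,
      (forall x, carrier G x -> carrier H (f x))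
    & forall x y, carrier G x -> carrier G y ->
        f (gmul x y) = gmul (f x) (f y)].

Definition definably_isomorphic (R : realType) (S : expansion R)
    (G H : groupData R) : Prop :=
  exists f, @definable_hom R S G H f /\ set_bij (carrier G) (carrier H) f.

Definition definably_ordered_isomorphic (R : realType) (S : expansion R)
    (G H : orderedGroupData R) : Prop :=
  [/\ definable_ordered_group S G, definable_ordered_group S H
    & exists f, [/\ @definable_hom R S G H f,
        set_bij (carrier G) (carrier H) f
      & forall x y, carrier G x -> carrier G y ->
          (olt x y <-> olt (f x) (f y))]].

(** * Extensions of the additive group *)

Definition additive_group (R : realType) (n : nat) : groupData R :=
  @GroupData R n setT (fun x y => x + y).

(* 1 -> (R,+) --i--> G --p--> (R,+) -> 1 *)
Definition definable_extension (R : realType) (S : expansion R)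
    (G : groupData R) (i : 'rV[R]_1 -> 'rV[R]_(gdim G))
    (p : 'rV[R]_(gdim G) -> 'rV[R]_1) : Prop :=
  definable_group S G /\
  [/\ @definable_hom R S (additive_group R 1) G i,
      @definable_hom R S G (additive_group R 1) p,
      injective i,
      (forall r, exists2 g, carrier G g & p g = r)
    & forall g, carrier G g -> (p g = 0 <-> exists r, i r = g)].

Definition abelian_group (R : realType) (G : groupData R) : Prop :=
  forall x y, carrier G x -> carrier G y -> gmul x y = gmul y x.

Definition splits (R : realType) (S : expansion R) (G : groupData R)
    (p : 'rV[R]_(gdim G) -> 'rV[R]_1) : Prop :=
  exists2 s, @definable_hom R S (additive_group R 1) G s
           & forall r, p (s r) = r.

(** * The model groups *)

Definition revlex (R : realType) (x y : 'rV[R]_2) : Prop :=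
  x 0 1 < y 0 1 \/ (x 0 1 = y 0 1 /\ x 0 0 < y 0 0).

Definition plane (R : realType) : orderedGroupData R :=
  @OrderedGroupData R (additive_group R 2) (@revlex R).

Definition semidirect_mul (R : realType) (eps : R) (z1 z2 : 'rV[R]_2)
    : 'rV[R]_2 :=
  \row_i (if i == 0 then z1 0 0 + expR (eps * z1 0 1) * z2 0 0
          else z1 0 1 + z2 0 1).

Definition semidirect (R : realType) (eps : R) : orderedGroupData R :=
  @OrderedGroupData R (@GroupData R 2 setT (semidirect_mul eps)) (@revlex R).

(* Main.v *)
(* Over the real numbers o-minimality can be exploited through countability: an
   infinite definable subset of the line contains an interval, so it is
   uncountable; hence, when countably many definable sets cover a box, one of
   them contains a box. This replaces cell decomposition in the dimension theory.

   The elements of G whose interval to 1 has dimension less than 2 form a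
   definable convex normal subgroup H. By a Fubini argument H has dimension less
   than 2. If H were trivial, order rays would be open in a planar chart, which
   is impossible since removing a point does not disconnect the plane. So H and
   G/H are one-dimensional, hence o-minimal, hence isomorphic to the additive
   group. Comparing the latter with the multiplicative group of the positive
   reals makes the exponential function definable. So G is an extension of the
   line by the line, with action x |-> e^(c y) x since definable homomorphisms are
   linear. If c = 0 the group is abelian and the extension splits by hypothesis;
   otherwise the centralizer of an element outside H is a complement of H, and
   rescaling makes c = 1 or c = -1. *)
Require Import Defs.
From mathcomp Require Import all_boot all_order all_algebra.
From mathcomp Require Import all_classical all_reals all_analysis.
From mathcomp Require Import ring lra.
Import Order.TTheory GRing.Theory Num.Theory.
Import numFieldNormedType.Exports.

Set Implicit Arguments.
Unset Strict Implicit.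
Unset Printing Implicit Defensive.

Local Open Scope classical_set_scope.
Local Open Scope ring_scope.

(** * The calculus of definable predicates and functions *)

(** The order of [G] need not be related to the topology of the ambient space. The two are compared
    only generically, by charts, and translations carry the outcome where it is needed. Dimension is
    kept in two opposite forms: [emb] asks for a definable injection of a box, [thin] for countably
    many definable pieces that inject into a lower power of the line. Allowing countably many pieces
    makes upper bounds easy to produce, and the uncountability of intervals still makes the two
    forms exclude each other. Cells enter only where the hypothesis [has_dim] is translated into
    these forms. The main obstacle is that the isomorphism hypothesis concerns groups whose
    definable subsets are finite unions of intervals with end points in the group. For [H] and the
    quotient this must be proved: finiteness of boundaries comes from charts, but a definable cut
    might still have no end point, and excluding this uses the group structure again. Moreover the
    hypothesis yields isomorphisms of groups, not of ordered groups, so the orientation has to be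
    adjusted afterwards. *)

Class Sp (R : realType) (T : Type) := MkSp {
  sz : nat;
  enc : T -> seq R;
  dec : seq R -> T;
  size_enc : forall x, size (enc x) = sz;
  encK : forall x, dec (enc x) = x;
  decK : forall s, size s = sz -> enc (dec s) = s
}.
Arguments sz {R} T {_}.
Arguments size_enc {R T _} x.

#[export] Instance Sp_unit (R : realType) : Sp R unit.
Proof.
refine (@MkSp R unit 0 (fun _ => [::]) (fun _ => tt) _ _ _) => //.
- by case.
- by case.
Defined.

#[export] Instance Sp_real (R : realType) : Sp R R.
Proof.
refine (@MkSp R R 1 (fun x => [:: x]) (fun s => s`_0) _ _ _) => //.
by move=> [|x [|y s]].
Defined.

#[export] Instance Sp_prod (R : realType) (T U : Type) (sT : Sp R T) (sU : Sp R U) :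
  Sp R (T * U).
Proof.
refine (@MkSp R _ (sz T + sz U) (fun p => enc p.1 ++ enc p.2)
  (fun s => (dec (take (sz T) s), dec (drop (sz T) s))) _ _ _).
- by move=> x; rewrite size_cat !size_enc.
- by move=> [x y] /=; rewrite -(size_enc x) take_size_cat // drop_size_cat // !encK.
- move=> s hs /=; rewrite !decK ?cat_take_drop //.
  + by rewrite size_drop hs addKn.
  + by rewrite size_takel // hs leq_addr.
Defined.

#[export] Instance Sp_row (R : realType) (n : nat) : Sp R 'rV[R]_n.
Proof.
refine (@MkSp R _ n (fun x : 'rV[R]_n => [seq x 0 i | i <- enum 'I_n])
  (fun s => \row_i s`_i) _ _ _).
- by move=> x; rewrite size_map size_enum_ord.
- move=> x; apply/rowP => i; rewrite mxE (nth_map i) ?size_enum_ord //.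
  by rewrite nth_ord_enum.
- move=> s hs; apply: (@eq_from_nth _ 0); first by rewrite size_map size_enum_ord.
  move=> i; rewrite size_map size_enum_ord => hi.
  by rewrite (nth_map (Ordinal hi)) ?size_enum_ord // mxE nth_enum_ord.
Defined.

(** Nested pairs instead of row vectors: arguments on boxes are inductions that split off the last
    coordinate, which a pair provides without index arithmetic. *)
Fixpoint Rn (R : realType) (d : nat) : Type :=
  if d is d'.+1 then (Rn R d' * R)%type else unit.

Arguments Rn : simpl never.

#[export] Instance Sp_Rn (R : realType) (d : nat) : Sp R (Rn R d).
Proof. by elim: d => [|d IHd]; [exact: Sp_unit | exact: Sp_prod]. Defined.

Section Definability.
Context {R : realType} (S : expansion R).

Fixpoint tshift (n : nat) (t : term S) : term S :=
  match t with
  | TVar i => TVar (n + i)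
  | TCst a => TCst a
  | TAdd t1 t2 => TAdd (tshift n t1) (tshift n t2)
  | TMul t1 t2 => TMul (tshift n t1) (tshift n t2)
  | @TApp _ _ f ts => @TApp R S f (fun i => tshift n (ts i))
  end.

Fixpoint fshift (n : nat) (phi : formula S) : formula S :=
  match phi with
  | FEq t1 t2 => FEq (tshift n t1) (tshift n t2)
  | FLt t1 t2 => FLt (tshift n t1) (tshift n t2)
  | @FRel _ _ r ts => @FRel R S r (fun i => tshift n (ts i))
  | FNot phi1 => FNot (fshift n phi1)
  | FAnd phi1 phi2 => FAnd (fshift n phi1) (fshift n phi2)
  | FEx i phi1 => FEx (n + i) (fshift n phi1)
  end.

Lemma eval_shift n (e e' : seq R) (t : term S) :
  (forall i, e`_(n + i) = e'`_i) -> Defs.eval e (tshift n t) = Defs.eval e' t.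
Proof.
move=> he; elim: t => //= [t1 -> t2 -> //|t1 -> t2 -> //|f ts IH].
by congr (fsym_interp _ _ _); apply/funext => i; rewrite IH.
Qed.

Lemma holds_shift n (phi : formula S) : forall e e' : seq R,
  (forall i, e`_(n + i) = e'`_i) -> holds e (fshift n phi) <-> holds e' phi.
Proof.
elim: phi => /= [t1 t2|t1 t2|r ts|phi IH|phi1 IH1 phi2 IH2|k phi IH] e e' he.
- by rewrite !(eval_shift _ he).
- by rewrite !(eval_shift _ he).
- suff -> : (fun i => Defs.eval e (tshift n (ts i))) = (fun i => Defs.eval e' (ts i)) by [].
  by apply/funext => i; rewrite (eval_shift _ he).
- by rewrite (IH _ _ he).
- by rewrite (IH1 _ _ he) (IH2 _ _ he).
- have h a i : (set_nth 0 e (n + k) a)`_(n + i) = (set_nth 0 e' k a)`_i.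
    by rewrite !nth_set_nth /= eqn_add2l he.
  by split=> -[a ha]; exists a; move: ha; rewrite (IH _ _ (h a)).
Qed.

Fixpoint fexists (n m : nat) (phi : formula S) : formula S :=
  if m is m'.+1 then FEx n (fexists n.+1 m' phi) else phi.

Lemma set_nth_size (e : seq R) a : set_nth 0 e (size e) a = rcons e a.
Proof. by elim: e => //= x e ->. Qed.

Lemma holds_fexists m : forall n (e : seq R) phi, size e = n ->
  holds e (fexists n m phi) <-> exists2 s, size s = m & holds (e ++ s) phi.
Proof.
elim: m => [|m IH] n e phi he /=.
  split=> [h|[s /size0nil -> ]]; last by rewrite cats0.
  by exists [::]; rewrite ?cats0.
split=> [[a]|[[//|a s] [hs] h]].
- rewrite -he set_nth_size => /(IH _ (rcons e a)); rewrite he size_rcons he.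
  by case=> // s hs; rewrite cat_rcons => h; exists (a :: s); rewrite //= hs.
- exists a; rewrite -{1}he set_nth_size; apply/IH; first by rewrite size_rcons he.
  by exists s => //; rewrite cat_rcons.
Qed.

(** Stated for any type with a coordinate encoding, so that nested pairs can serve as contexts of
    several variables; for row vectors the encoding is the one in [definable]. *)
Definition Dp (T : Type) {sT : Sp R T} (P : T -> Prop) : Prop :=
  exists phi : formula S, forall x, P x <-> holds (enc x) phi.

Definition Df (T U : Type) {sT : Sp R T} {sU : Sp R U} (f : T -> U) : Prop :=
  Dp (fun p : T * U => p.2 = f p.1).

Lemma definableP n (A : set 'rV[R]_n) : definable S A <-> Dp A.
Proof.
split=> -[phi h]; exists phi; first by move=> x; rewrite h.
by apply/seteqP; split=> x /= /h.
Qed.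

Section Basic.
Context (T : Type) (sT : Sp R T).
Implicit Types P Q : T -> Prop.

Lemma Dp_ext P Q : (forall x, P x <-> Q x) -> Dp P -> Dp Q.
Proof. by move=> h [phi hphi]; exists phi => x; rewrite -h. Qed.

Lemma Dp_not P : Dp P -> Dp (fun x => ~ P x).
Proof. by move=> [phi h]; exists (FNot phi) => x /=; rewrite h. Qed.

Lemma Dp_and P Q : Dp P -> Dp Q -> Dp (fun x => P x /\ Q x).
Proof. by move=> [p hp] [q hq]; exists (FAnd p q) => x /=; rewrite hp hq. Qed.

Lemma Dp_and3 P Q P3 : Dp P -> Dp Q -> Dp P3 -> Dp (fun x => [/\ P x, Q x & P3 x]).
Proof.
move=> h1 h2 h3; apply: Dp_ext (Dp_and h1 (Dp_and h2 h3)) => x.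
by split=> [[? []]|[]].
Qed.

Lemma Dp_and4 P Q P3 P4 : Dp P -> Dp Q -> Dp P3 -> Dp P4 ->
  Dp (fun x => [/\ P x, Q x, P3 x & P4 x]).
Proof.
move=> h1 h2 h3 h4; apply: Dp_ext (Dp_and h1 (Dp_and3 h2 h3 h4)) => x.
by split=> [[? []]|[]].
Qed.

Lemma Dp_or P Q : Dp P -> Dp Q -> Dp (fun x => P x \/ Q x).
Proof.
move=> hP hQ; apply: (@Dp_ext (fun x => ~ (~ P x /\ ~ Q x))).
  by move=> x; case: (pselect (P x)); case: (pselect (Q x)); tauto.
by apply: Dp_not; apply: Dp_and; apply: Dp_not.
Qed.

Lemma Dp_imp P Q : Dp P -> Dp Q -> Dp (fun x => P x -> Q x).
Proof.
move=> hP hQ; apply: (@Dp_ext (fun x => ~ P x \/ Q x)); first by move=> x; case: (pselect (P x)); tauto.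
by apply: Dp_or => //; apply: Dp_not.
Qed.

Lemma Dp_iff P Q : Dp P -> Dp Q -> Dp (fun x => P x <-> Q x).
Proof. by move=> hP hQ; apply: Dp_and; apply: Dp_imp. Qed.

Lemma Dp_cst (A : Prop) : Dp (fun _ : T => A).
Proof.
case: (pselect A) => hA.
  by exists (FEq (TCst 0) (TCst 0)) => x /=; split.
by exists (FLt (TCst 0) (TCst 0)) => x /=; rewrite ltxx.
Qed.

Lemma Dp_all_seq (I : eqType) (s : seq I) (P : I -> T -> Prop) :
  (forall i, Dp (P i)) -> Dp (fun x => forall i, i \in s -> P i x).
Proof.
move=> h; elim: s => [|a s IH].
  by apply: Dp_ext (Dp_cst True) => x; split.
apply: Dp_ext (Dp_and (h a) IH) => x; split=> [[ha hs] i|hi].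
  by rewrite inE => /orP[/eqP->|/hs].
by split=> [|i si]; apply: hi; rewrite inE ?eqxx // si orbT.
Qed.

Lemma Dp_all_fin (I : finType) (P : I -> T -> Prop) :
  (forall i, Dp (P i)) -> Dp (fun x => forall i, P i x).
Proof.
move=> h; apply: Dp_ext (Dp_all_seq (enum I) h) => x.
by split=> hx i; [apply: hx; rewrite mem_enum | move=> _; exact: hx].
Qed.

End Basic.

Lemma Dp_ex (T : Type) (sT : Sp R T) (U : Type) (sU : Sp R U) (P : T -> U -> Prop) :
  Dp (fun p : T * U => P p.1 p.2) -> Dp (fun x => exists y, P x y).
Proof.
move=> [phi h]; exists (fexists (sz T) (sz U) phi) => x.
rewrite holds_fexists ?size_enc //; split=> [[y /(h (x, y)) hy]|[s hs hx]].
  by exists (enc y); rewrite ?size_enc.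
by exists (dec s); apply/(h (x, dec s)); rewrite /= decK.
Qed.

Lemma Dp_ex2 (T : Type) (sT : Sp R T) (U : Type) (sU : Sp R U) (P Q : T -> U -> Prop) :
  Dp (fun p : T * U => P p.1 p.2 /\ Q p.1 p.2) ->
  Dp (fun x => exists2 y, P x y & Q x y).
Proof.
move=> /(@Dp_ex _ _ _ _ (fun x y => P x y /\ Q x y)); apply: Dp_ext => x.
by split=> [[y [h1 h2]]|[y h1 h2]]; exists y.
Qed.

Lemma Dp_all (T : Type) (sT : Sp R T) (U : Type) (sU : Sp R U) (P : T -> U -> Prop) :
  Dp (fun p : T * U => P p.1 p.2) -> Dp (fun x => forall y, P x y).
Proof.
move=> h; apply: Dp_ext (Dp_not (@Dp_ex _ _ _ _ (fun x y => ~ P x y) (Dp_not h))) => x.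
by split=> [hn y|hy [y]]; [apply: contrapT => hy; apply: hn; exists y | apply].
Qed.

(** Since [f] is known only through its graph, substitution is replaced by an existential quantifier
    over the value, with the formula of [P] shifted past the coordinates of [x]. *)
Lemma Dp_comp (T U : Type) (sT : Sp R T) (sU : Sp R U) (P : U -> Prop) (f : T -> U) :
  Dp P -> Df f -> Dp (fun x => P (f x)).
Proof.
move=> [phi h] hf.
apply: (@Dp_ext _ _ (fun x => exists y, y = f x /\ P y)).
  by move=> x; split=> [[y [-> //]]|hx]; exists (f x).
apply: Dp_ex; apply: Dp_and; first exact: hf.
exists (fshift (sz T) phi) => -[x y] /=; rewrite h; symmetry; apply: holds_shift => i.
by rewrite nth_cat size_enc ltnNge leq_addr /= addKn.
Qed.

(** The tail [s] is there because the graph is a formula in the coordinates of [x] followed by those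
    of the value. *)
Lemma Df_terms (T U : Type) (sT : Sp R T) (sU : Sp R U) (f : T -> U)
    (t : nat -> term S) :
  (forall x s i, (i < sz U)%N -> Defs.eval (enc x ++ s) (t i) = (enc (f x))`_i) -> Df f.
Proof.
move=> ht; pose P (i : 'I_(@sz R U sU)) (p : T * U) :=
  (@enc R U sU p.2)`_i = (@enc R U sU (f p.1))`_i.
rewrite /Df; apply: (@Dp_ext _ _ (fun p => forall i, P i p)).
  move=> [x y]; split=> [h /=|h i]; last by rewrite /P h.
  rewrite -[y]encK -[f x]encK; congr dec.
  apply: (@eq_from_nth _ 0); rewrite !size_enc // => i hi.
  exact: (h (Ordinal hi)).
apply: Dp_all_fin => i; exists (FEq (TVar (sz T + i)) (t i)) => -[x y] /=.
by rewrite ht // nth_cat size_enc ltnNge leq_addr /= addKn.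
Qed.

Lemma Df_id (T : Type) (sT : Sp R T) : Df (fun x : T => x).
Proof.
by apply: (@Df_terms _ _ _ _ _ (@TVar R S)) => x s i hi /=; rewrite nth_cat size_enc hi.
Qed.

Lemma Df_cst (T U : Type) (sT : Sp R T) (sU : Sp R U) (c : U) : Df (fun _ : T => c).
Proof. by apply: (@Df_terms _ _ _ _ _ (fun i => TCst (enc c)`_i)). Qed.

Lemma Df_fst_aux (T U V : Type) (sT : Sp R T) (sU : Sp R U) (sV : Sp R V)
    (f : T -> V) : Df f -> Df (fun p : T * U => f p.1).
Proof.
move=> hf; apply: (@Dp_comp _ _ _ _ (fun q : T * V => q.2 = f q.1)
  (fun p : T * U * V => (p.1.1, p.2)) hf).
(* The variables of [T] keep their place; those of [V] lie beyond the block of [U], which the index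
   jumps over. *)
apply: (@Df_terms _ _ _ _ _ (fun i => TVar (if (i < sz T)%N then i else (i + sz U)%N))).
move=> [[x y] z] s i /= hi; rewrite -!catA !nth_cat !size_enc.
case: (ltnP i (sz T)) => hT; first by rewrite hT.
rewrite ltnNge (leq_trans hT (leq_addr _ _)) /=.
rewrite ltnNge -addnBAC // leq_addl /= addnK.
by rewrite ltn_subLR // hi.
Qed.

Lemma Df_pair (T U V : Type) (sT : Sp R T) (sU : Sp R U) (sV : Sp R V)
    (f : T -> U) (g : T -> V) : Df f -> Df g -> Df (fun x => (f x, g x)).
Proof.
move=> hf hg; rewrite /Df; apply: (@Dp_ext _ _
  (fun p : T * (U * V) => p.2.1 = f p.1 /\ p.2.2 = g p.1)).
  by move=> [x [y z]] /=; split=> [[-> -> //]|[-> ->]].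
apply: Dp_and.
- apply: (@Dp_comp _ _ _ _ (fun q : T * U => q.2 = f q.1)
    (fun p : T * (U * V) => (p.1, p.2.1)) hf).
  apply: (@Df_terms _ _ _ _ _ (@TVar R S)) => -[x [y z]] s i hi /=.
  by rewrite -!catA catA nth_cat size_cat !size_enc hi.
- apply: (@Dp_comp _ _ _ _ (fun q : T * V => q.2 = g q.1)
    (fun p : T * (U * V) => (p.1, p.2.2)) hg).
  apply: (@Df_terms _ _ _ _ _ (fun i => TVar (if (i < sz T)%N then i else (i + sz U)%N))).
  move=> [x [y z]] s i /= hi; rewrite -!catA !nth_cat !size_enc.
  case: (ltnP i (sz T)) => hT; first by rewrite hT.
  rewrite ltnNge (leq_trans hT (leq_addr _ _)) /=.
  rewrite ltnNge -addnBAC // leq_addl /= addnK.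
  by rewrite ltn_subLR // hi.
Qed.

Lemma Df_snd_aux (T U : Type) (sT : Sp R T) (sU : Sp R U) :
  Df (fun p : T * U => p.2).
Proof.
apply: (@Df_terms _ _ _ _ _ (fun i => TVar (sz T + i))) => -[x y] s i hi /=.
by rewrite -catA nth_cat size_enc ltnNge leq_addr /= addKn nth_cat size_enc hi.
Qed.

Lemma Df_comp (T U V : Type) (sT : Sp R T) (sU : Sp R U) (sV : Sp R V)
    (g : U -> V) (f : T -> U) : Df g -> Df f -> Df (fun x => g (f x)).
Proof.
move=> hg hf; apply: (@Dp_comp _ _ _ _ (fun q : U * V => q.2 = g q.1)
  (fun p : T * V => (f p.1, p.2)) hg).
by apply: Df_pair; [exact: Df_fst_aux | exact: Df_snd_aux].
Qed.

Section Combinators.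
Context (T : Type) (sT : Sp R T).

Lemma Df_fst (U V : Type) (sU : Sp R U) (sV : Sp R V) (f : T -> U * V) :
  Df f -> Df (fun x => (f x).1).
Proof. exact: (@Df_comp _ _ _ _ _ _ (fun p : U * V => p.1) f (Df_fst_aux _ (Df_id _))). Qed.

Lemma Df_snd (U V : Type) (sU : Sp R U) (sV : Sp R V) (f : T -> U * V) :
  Df f -> Df (fun x => (f x).2).
Proof. exact: (@Df_comp _ _ _ _ _ _ (fun p : U * V => p.2) f (Df_snd_aux _ _)). Qed.

Lemma Dp_eq (U : Type) (sU : Sp R U) (f g : T -> U) :
  Df f -> Df g -> Dp (fun x => f x = g x).
Proof.
move=> hf hg; apply: (@Dp_comp _ _ _ _ (fun p : U * U => p.2 = p.1)
  (fun x => (g x, f x)) (@Df_id U sU)).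
exact: Df_pair.
Qed.

Lemma Df_add (f g : T -> R) : Df f -> Df g -> Df (fun x => f x + g x).
Proof.
move=> hf hg; apply: (@Df_comp _ _ _ _ _ _ (fun p : R * R => p.1 + p.2)
  (fun x => (f x, g x))); last exact: Df_pair.
by apply: (@Df_terms _ _ _ _ _ (fun i => TAdd (TVar 0) (TVar 1))) => x s [|].
Qed.

Lemma Df_mul (f g : T -> R) : Df f -> Df g -> Df (fun x => f x * g x).
Proof.
move=> hf hg; apply: (@Df_comp _ _ _ _ _ _ (fun p : R * R => p.1 * p.2)
  (fun x => (f x, g x))); last exact: Df_pair.
by apply: (@Df_terms _ _ _ _ _ (fun i => TMul (TVar 0) (TVar 1))) => x s [|].
Qed.

Lemma Df_opp (f : T -> R) : Df f -> Df (fun x => - f x).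
Proof.
move=> hf; have -> : (fun x => - f x) = (fun x => -1 * f x).
  by apply/funext => x; rewrite mulN1r.
by apply: Df_mul => //; exact: Df_cst.
Qed.

Lemma Dp_lt (f g : T -> R) : Df f -> Df g -> Dp (fun x => f x < g x).
Proof.
move=> hf hg; apply: (@Dp_comp _ _ _ _ (fun p : R * R => p.1 < p.2)
  (fun x => (f x, g x))); last exact: Df_pair.
by exists (FLt (TVar 0) (TVar 1)) => x.
Qed.

Lemma Dp_le (f g : T -> R) : Df f -> Df g -> Dp (fun x => f x <= g x).
Proof.
move=> hf hg; apply: Dp_ext (Dp_not (Dp_lt hg hf)) => x.
by rewrite leNgt; split=> [/negP //|/negP].
Qed.

Lemma Df_if (U : Type) (sU : Sp R U) (P : T -> Prop) (f g : T -> U) :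
  Dp P -> Df f -> Df g -> Df (fun x => if `[< P x >] then f x else g x).
Proof.
move=> hP hf hg; rewrite /Df; apply: (@Dp_ext _ _ (fun p : T * U =>
  (P p.1 /\ p.2 = f p.1) \/ (~ P p.1 /\ p.2 = g p.1))).
  by move=> [x y] /=; case: asboolP => hx; tauto.
have hP1 : Dp (fun p : T * U => P p.1).
  exact: (Dp_comp hP (Df_fst_aux _ (Df_id _))).
by apply: Dp_or; apply: Dp_and => //; apply: Dp_not.
Qed.

Lemma Df_coord n (f : T -> 'rV[R]_n) (i : 'I_n) : Df f -> Df (fun x => f x 0 i).
Proof.
move=> hf; apply: (@Df_comp _ _ _ _ _ _ (fun v : 'rV[R]_n => v 0 i) f) => //.
apply: (@Df_terms _ _ _ _ _ (fun _ => TVar i)) => x s [|//] _ /=.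
rewrite nth_cat size_map size_enum_ord ltn_ord.
by rewrite (nth_map i) ?size_enum_ord // nth_ord_enum.
Qed.

End Combinators.

Section Rows.
Context (T : Type) (sT : Sp R T).

Lemma Df_row n (f : T -> 'rV[R]_n) : (forall i, Df (fun x => f x 0 i)) -> Df f.
Proof.
move=> hf; rewrite /Df; apply: (@Dp_ext _ _ (fun p : T * 'rV[R]_n => forall i, p.2 0 i = f p.1 0 i)).
  move=> [x y]; split=> [h|/= -> //]; exact/rowP.
apply: Dp_all_fin => i; apply: Dp_eq; last exact: (Df_fst_aux _ (hf i)).
exact: Df_coord (Df_snd_aux _ _).
Qed.

Lemma Df_lsubmx n m (f : T -> 'rV[R]_(n + m)) : Df f -> Df (fun x => lsubmx (f x)).
Proof.
move=> hf; apply: Df_row => i.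
have -> : (fun x => lsubmx (f x) 0 i) = (fun x => f x 0 (lshift m i)).
  by apply/funext => x; rewrite mxE.
exact: Df_coord.
Qed.

Lemma Df_rsubmx n m (f : T -> 'rV[R]_(n + m)) : Df f -> Df (fun x => rsubmx (f x)).
Proof.
move=> hf; apply: Df_row => i.
have -> : (fun x => rsubmx (f x) 0 i) = (fun x => f x 0 (rshift n i)).
  by apply/funext => x; rewrite mxE.
exact: Df_coord.
Qed.

Lemma Df_row_mx n m (f : T -> 'rV[R]_n) (g : T -> 'rV[R]_m) :
  Df f -> Df g -> Df (fun x => row_mx (f x) (g x)).
Proof.
move=> hf hg; apply: Df_row => i; case: (split_ordP i) => j ->.
  have -> : (fun x => row_mx (f x) (g x) 0 (lshift m j)) = (fun x => f x 0 j).
    by apply/funext => x; rewrite row_mxEl.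
  exact: Df_coord.
have -> : (fun x => row_mx (f x) (g x) 0 (rshift n j)) = (fun x => g x 0 j).
  by apply/funext => x; rewrite row_mxEr.
exact: Df_coord.
Qed.

Lemma Df_col' n (f : T -> 'rV[R]_n.+1) : Df f -> Df (fun x => col' ord_max (f x)).
Proof.
move=> hf; apply: Df_row => i.
have -> : (fun x => col' ord_max (f x) 0 i) = (fun x => f x 0 (lift ord_max i)).
  by apply/funext => x; rewrite mxE.
exact: Df_coord.
Qed.

End Rows.

Definition Dp2 (T U : Type) {sT : Sp R T} {sU : Sp R U} (P : T -> U -> Prop) :=
  Dp (fun p : T * U => P p.1 p.2).

Definition Df2 (T U V : Type) {sT : Sp R T} {sU : Sp R U} {sV : Sp R V}
  (f : T -> U -> V) := Df (fun p : T * U => f p.1 p.2).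

Lemma Dp2_comp (V T U : Type) (sV : Sp R V) (sT : Sp R T) (sU : Sp R U)
    (P : T -> U -> Prop) (f : V -> T) (g : V -> U) :
  Dp2 P -> Df f -> Df g -> Dp (fun x => P (f x) (g x)).
Proof.
move=> hP hf hg.
exact: (@Dp_comp _ _ _ _ _ (fun x => (f x, g x)) hP (Df_pair hf hg)).
Qed.

Lemma Df2_comp (V T U W : Type) (sV : Sp R V) (sT : Sp R T) (sU : Sp R U) (sW : Sp R W)
    (h : T -> U -> W) (f : V -> T) (g : V -> U) :
  Df2 h -> Df f -> Df g -> Df (fun x => h (f x) (g x)).
Proof.
move=> hh hf hg.
exact: (@Df_comp _ _ _ _ _ _ (fun p => h p.1 p.2) (fun x => (f x, g x)) hh (Df_pair hf hg)).
Qed.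

End Definability.

(* Extended below each time a new definable operation becomes available. *)
Ltac dp_ext := fail.

(** Reads definability off the syntax of a predicate or function; the last two clauses eta-expand a
    bare one so that the others can match. *)
Ltac dp1 :=
  cbv beta delta [mkset];
  match goal with
  | |- forall _, _ => intro
  | |- Dp2 _ _ => red
  | |- Df2 _ _ => red
  | |- Dp _ _ => assumption
  | |- Df _ _ => assumption
  | |- Dp _ (fun _ => ?A) => eapply Dp_cst
  | |- Dp _ (fun _ => ~ _) => eapply Dp_not
  | |- Dp _ (fun _ => _ /\ _) => eapply Dp_and
  | |- Dp _ (fun _ => and3 _ _ _) => eapply Dp_and3
  | |- Dp _ (fun _ => and4 _ _ _ _) => eapply Dp_and4
  | |- Dp _ (fun _ => _ <-> _) => eapply Dp_iff
  | |- Dp _ (fun _ => _ \/ _) => eapply Dp_or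
  | |- Dp _ (fun _ => _ = _) => eapply Dp_eq
  | |- Dp _ (fun _ => is_true (_ < _)) => eapply Dp_lt
  | |- Dp _ (fun _ => is_true (_ <= _)) => eapply Dp_le
  | |- Dp _ (fun _ => ex _) => eapply Dp_ex
  | |- Dp _ (fun _ => ex2 _ _) => eapply Dp_ex2
  | |- Dp _ (fun _ => _ -> _) => eapply Dp_imp
  | |- Dp _ (fun _ => forall x : ordinal _, _) => eapply Dp_all_fin
  | |- Dp _ (fun _ => forall x, _) => eapply Dp_all
  | |- Df _ (fun x => x) => eapply Df_id
  | |- Df _ (fun _ => ?c) => eapply Df_cst
  | H : Dp _ ?P |- Dp _ (fun e => ?P (@?f e)) => eapply (Dp_comp H)
  | H : Dp2 _ ?P |- Dp _ (fun e => ?P (@?f e) (@?g e)) => eapply (Dp2_comp H)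
  | H : Df _ ?h |- Df _ (fun e => ?h (@?f e)) => eapply (Df_comp H)
  | H : Df2 _ ?h |- Df _ (fun e => ?h (@?f e) (@?g e)) => eapply (Df2_comp H)
  | |- _ => dp_ext
  | |- Df _ fst => eapply Df_fst; eapply Df_id
  | |- Df _ snd => eapply Df_snd; eapply Df_id
  | |- Df _ (pair _) => eapply Df_pair
  | H : Dp2 _ ?P |- Dp _ (?P _) => eapply (Dp2_comp H)
  | H : Df2 _ ?h |- Df _ (?h _) => eapply (Df2_comp H)
  | |- Df _ (fun _ => (_, _)) => eapply Df_pair
  | |- Df _ (fun _ => _.1) => eapply Df_fst
  | |- Df _ (fun _ => _.2) => eapply Df_snd
  | |- Df _ (fun _ => _ + _) => eapply Df_add
  | |- Df _ (fun _ => _ * _) => eapply Df_mul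
  | |- Df _ (fun _ => - _) => eapply Df_opp
  | |- Df _ (fun _ => if `[< _ >] then _ else _) => eapply Df_if
  | |- Df _ (fun _ => lsubmx _) => eapply Df_lsubmx
  | |- Df _ (fun _ => rsubmx _) => eapply Df_rsubmx
  | |- Df _ (fun _ => row_mx _ _) => eapply Df_row_mx
  | |- Df _ (fun _ => col' ord_max _) => eapply Df_col'
  | |- Df _ (fun _ => fun_of_matrix _ _ _) => eapply Df_coord
  | |- @Df ?R ?S ?T ?U ?sT ?sU ?f =>
      lazymatch f with
      | (fun _ => _) => fail
      | _ => change (@Df R S T U sT sU (fun x => f x))
      end
  | |- @Dp ?R ?S ?T ?sT ?P =>
      lazymatch P with
      | (fun _ => _) => fail
      | _ => change (@Dp R S T sT (fun x => P x))
      end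
  end.
Ltac dp := repeat dp1.

Existing Class o_minimal.

(** * Definable subsets of the line and boxes *)

Lemma finite_set_rect (T : Type) (P : set T -> Prop) :
  P set0 -> (forall x A, P A -> P (x |` A)) -> forall A, finite_set A -> P A.
Proof.
elim/Pchoice: T => T in P * => P0 PU A /finite_seqP[s ->{A}].
elim: s => [|x s IH]; first by have -> : [set` [::]] = set0 :> set T by apply/seteqP; split.
have -> : [set` x :: s] = x |` [set` s] :> set T; last exact: PU.
apply/seteqP; split=> y /=; rewrite inE; first by case/orP => [/eqP|]; [left|right].
by case=> [->|->]; rewrite ?eqxx ?orbT.
Qed.

(** For definable sets this is infinity ([fatP]), but unlike infinity it is a first-order condition
    and may occur inside formulas with parameters. *)
Definition fat (R : realType) (A : R -> Prop) : Prop :=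
  exists a b, a < b /\ forall y, a < y -> y < b -> A y.

Section Line.
Context {R : realType} {S : expansion R} {S_omin : o_minimal S}.
Implicit Types A B : R -> Prop.

Lemma omin_union A : Dp S A ->
  finite_union_of_intervals_and_points setT (fun x y : R => x < y) A.
Proof.
move=> hA; apply: S_omin; apply/definableP => /=.
exact: (@Dp_comp _ _ _ _ _ _ A (fun x : 'rV[R]_1 => x 0 0) hA (Df_coord _ (Df_id _ _))).
Qed.

Lemma open_interval_nbhs (a b : option R) x :
  open_interval setT (fun x y : R => x < y) a b x ->
  exists2 e, 0 < e & forall y, `|y - x| < e ->
    open_interval setT (fun x y : R => x < y) a b y.
Proof.
move=> [_ ha hb].
have [e1 e1_gt0 h1] : exists2 e, 0 < e &
    forall y, `|y - x| < e -> if a is Some u then is_true (u < y) else True.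
  case: a ha => [u hu|_]; last by exists 1.
  by exists (x - u); [lra | move=> y; rewrite ltr_norml => /andP[]; lra].
have [e2 e2_gt0 h2] : exists2 e, 0 < e &
    forall y, `|y - x| < e -> if b is Some u then is_true (y < u) else True.
  case: b hb => [u hu|_]; last by exists 1.
  by exists (u - x); [lra | move=> y; rewrite ltr_norml => /andP[]; lra].
exists (Num.min e1 e2); first by rewrite lt_min e1_gt0.
by move=> y; rewrite lt_min => /andP[/h1 ? /h2 ?]; split.
Qed.

(** The local form of o-minimality, to the right of a point; germs to the left are obtained by
    reflecting the set. *)
Definition germ A := forall x, exists2 e, 0 < e &
  (forall y, x < y -> y < x + e -> A y) \/ (forall y, x < y -> y < x + e -> ~ A y).

Lemma Dp_germ A : Dp S A -> germ A.
Proof.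
move=> /omin_union[F [Ffin FB ->]]; move: F Ffin FB.
apply: finite_set_rect => [_ x|B F IH FB x].
  by exists 1 => //; right=> y _ _ [].
have [e1 e1_gt0 h1] := IH (fun B FB' => FB _ (or_intror FB')) x.
suff [e2 e2_gt0 h2] : exists2 e, 0 < e &
    (forall y, x < y -> y < x + e -> B y) \/ (forall y, x < y -> y < x + e -> ~ B y).
  exists (Num.min e1 e2); first by rewrite lt_min e1_gt0.
  rewrite bigcup_setU1.
  case: h1 => h1.
    by left=> y xy; rewrite -ltrBlDl lt_min => /andP[] *; right; apply: h1; lra.
  case: h2 => h2.
    by left=> y xy; rewrite -ltrBlDl lt_min => /andP[] *; left; apply: h2; lra.
  right=> y xy; rewrite -ltrBlDl lt_min => /andP[l1 l2] [hB|hF].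
    by apply: (h2 y) => //; lra.
  by apply: (h1 y) => //; lra.
have [[c _ ->]|[a [b [_ _ ->]]]] := FB B (or_introl erefl).
  have [xc|cx] := ltP x c.
    by exists (c - x); [lra | right=> y _ hy /= E; lra].
  by exists 1 => //; right=> y hy _ /= E; lra.
have [e1' h1' [k1|k1]] : exists2 e, 0 < e &
    (forall y, x < y -> y < x + e -> if a is Some u then is_true (u < y) else True) \/
    (forall y, x < y -> y < x + e -> ~ if a is Some u then is_true (u < y) else True).
- case: a => [u|]; last by exists 1 => //; left.
  have [xu|ux] := ltP x u.
    by exists (u - x); [lra | right=> y _ hy E; lra].
  by exists 1 => //; left=> y hy _; lra.
- have [e2 h2 [k2|k2]] : exists2 e, 0 < e &
      (forall y, x < y -> y < x + e -> if b is Some u then is_true (y < u) else True) \/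
      (forall y, x < y -> y < x + e -> ~ if b is Some u then is_true (y < u) else True).
  + case: b => [u|]; last by exists 1 => //; left.
    have [xu|ux] := ltP x u.
      by exists (u - x); [lra | left=> y _ hy; lra].
    by exists 1 => //; right=> y hy _ E; lra.
  + exists (Num.min e1' e2); first by rewrite lt_min h1'.
    left=> y xy; rewrite -ltrBlDl lt_min => /andP[l1 l2].
    by split=> //; [apply: k1; lra | apply: k2; lra].
  + by exists e2 => //; right=> y xy hy [_ _]; exact: k2.
- by exists e1' => //; right=> y xy hy [_ + _]; exact: k1.
Qed.

Lemma infinite_fat A : Dp S A -> infinite_set A -> fat A.
Proof.
move=> /omin_union[F [Ffin FB ->]] inf.
have [B FB' Binf] : exists2 B, F B & infinite_set B.
  apply: contrapT => hn; apply: inf; apply: bigcup_finite => // B hB.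
  by apply: contrapT => hB'; apply: hn; exists B.
have [[c _ E]|[a [b [_ _ E]]]] := FB B FB'.
  by case: Binf; rewrite E; exact: finite_set1.
have [x] := infinite_setN0 Binf; rewrite E => /open_interval_nbhs[e e_gt0 he].
exists (x - e), (x + e); split; first by lra.
by move=> y h1 h2; exists B => //; rewrite E; apply: he; rewrite ltr_norml; lra.
Qed.

(** Rational end points turn the containment of an interval into a countable disjunction, the form
    that the covering arguments can consume. *)
Lemma fat_rat A : fat A ->
  exists p q : rat, p < q /\ forall y, ratr p < y -> y < ratr q -> A y.
Proof.
move=> [a [b [ab h]]].
have [p] := rat_in_itvoo ab; rewrite in_itv /= => /andP[ap pb].
have [q] := rat_in_itvoo pb; rewrite in_itv /= => /andP[pq qb].
exists p, q; split; first by move: pq; rewrite ltr_rat.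
by move=> y py yq; apply: h; [exact: lt_trans py | exact: lt_trans qb].
Qed.

Lemma countable_itv (a b : R) : a < b -> ~ countable [set y | a < y < b].
Proof.
move=> ab /countable_lebesgue_measure0.
have -> : [set y | a < y < b] = [set` `]a, b[] by apply/seteqP; split.
rewrite lebesgue_measure_itv /= lte_fin ab -EFinB => -[]; lra.
Qed.

Lemma fat_uncountable A : fat A -> ~ countable A.
Proof.
move=> [a [b [ab h]]] cA; apply: (countable_itv ab).
apply: sub_countable cA; apply: subset_card_le => y /andP[]; exact: h.
Qed.

Lemma fatP A : Dp S A -> fat A <-> infinite_set A.
Proof.
move=> hA; split=> [hf|]; last exact: infinite_fat.
by move=> /finite_set_countable; exact: fat_uncountable.
Qed.

(** Plays the role of the Baire category theorem: definable sets without interval are finite, and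
    countably many finite sets cannot cover an interval. *)
Lemma fat_sigma (I : countType) A (B : I -> R -> Prop) :
  fat A -> (forall i, Dp S (B i)) -> (forall y, A y -> exists i, B i y) ->
  exists i, fat (fun y => A y /\ B i y).
Proof.
move=> [a [b [ab h]]] hB cov; pose C i y := (a < y /\ y < b) /\ B i y.
have hC i : Dp S (C i) by have := hB i; rewrite /C; dp.
have [i hi] : exists i, infinite_set (C i).
  apply: contrapT => hn; apply: (countable_itv ab).
  apply: (@sub_countable _ _ _ (\bigcup_i (C i))).
    apply: subset_card_le => y /andP[ay yb]; have [i hi] := cov y (h y ay yb).
    by exists i.
  apply: bigcup_countable => // i _; apply: finite_set_countable.
  by apply: contrapT => hi; apply: hn; exists i.
have [c [d [cd hcd]]] := infinite_fat (hC i) hi.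
by exists i, c, d; split=> // y cy yd; have [[??]?] := hcd y cy yd; split=> //; exact: h.
Qed.

End Line.

(** * Boxes in powers of the line and countable covers of them *)

Section Boxes.
Context {R : realType}.

(* [hasint A]: the set [A] contains a box. *)
Fixpoint hasint (d : nat) : (Rn R d -> Prop) -> Prop :=
  match d with
  | 0 => fun A => A tt
  | d'.+1 => fun A => exists a b, a < b /\
      hasint (fun x : Rn R d' => forall y, a < y -> y < b -> A (x, y))
  end.

Arguments hasint d : simpl never.

Lemma hasint_mono d (A B : Rn R d -> Prop) :
  (forall x, A x -> B x) -> hasint A -> hasint B.
Proof.
elim: d A B => [|d IH] A B AB; first exact: AB.
move=> [a [b [ab h]]]; exists a, b; split=> //.
by apply: IH h => x hx y ay yb; apply: AB; exact: hx.
Qed.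

Lemma hasint_box d (U : Rn R d -> Prop) a b : a < b -> hasint U ->
  @hasint d.+1 (fun x => [/\ U x.1, a < x.2 & x.2 < b]).
Proof. by move=> ab hU; exists a, b; split=> //; apply: hasint_mono hU. Qed.

Lemma hasint_nonempty d (A : Rn R d -> Prop) : hasint A -> exists x, A x.
Proof.
elim: d A => [|d IH] A /=; first by exists tt.
move=> [a [b [ab /IH[x hx]]]]; exists (x, (a + b) / 2); apply: hx; lra.
Qed.

Fixpoint boxnear (d : nat) (e : R) : Rn R d -> Rn R d -> Prop :=
  match d with
  | 0 => fun _ _ => True
  | d'.+1 => fun x y => boxnear e x.1 y.1 /\ `|y.2 - x.2| < e
  end.

Lemma boxnear_refl d e (x : Rn R d) : 0 < e -> boxnear e x x.
Proof.
by move=> e0; elim: d x => [|d IH] //= [x y]; rewrite subrr normr0.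
Qed.

Lemma boxnear_le d e e' (x y : Rn R d) : e' <= e -> boxnear e' x y -> boxnear e x y.
Proof.
move=> ee'; elim: d x y => [|d IH] //= x y [/IH ? ?]; split=> //.
exact: lt_le_trans ee'.
Qed.

Lemma hasint_ball d (A : Rn R d -> Prop) : hasint A ->
  exists x, exists2 e, 0 < e & forall x', boxnear e x x' -> A x'.
Proof.
elim: d A => [|d IH] A /=; first by exists tt, 1 => // -[].
move=> [a [b [ab /IH[x [e e0 he]]]]].
exists (x, (a + b) / 2), (Num.min e ((b - a) / 2)).
  by rewrite lt_min e0; lra.
move=> [x' y] /= [/boxnear_le hn]; rewrite lt_min => /andP[_].
rewrite ltr_norml => /andP[h1 h2].
by apply: he; [apply: hn; rewrite ge_min lexx | lra | lra].
Qed.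

Fixpoint ratpt (d : nat) (s : seq rat) : Rn R d :=
  match d with
  | 0 => tt
  | d'.+1 => (ratpt d' (behead s), ratr (head 0 s))
  end.

Lemma hasint_ratpt d (A : Rn R d -> Prop) : hasint A -> exists s, A (ratpt d s).
Proof.
elim: d A => [|d IH] A /=; first by exists [::].
move=> [a [b [ab /IH[s hs]]]].
have [p] := rat_in_itvoo ab; rewrite in_itv /= => /andP[ap pb].
by exists (p :: s) => /=; apply: hs.
Qed.

Context {S : expansion R}.

Lemma Dp_fat (T : Type) (sT : Sp R T) (P : T -> R -> Prop) :
  Dp S (fun p : T * R => P p.1 p.2) -> Dp S (fun e => fat (P e)).
Proof. by move=> hP; have : Dp2 S P := hP; rewrite /fat => h; dp. Qed.

Lemma Dp_hasint d (T : Type) (sT : Sp R T) (P : T -> Rn R d -> Prop) :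
  Dp S (fun p : T * Rn R d => P p.1 p.2) -> Dp S (fun e => hasint (P e)).
Proof.
elim: d T sT P => [|d IH] T sT P hP; have h : Dp2 S P := hP.
  by change (Dp S (fun e => P e tt)); dp.
eapply Dp_ex; eapply Dp_ex; eapply Dp_and; first by dp.
apply: (@IH _ _ (fun p x => forall y, p.1.2 < y -> y < p.2 -> P p.1.1 (x, y))).
by dp.
Qed.

Context {S_omin : o_minimal S}.

(** Over each point of the lower box some piece contains an interval with rational end points. There
    are countably many triples of a piece and two rationals, so by induction a single triple works
    over a whole box. *)
Lemma hasint_sigma d (I : countType) (U : Rn R d -> Prop) (A : I -> Rn R d -> Prop) :
  (forall i, Dp S (A i)) -> hasint U -> (forall x, U x -> exists i, A i x) ->
  exists i, hasint (fun x => U x /\ A i x).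
Proof.
elim: d I U A => [|d IH] I U A hA hU cov /=; first by have [i hi] := cov tt hU; exists i.
case: hU => a [b [ab hQ]].
pose B (k : I * (rat * rat)) x := [/\ k.2.1 < k.2.2, a <= ratr k.2.1, ratr k.2.2 <= b &
  forall y, ratr k.2.1 < y -> y < ratr k.2.2 -> A k.1 (x, y)].
have := IH [the countType of (I * (rat * rat))%type] _ B _ hQ.
case=> [[i [p q]]|x hx|[i [p q]] hi].
- by have := hA i; rewrite /B /=; dp.
- have fab : fat (fun y => a < y /\ y < b).
    by exists a, b; split.
  have [|y [ay yb]|i [c [e [ce hce]]]] := @fat_sigma _ _ _ I _ (fun i y => A i (x, y)) fab.
  + by move=> i; have := hA i; dp.
  + exact: cov (hx y ay yb).
  + have [p [q [pq hpq]]] := fat_rat (ex_intro _ c (ex_intro _ e (conj ce hce))).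
    exists (i, (p, q)); split=> //=.
    (* If [ratr p] were below [a], a rational between [ratr p] and both [a] and [ratr q] would
       belong to the fibre interval and yet lie outside of it. *)
    * rewrite leNgt; apply/negP => pa.
      have pq' : ratr p < Num.min a (ratr q) :> R by rewrite lt_min pa ltr_rat.
      have /rat_in_itvoo[r] := pq'; rewrite in_itv /= lt_min => /and3P[pr ra rq].
      have [[]] := hpq _ pr rq; lra.
    * rewrite leNgt; apply/negP => bq.
      have pq' : Num.max (ratr p) b < ratr q :> R by rewrite gt_max bq ltr_rat pq.
      have /rat_in_itvoo[r] := pq'; rewrite in_itv /= gt_max => /andP[/andP[pr br] rq].
      have [[]] := hpq _ pr rq; lra.
    * by move=> y py yq; have [_] := hpq y py yq.
exists i, (ratr p), (ratr q); split.
  by have [x [_ [pq _ _ _]]] := hasint_nonempty hi; rewrite ltr_rat.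
apply: hasint_mono hi => x [hx [/= _ ap qb hA']] y py yq; split; last exact: hA'.
by apply: hx; [exact: le_lt_trans py | exact: lt_le_trans qb].
Qed.

Lemma hasint_or d (U A B : Rn R d -> Prop) : Dp S A -> Dp S B ->
  hasint U -> (forall x, U x -> A x \/ B x) ->
  hasint (fun x => U x /\ A x) \/ hasint (fun x => U x /\ B x).
Proof.
move=> hA hB hU cov.
have [|x /cov[hx|hx]|[] h] := @hasint_sigma d _ U (fun b : bool => if b then A else B) _ hU.
- by case.
- by exists true.
- by exists false.
- by left.
- by right.
Qed.

End Boxes.

(** * Definable choice *)

Section Choice.
Context {R : realType} {S : expansion R}.

(** Unique choice: since [P e] has at most one solution, the graph of the description is
    first-order, with [u0] for an empty fibre. Functions introduced by a description are shown
    definable in this way. *)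
Lemma Df_xget (T : Type) (U : pointedType) (sT : Sp R T) (sU : Sp R U) (u0 : U)
    (P : T -> U -> Prop) :
  Dp S (fun p : T * U => P p.1 p.2) -> (forall e y y', P e y -> P e y' -> y = y') ->
  Df S (fun e => xget u0 [set y | P e y]).
Proof.
move=> hP uniqP; have h : Dp2 S P := hP; rewrite /Df.
apply: (@Dp_ext _ _ _ _ (fun p : T * U =>
  P p.1 p.2 \/ ((forall y, ~ P p.1 y) /\ p.2 = u0))); last by dp.
move=> [e y] /=; split=> [[hy|[hn ->]]|->].
- by case: xgetP => [z _ hz|/(_ y)//]; exact: uniqP hy hz.
- by case: xgetP => // z _ /hn.
- by case: xgetP => [z _ hz|hz]; [left|right].
Qed.

Implicit Types A : R -> Prop.

Definition is_min A y := A y /\ forall z, A z -> y <= z.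
Definition is_glb A s :=
  (forall z, A z -> s <= z) /\ forall s', (forall z, A z -> s' <= z) -> s' <= s.
Definition initial_part A s t := t <= s + 1 /\ forall z, s < z -> z < t -> A z.

(* For a set without minimum: the midpoint of the longest interval of length at
   most 1 that starts at the infimum and is contained in the set. *)
Definition pick_below A y := is_min A y \/ (~ (exists m, is_min A m) /\
  exists s t, [/\ is_glb A s, initial_part A s t,
    forall t', initial_part A s t' -> t' <= t & y + y = s + t]).

(** [pick_below] needs a set bounded below: the nonnegative part is used when it is nonempty, and
    otherwise the reflection of the negative part. *)
Definition pick_rel A y :=
  ((exists z, 0 <= z /\ A z) /\ pick_below (fun z => 0 <= z /\ A z) y) \/
  (~ (exists z, 0 <= z /\ A z) /\ pick_below (fun z => 0 <= z /\ A (- z)) (- y)).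

Lemma is_glb_uniq A s s' : is_glb A s -> is_glb A s' -> s = s'.
Proof. by move=> [h1 h2] [h3 h4]; apply/eqP; rewrite eq_le h4 // h2. Qed.

Lemma pick_below_uniq A y y' : pick_below A y -> pick_below A y' -> y = y'.
Proof.
move=> [[h1 h2]|[h1 [s [t [h2 h3 h4 h5]]]]] [[k1 k2]|[k1 [s' [t' [k2 k3 k4 k5]]]]].
- by apply/eqP; rewrite eq_le h2 // k2.
- by case: k1; exists y.
- by case: h1; exists y'.
- move: h3 h4 h5; rewrite (is_glb_uniq h2 k2) => h3 h4 h5.
  have tt' : t = t' by apply/eqP; rewrite eq_le h4 // k4.
  by move: h5 k5; rewrite tt'; lra.
Qed.

Lemma pick_rel_uniq A y y' : pick_rel A y -> pick_rel A y' -> y = y'.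
Proof.
move=> [[h1 h2]|[h1 h2]] [[k1 k2]|[k1 k2]] //.
  exact: pick_below_uniq h2 k2.
by apply: oppr_inj; exact: pick_below_uniq h2 k2.
Qed.

Definition choose_real (A : R -> Prop) : R := xget 0 [set y | pick_rel A y].

Lemma Df_choose_real (T : Type) (sT : Sp R T) (P : T -> R -> Prop) :
  Dp S (fun p : T * R => P p.1 p.2) -> Df S (fun e => choose_real (P e)).
Proof.
move=> hP; have h : Dp2 S P := hP; apply: Df_xget; last by move=> e; exact: pick_rel_uniq.
rewrite /pick_rel /pick_below /is_min /is_glb /initial_part; dp.
Qed.

Context {S_omin : o_minimal S}.

Lemma pick_below_ex A : Dp S A -> (exists y, A y) -> (forall z, A z -> 0 <= z) ->
  exists2 y, pick_below A y & A y.
Proof.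
move=> hA [a ha] A0.
case: (pselect (exists m, is_min A m)) => [[m hm]|nomin].
  by exists m; [left | case: hm].
have hlb : has_lbound [set z | A z] by exists 0 => z; exact: A0.
have hne : [set z | A z] !=set0 by exists a.
pose s := inf [set z | A z].
have hs : is_glb A s.
  by split=> [z hz|s' hs']; [exact: ge_inf | exact: lb_le_inf].
have sA : ~ A s by move=> sA; apply: nomin; exists s; split=> //; case: hs.
(* The infimum [s] is not in [A]. If [A] also missed an interval to the right of [s], then [s + e]
   would be a larger lower bound. *)
have [e e0 [he|he]] := Dp_germ hA s; last first.
  have [_ /(_ (s + e))] := hs; suff h : forall z, A z -> s + e <= z by move=> /(_ h); lra.
  move=> z hz; rewrite leNgt; apply/negP => ze; apply: (he z) => //.
  by rewrite lt_neqAle (hs.1 _ hz) andbT; apply/eqP => E; apply: sA; rewrite E.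
pose T := [set t | initial_part A s t].
pose t := sup T.
have Tub : has_ubound T by exists (s + 1) => z [].
have hT : T (Num.min (s + 1) (s + e)).
  split; first by rewrite ge_min lexx.
  by move=> z sz; rewrite lt_min => /andP[_ ze]; exact: he.
have st : s < t.
  apply: (@lt_le_trans _ _ (Num.min (s + 1) (s + e))); last exact: ub_le_sup.
  by rewrite lt_min; lra.
have ht : initial_part A s t.
  split; first by apply: ge_sup; [exists (Num.min (s + 1) (s + e)) | move=> z []].
  move=> z sz zt; have [t' [_ ht'] zt'] := sup_gt (ex_intro _ _ hT) zt.
  exact: ht'.
exists ((s + t) / 2); last by apply: ht.2; lra.
right; split=> //; exists s, t; split=> //; last by lra.
by move=> t' ht'; exact: ub_le_sup.
Qed.

Lemma choose_realP A : Dp S A -> (exists y, A y) -> A (choose_real A).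
Proof.
move=> hA [a ha].
suff [y hy Ay] : exists2 y, pick_rel A y & A y.
  by rewrite /choose_real; case: xgetP => [z _ hz|/(_ y)//]; rewrite (pick_rel_uniq hz hy).
have d1 : Dp S (fun z => 0 <= z /\ A z) by dp.
have d2 : Dp S (fun z => 0 <= z /\ A (- z)) by dp.
case: (pselect (exists z, 0 <= z /\ A z)) => [h|h].
  have [z []//|y hy [_ Ay]] := pick_below_ex d1 h.
  by exists y => //; left.
have [|z []//|y hy [_ Ay]] := pick_below_ex d2.
  exists (- a); rewrite opprK; split=> //; rewrite leNgt; apply/negP => a0.
  by apply: h; exists a; split=> //; lra.
by exists (- y) => //; right; rewrite opprK.
Qed.

End Choice.

(** * Definable choice for row vectors, one coordinate at a time *)

Section RowChoice.
Context {R : realType}.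

Definition snoc n (x : 'rV[R]_n) (y : R) : 'rV[R]_n.+1 :=
  \row_i if unlift ord_max i is Some j then x 0 j else y.

Lemma col'_snoc n (x : 'rV[R]_n) y : col' ord_max (snoc x y) = x.
Proof. by apply/rowP => i; rewrite !mxE liftK. Qed.

Lemma snoc_last n (x : 'rV[R]_n) y : snoc x y 0 ord_max = y.
Proof. by rewrite mxE unlift_none. Qed.

Lemma snocK n (z : 'rV[R]_n.+1) : snoc (col' ord_max z) (z 0 ord_max) = z.
Proof. by apply/rowP => i; rewrite mxE; case: unliftP => [j ->|->]; rewrite ?mxE. Qed.

Context {S : expansion R}.

Lemma Df_snoc (T : Type) (sT : Sp R T) n (f : T -> 'rV[R]_n) (g : T -> R) :
  Df S f -> Df S g -> Df S (fun x => snoc (f x) (g x)).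
Proof.
move=> hf hg; apply: Df_row => i.
have -> : (fun x => snoc (f x) (g x) 0 i) =
    (fun x => if unlift ord_max i is Some j then f x 0 j else g x).
  by apply/funext => x; rewrite mxE.
by case: unlift => [j|//]; exact: Df_coord.
Qed.

(** The value depends only on the set [A]; hence elements of one coset receive the same
    representative in [repP]. *)
Fixpoint choose_row n : ('rV[R]_n -> Prop) -> 'rV[R]_n :=
  match n with
  | 0 => fun _ => 0
  | n'.+1 => fun A => let x := choose_row (fun x => exists y, A (snoc x y)) in
      snoc x (choose_real (fun y => A (snoc x y)))
  end.

Lemma Df_choose_row n (T : Type) (sT : Sp R T) (P : T -> 'rV[R]_n -> Prop) :
  Dp S (fun p : T * 'rV[R]_n => P p.1 p.2) -> Df S (fun e => choose_row (P e)).
Proof.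
elim: n T sT P => [|n IH] T sT P hP /=; have h : Dp2 S P := hP; first exact: Df_cst.
have h1 : Df S (fun e => choose_row (fun x => exists y, P e (snoc x y))).
  apply: (@IH _ _ (fun e x => exists y, P e (snoc x y))).
  by dp; apply: Df_snoc; dp.
apply: Df_snoc => //.
apply: (@Df_choose_real _ _ _ _ (fun e y =>
  P e (snoc (choose_row (fun x : 'rV[R]_n => exists y, P e (snoc x y))) y))).
apply: (Dp2_comp h); first by dp.
apply: Df_snoc; last by dp.
exact: (Df_fst_aux _ h1).
Qed.

Lemma choose_rowP {S_omin : o_minimal S} n (A : 'rV[R]_n -> Prop) :
  Dp S A -> (exists x, A x) -> A (choose_row A).
Proof.
elim: n A => [|n IH] A hA [x hx] /=.
  by rewrite (_ : 0 = x) //; apply/rowP => -[].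
have hp : Dp S (fun x => exists y, A (snoc x y)).
  by dp; apply: Df_snoc; dp.
have [|y hy] := IH _ hp; first by exists (col' ord_max x), (x 0 ord_max); rewrite snocK.
apply: (@choose_realP _ _ _ (fun z => A (snoc (choose_row (fun x => exists y, A (snoc x y))) z))).
  by dp; apply: Df_snoc; dp.
by exists y.
Qed.

End RowChoice.

Ltac dp_ext ::=
  match goal with
  | |- Df _ (fun _ => snoc _ _) => eapply Df_snoc
  | |- Df _ (snoc _) => eapply Df_snoc
  | |- Df _ (fun _ => choose_real _) => eapply Df_choose_real
  | |- Df _ (fun _ => choose_row _) => eapply Df_choose_row
  | |- Dp _ (fun _ => fat _) => eapply Dp_fat
  | |- Dp _ (fun _ => hasint _) => eapply Dp_hasint
  end.

(** * Dimension *)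

Section Emb.
Context {R : realType} (S : expansion R).

(* [emb d X] and [thin d X] express that the dimension of [X] is at least [d],
   respectively less than [d]. *)
Definition emb (T : Type) {sT : Sp R T} (d : nat) (X : T -> Prop) : Prop :=
  exists (U : Rn R d -> Prop) (phi : Rn R d -> T),
    [/\ Dp S U, Df S phi, hasint U,
      (forall u v, U u -> U v -> phi u = phi v -> u = v) & forall u, U u -> X (phi u)].

Definition thin (T : Type) {sT : Sp R T} (d : nat) (X : T -> Prop) : Prop :=
  if d is d'.+1 then
    exists (I : countType) (A : I -> T -> Prop) (f : I -> T -> Rn R d'),
      [/\ forall i, Dp S (A i), forall i, Df S (f i),
        (forall i x y, A i x -> A i y -> f i x = f i y -> x = y)
        & forall x, X x -> exists i, A i x]
  else forall x, ~ X x.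

Context (T : Type) (sT : Sp R T).
Implicit Types X Y : T -> Prop.

Lemma emb_mono d X Y : (forall x, X x -> Y x) -> emb d X -> emb d Y.
Proof. by move=> XY [U [phi [? ? ? ? h]]]; exists U, phi; split=> // u /h /XY. Qed.

Lemma thin_mono d X Y : (forall x, Y x -> X x) -> thin d X -> thin d Y.
Proof.
case: d => [|d] YX; first by move=> h x /YX /h.
by move=> [I [A [f [? ? ? h]]]]; exists I, A, f; split=> // x /YX /h.
Qed.

Lemma emb0 X x : X x -> emb 0 X.
Proof.
move=> hx; exists (fun _ => True), (fun _ => x); split=> //.
- exact: Dp_cst.
- exact: Df_cst.
- by move=> [] [].
Qed.

Lemma emb_id d (U : Rn R d -> Prop) : Dp S U -> hasint U -> emb d U.
Proof. by move=> hU iU; exists U, id; split=> //; exact: Df_id. Qed.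

Lemma thin_inj (T' : Type) (sT' : Sp R T') d X (Y : T' -> Prop) (g : T -> T') (D : T -> Prop) :
  Dp S D -> Df S g -> (forall x y, D x -> D y -> g x = g y -> x = y) ->
  (forall x, X x -> D x /\ Y (g x)) -> thin d Y -> thin d X.
Proof.
move=> hD hg injg XY; case: d => [|d]; first by move=> h x /XY[_ /h].
move=> [I [A [f [hA hf injf cov]]]].
exists I, (fun i x => D x /\ A i (g x)), (fun i x => f i (g x)); split.
- by move=> i; have := hA i; dp.
- by move=> i; have := hf i; dp.
- move=> i x y [Dx ix] [Dy iy] /(injf _ _ _ ix iy); exact: injg.
- by move=> x /XY[Dx /cov[i hi]]; exists i.
Qed.

Lemma thin_or d X Y : thin d X -> thin d Y -> thin d (fun x => X x \/ Y x).
Proof.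
case: d => [h1 h2 x [/h1|/h2] //|d].
move=> [I [A [f [hA hf injf cov]]]] [J [B [g [hB hg injg cov']]]].
exists (I + J)%type, (fun k => match k with inl i => A i | inr j => B j end),
  (fun k => match k with inl i => f i | inr j => g j end); split.
- by case.
- by case.
- by case=> [i|j]; [exact: injf | exact: injg].
- by move=> x [/cov[i hi]|/cov'[j hj]]; [exists (inl i) | exists (inr j)].
Qed.

Lemma emb_map (T' : Type) (sT' : Sp R T') d X (Y : T' -> Prop) (g : T -> T') :
  Df S g -> (forall x y, X x -> X y -> g x = g y -> x = y) ->
  (forall x, X x -> Y (g x)) -> emb d X -> emb d Y.
Proof.
move=> hg injg XY [U [phi [hU hphi iU injphi UX]]].
exists U, (fun u => g (phi u)); split=> //.
- by dp.
- by move=> u v Uu Uv /(injg _ _ (UX _ Uu) (UX _ Uv)); exact: injphi.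
- by move=> u /UX /XY.
Qed.

Context {S_omin : o_minimal S}.

Lemma emb_sigma d (I : countType) X (A : I -> T -> Prop) :
  (forall i, Dp S (A i)) -> (forall x, X x -> exists i, A i x) -> emb d X ->
  exists i, emb d (fun x => X x /\ A i x).
Proof.
move=> hA cov [U [phi [hU hphi iU injphi UX]]].
have [i|u /UX /cov //|i hi] := @hasint_sigma _ _ _ d I U (fun i u => A i (phi u)) _ iU.
  by have := hA i; dp.
exists i, (fun u => U u /\ A i (phi u)), phi; split=> //.
- by have := hA i; dp.
- by move=> u v [Uu _] [Uv _]; exact: injphi.
- by move=> u [/UX].
Qed.

Lemma emb_or d X Y : Dp S X -> Dp S Y ->
  emb d (fun x => X x \/ Y x) -> emb d X \/ emb d Y.
Proof.
move=> hX hY /(@emb_sigma d bool _ (fun b => if b then X else Y))[].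
- by case.
- by move=> x [hx|hx]; [exists true | exists false].
- by case=> h; [left|right]; apply: emb_mono h => x [].
Qed.

(** A definable choice of [y] maps [X] injectively into the set of pairs. *)
Lemma emb_choose d X (P : T -> R -> Prop) : Dp S (fun p : T * R => P p.1 p.2) ->
  (forall x, X x -> exists y, P x y) -> emb d X ->
  emb d (fun p : T * R => X p.1 /\ P p.1 p.2).
Proof.
move=> hP exP; have h : Dp2 S P := hP.
apply: (@emb_map _ _ _ _ _ (fun x => (x, choose_real (P x)))); first by dp.
  by move=> x y _ _ [].
by move=> x hx; split=> //=; apply: choose_realP; [dp | exact: exP].
Qed.

Lemma hasint_fat d (U : Rn R d -> Prop) (P : Rn R d -> R -> Prop) :
  Dp S (fun p : Rn R d * R => P p.1 p.2) -> hasint U -> (forall u, U u -> fat (P u)) ->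
  exists p q, p < q /\ hasint (fun u => U u /\ forall y, p < y -> y < q -> P u y).
Proof.
move=> hP iU fU; have h : Dp2 S P := hP.
have [[p q]|u /fU /fat_rat[p [q [pq hpq]]]|[p q] hi] := @hasint_sigma _ _ _ d
    (rat * rat)%type U (fun k u => k.1 < k.2 /\ forall y, ratr k.1 < y -> y < ratr k.2 -> P u y) _ iU.
- by dp.
- by exists (p, q).
- have [u [_ [/= pq _]]] := hasint_nonempty hi.
  exists (ratr p), (ratr q); split; first by rewrite ltr_rat.
  by apply: hasint_mono hi => v [? []].
Qed.

(** By [hasint_fat] one interval lies in the fibres over all points of a smaller box, and the
    product with it is a box of one more dimension. *)
Lemma emb_step d X (P : T -> R -> Prop) : Dp S (fun p : T * R => P p.1 p.2) ->
  (forall x, X x -> fat (P x)) -> emb d X ->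
  emb d.+1 (fun p : T * R => X p.1 /\ P p.1 p.2).
Proof.
move=> hP fP [U [phi [hU hphi iU injphi UX]]]; have h : Dp2 S P := hP.
have [|u /UX /fP //|p [q [pq hpq]]] := @hasint_fat d U (fun u => P (phi u)) _ iU.
  by dp.
pose V u := U u /\ forall y, p < y -> y < q -> P (phi u) y.
have hV : Dp S V by rewrite /V; dp.
exists (fun u : Rn R d.+1 => [/\ V u.1, p < u.2 & u.2 < q]), (fun u => (phi u.1, u.2)).
split.
- by dp.
- by dp.
- exact: hasint_box.
- move=> [u y] [v z] /= [[Uu _] _ _] [[Uv _] _ _] [E ->].
  by congr pair; exact: injphi.
- by move=> [u y] /= [[/UX Xu hy] py yq]; split=> //; exact: hy.
Qed.

End Emb.

(** * Invariance of dimension *)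

Section Invariance.
Context {R : realType} {S : expansion R} {S_omin : o_minimal S}.

(** As a function of the last coordinate [g] is constant on an interval or takes every value of an
    interval, and one alternative holds uniformly over a box. In the first case the induction
    hypothesis at a fixed last coordinate is multiplied by an interval; in the second case a fixed
    value is attained over every point of the box, which gives a graph. *)
Lemma emb_fiber m : forall (U : Rn R m.+1 -> Prop) (g : Rn R m.+1 -> R),
  Dp S U -> Df S g -> hasint U -> exists w, emb S m (fun x => U x /\ g x = w).
Proof.
elim: m => [|m IH] U g hU hg [a [b [ab hV]]].
  have [y [ay yb]] : exists y, a < y /\ y < b by exists ((a + b) / 2); lra.
  by exists (g (tt, y)); apply: (@emb0 _ _ _ _ _ (tt, y)); split=> //; exact: hV.
pose V (x : Rn R m.+1) := forall y, a < y -> y < b -> U (x, y).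
have {}hV : hasint V := hV.
have hVd : Dp S V by rewrite /V; dp.
(* With [true] the function is constant in the last coordinate between the two rationals; with
   [false] it takes all values between them. *)
pose B (k : bool * (rat * rat)) (v : Rn R m.+1) := k.2.1 < k.2.2 /\ if k.1 then
    forall y y', ratr k.2.1 < y -> y < ratr k.2.2 ->
      ratr k.2.1 < y' -> y' < ratr k.2.2 -> [/\ a < y, y < b & g (v, y) = g (v, y')]
  else forall w, ratr k.2.1 < w -> w < ratr k.2.2 ->
      exists y, [/\ a < y, y < b & g (v, y) = w].
have hB k : Dp S (B k) by case: k => -[] k; rewrite /B /=; dp.
have cov v : V v -> exists k, B k v.
  move=> Vv.
  pose W w := exists y, [/\ a < y, y < b & g (v, y) = w].
  have hW : Dp S W by rewrite /W; dp.
  case: (pselect (fat W)) => [/fat_rat[p [q [pq hpq]]]|].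
    by exists (false, (p, q)).
  rewrite (fatP hW) => /contrapT finW.
  (* There are finitely many values on an uncountable interval, so one is taken infinitely often,
     hence on an interval. *)
  have [w hw] : exists w, infinite_set [set y | [/\ a < y, y < b & g (v, y) = w]].
    apply: contrapT => hn; apply: (countable_itv ab); apply: finite_set_countable.
    apply: (@sub_finite_set _ _ (\bigcup_(w in W) [set y | [/\ a < y, y < b & g (v, y) = w]])).
      by move=> y /= /andP[ay yb]; exists (g (v, y)) => //; exists y.
    by apply: bigcup_finite => // w _; apply: contrapT => hw; apply: hn; exists w.
  have /(infinite_fat _) /fat_rat[|p [q [pq hpq]]] := hw; first by dp.
  exists (true, (p, q)); split=> //= y y' h1 h2 h3 h4.
  by have [? ? ->] := hpq _ h1 h2; have [? ? ->] := hpq _ h3 h4.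
have [[[] [p q]] hi] :=
  @hasint_sigma _ _ _ _ (bool * (rat * rat))%type V B hB hV cov.
- have pq : (ratr p : R) < ratr q.
    by have [x [_ [pq _]]] := hasint_nonempty hi; rewrite ltr_rat.
  have hm1 : ratr p < (ratr p + ratr q) / 2 :> R by lra.
  have hm2 : (ratr p + ratr q) / 2 < ratr q :> R by lra.
  set c := (_ / _) in hm1 hm2.
  have [w hw] := IH _ (fun v => g (v, c)) (Dp_and hVd (hB _)) ltac:(dp) hi.
  exists w; have := @emb_step _ _ _ _ S_omin _ _ (fun _ y => ratr p < y /\ y < ratr q) _ _ hw.
  move=> /(_ ltac:(dp)) h; apply: emb_mono (h _).
    move=> [v y] /= [[[Vv [_ hv]] <-] [py yq]]; move: (hv y c py yq hm1 hm2) => [ay yb ->].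
    by split=> //; exact: Vv.
  by move=> x _; exists (ratr p), (ratr q).
- have pq : (ratr p : R) < ratr q.
    by have [x [_ [pq _]]] := hasint_nonempty hi; rewrite ltr_rat.
  have hm1 : ratr p < (ratr p + ratr q) / 2 :> R by lra.
  have hm2 : (ratr p + ratr q) / 2 < ratr q :> R by lra.
  set c := (_ / _) in hm1 hm2; exists c.
  have := emb_id (Dp_and hVd (hB _)) hi.
  move=> /(@emb_choose _ _ _ _ S_omin _ _ (fun v y => [/\ a < y, y < b & g (v, y) = c])).
  move=> /(_ ltac:(dp)) h; apply: emb_mono (h _).
    by move=> [v y] /= [[Vv _] [ay yb <-]]; split=> //; exact: Vv.
  by move=> v [_ [_ hv]]; exact: hv.
Qed.

(** On a large fibre of the last coordinate of [f], given by [emb_fiber], the remaining coordinates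
    are still injective; both dimensions drop by one. At the bottom an interval would inject into a
    point. *)
Lemma no_injection d : forall (U : Rn R d.+1 -> Prop) (f : Rn R d.+1 -> Rn R d),
  Dp S U -> Df S f -> hasint U -> (forall u v, U u -> U v -> f u = f v -> u = v) -> False.
Proof.
elim: d => [|d IH] U f hU hf hi injf.
  case: hi => a [b [ab h]].
  have E : (tt, a + (b - a) / 2) = (tt, a + (b - a) / 3) :> Rn R 1.
    apply: injf; [by apply: h; lra | by apply: h; lra |].
    by case: (f _); case: (f _).
  by case: E; lra.
have [|w [V [psi [hV hpsi iV injpsi VU]]]] := emb_fiber hU _ hi (g := fun x => (f x).2).
  by dp.
apply: (IH V (fun v => (f (psi v)).1)) => //; first by dp.
move=> u v Vu Vv E; apply: injpsi => //.
have [Uu wu] := VU u Vu; have [Uv wv] := VU v Vv.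
apply: injf => //; move: E wu wv; case: (f _) => ? ?; case: (f _) => ? ? /= -> -> ->.
by [].
Qed.

Lemma emb_thin (T : Type) (sT : Sp R T) d (X : T -> Prop) :
  emb S d X -> thin S d X -> False.
Proof.
case: d => [[U [phi [_ _ hU _ UX]]] hX|d]; first exact: hX (UX tt hU).
move=> [U [phi [hU hphi iU injphi UX]]] [I [A [f [hA hf injf cov]]]].
have [i|u /UX /cov //|i hi] := @hasint_sigma _ _ _ _ I U (fun i u => A i (phi u)) _ iU.
  by have := hA i; dp.
have := hA i; have := hf i => hfi hAi.
apply: (@no_injection d (fun u => U u /\ A i (phi u)) (fun u => f i (phi u))) => //.
- by dp.
- by dp.
- by move=> u v [Uu Au] [Uv Av] /(injf _ _ _ Au Av); exact: injphi.
Qed.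

Lemma thin_step (T : Type) (sT : Sp R T) d (W : T -> Prop) :
  thin S d W -> thin S d.+1 (fun p : T * R => W p.1).
Proof.
case: d => [hW|d [I [A [f [hA hf injf cov]]]]].
  exists unit, (fun _ _ => False), (fun _ _ => tt); split=> //.
  - by move=> _; exact: Dp_cst.
  - by move=> _; exact: Df_cst.
  - by move=> [x y] /hW.
exists I, (fun i p => A i p.1), (fun i p => (f i p.1, p.2)); split.
- by move=> i; have := hA i; dp.
- by move=> i; have := hf i; dp.
- by move=> i [x y] [x' y'] /= h h' [/(injf _ _ _ h h') -> ->].
- by move=> [x y] /= /cov.
Qed.

Lemma not_fat_isolated (A : R -> Prop) y : Dp S A -> ~ fat A ->
  exists p q : rat, [/\ ratr p < y, y < ratr q &
    forall z, A z -> ratr p < z -> z < ratr q -> z = y].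
Proof.
move=> hA nfA.
have [e e0 [he|he]] := Dp_germ hA y.
  by case: nfA; exists y, (y + e); split; [lra|].
have hA' : Dp S (fun z => A (- z)) by dp.
have [e' e'0 [he'|he']] := Dp_germ hA' (- y).
  case: nfA; exists (y - e'), y; split; first lra.
  by move=> z h1 h2; rewrite -[z]opprK; apply: he'; lra.
have : y - e' < y by lra.
move=> /rat_in_itvoo[p]; rewrite in_itv /= => /andP[p1 p2].
have : y < y + e by lra.
move=> /rat_in_itvoo[q]; rewrite in_itv /= => /andP[q1 q2].
exists p, q; split=> // z Az pz zq.
have [zy|yz|//] := ltgtP z y.
  by case: (he' (- z)); rewrite ?opprK //; lra.
by case: (he z) => //; lra.
Qed.

(** A point of a finite fibre is determined by a rational interval that isolates it. Adding this
    interval to the index makes the projection injective on each piece. *)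
Lemma thin_fin (T : Type) (sT : Sp R T) d (P : T -> R -> Prop) :
  Dp S (fun p : T * R => P p.1 p.2) -> (forall x, ~ fat (P x)) ->
  thin S d (fun x => exists y, P x y) -> thin S d (fun p : T * R => P p.1 p.2).
Proof.
move=> hP nf; have h : Dp2 S P := hP.
case: d => [hn [x y] /= Pxy|d [I [A [f [hA hf injf cov]]]]].
  by apply: (hn x); exists y.
exists (I * (rat * rat))%type, (fun k p => [/\ A k.1 p.1, P p.1 p.2,
    ratr k.2.1 < p.2 /\ p.2 < ratr k.2.2 &
    forall z, P p.1 z -> ratr k.2.1 < z -> z < ratr k.2.2 -> z = p.2]),
  (fun k p => f k.1 p.1); split.
- by move=> [i k]; have := hA i => /= hAi; dp.
- by move=> [i k]; have := hf i => /= hAi; dp.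
- move=> [i [p q]] [x y] [x' y'] /= [Ax Px [h1 h2] _] [Ax' Px' [h3 h4] h5] E.
  have xx' := injf _ _ _ Ax Ax' E; rewrite -xx' in h5 *; congr pair.
  exact: h5.
- move=> [x y] /= Pxy; have [i hi] := cov x (ex_intro _ y Pxy).
  have [|p [q [py yq hpq]]] := @not_fat_isolated (P x) y _ (nf x); first by dp.
  by exists (i, (p, q)).
Qed.

Lemma thin_split (T : Type) (sT : Sp R T) d (P : T -> R -> Prop) :
  Dp S (fun p : T * R => P p.1 p.2) -> thin S d (fun x => fat (P x)) ->
  thin S d.+1 (fun x => exists y, P x y) -> thin S d.+1 (fun p : T * R => P p.1 p.2).
Proof.
move=> hP h1 h2; have h : Dp2 S P := hP.
have := thin_or (thin_step h1)
  (@thin_fin _ _ d.+1 (fun x y => P x y /\ ~ fat (P x)) _ _ _).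
move=> /(_ ltac:(dp)) h3; apply: thin_mono (h3 _ _).
- by move=> [x y] /= Pxy; case: (pselect (fat (P x))); [left|right].
- by move=> x [a [b [ab hab]]]; case: (hab ((a + b) / 2)) => [||_ []]; try lra;
    exists a, b; split=> // y ay yb; case: (hab y ay yb).
- by apply: thin_mono h2 => x [y []]; exists y.
Qed.

Lemma hasint_or_thin d (Z : Rn R d -> Prop) : Dp S Z -> hasint Z \/ thin S d Z.
Proof.
elim: d Z => [|d IH] Z hZ.
  by case: (pselect (Z tt)) => h; [left | right; case].
have [|hi|ht] := IH (fun x => fat (fun y => Z (x, y))); first by dp.
  left; have [|//|p [q [pq hpq]]] := @hasint_fat _ _ _ _ _ (fun x y => Z (x, y)) _ hi.
    by dp.
  by exists p, q; split=> //; apply: hasint_mono hpq => x [].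
right; apply: (thin_mono (X := fun p => Z (p.1, p.2))); first by case.
apply: (@thin_split _ _ _ (fun x y => Z (x, y))) => //; first by dp.
(* The projection lies in [Rn R d], so the identity shows it to be thin in dimension [d.+1]. *)
exists unit, (fun _ _ => True), (fun _ x => x); split=> //.
- by move=> _; exact: Dp_cst.
- by move=> _; exact: Df_id.
Qed.

End Invariance.

(** * Dimension of sets of row vectors, and its definability in families *)

Section RowDimension.
Context {R : realType} {S : expansion R} {S_omin : o_minimal S}.

(** [emb] quantifies over parametrizations and is not first-order as it stands. This recursion on
    fibres is, and [embP] identifies the two; hence dimension conditions can occur in formulas. *)
Fixpoint dimge n (d : nat) : ('rV[R]_n -> Prop) -> Prop :=
  match n with
  | 0 => fun X => d = 0%N /\ X 0
  | n'.+1 => fun X => @dimge n' d (fun x => exists y, X (snoc x y)) \/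
      match d with
      | 0 => False
      | d'.+1 => @dimge n' d' (fun x => fat (fun y => X (snoc x y)))
      end
  end.

Lemma dimge_emb n d (X : 'rV[R]_n -> Prop) : Dp S X -> dimge d X -> emb S d X.
Proof.
elim: n d X => [|n IH] d X hX /=; first by move=> [-> X0]; exact: emb0 X0.
have hs : Df S (fun p : 'rV[R]_n * R => snoc p.1 p.2) by dp.
have injs (p q : 'rV[R]_n * R) : snoc p.1 p.2 = snoc q.1 q.2 -> p = q.
  case: p q => [x y] [x' y'] /= E; have := congr1 (col' ord_max) E.
  by rewrite !col'_snoc => ->; rewrite -(snoc_last x y) E snoc_last.
case=> [/IH h|].
  have {h} := h ltac:(dp) => /(@emb_choose _ _ _ _ S_omin _ _ (fun x y => X (snoc x y))).
  move=> /(_ ltac:(dp)) h; apply: (emb_map hs _ _ (h _)) => //.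
  - by move=> p q _ _; exact: injs.
  - by move=> p [].
case: d => // d /IH h.
have {h} := h ltac:(dp) => /(@emb_step _ _ _ _ S_omin _ _ (fun x y => X (snoc x y))).
move=> /(_ ltac:(dp)) h; apply: (emb_map hs _ _ (h _)) => //.
- by move=> p q _ _; exact: injs.
- by move=> p [].
Qed.

Lemma dimge_or_thin n d (X : 'rV[R]_n -> Prop) : Dp S X -> dimge d X \/ thin S d X.
Proof.
elim: n d X => [|n IH] d X hX /=.
  case: d => [|d].
    case: (pselect (X 0)) => h; [by left | right=> x].
    by rewrite (_ : x = 0) //; apply/rowP => -[].
  right; exists unit, (fun _ _ => True), (fun _ _ => ratpt d [::]); split=> //.
  - by move=> _; exact: Dp_cst.
  - by move=> _; exact: Df_cst.
  - by move=> _ x y _ _ _; apply/rowP => -[].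
have h1 : Dp S (fun x => exists y, X (snoc x y)) by dp.
have h2 : Dp S (fun x => fat (fun y => X (snoc x y))) by dp.
have [hd|ht] := IH d _ h1; first by left; left.
case: d ht => [ht|d ht].
  by right=> z Xz; apply: (ht (col' ord_max z)); exists (z 0 ord_max); rewrite snocK.
have [hd|ht'] := IH d _ h2; first by left; right.
right; apply: (@thin_inj _ _ _ _ _ _ _ _ _ (fun z => (col' ord_max z, z 0 ord_max))
  (fun=> True) _ _ _ _ (@thin_split _ _ _ _ _ _ (fun x y => X (snoc x y)) _ ht' ht)).
- exact: Dp_cst.
- by dp.
- by move=> x y _ _ [E1 E2]; rewrite -(snocK x) -(snocK y) E1 E2.
- by move=> x Xx; split=> //=; rewrite snocK.
- by dp.
Qed.

Lemma embP n d (X : 'rV[R]_n -> Prop) : Dp S X -> emb S d X <-> dimge d X.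
Proof.
move=> hX; split=> [hemb|]; last exact: dimge_emb.
by have [//|/(emb_thin hemb)] := dimge_or_thin d hX.
Qed.

Lemma emb_or_thin n d (X : 'rV[R]_n -> Prop) : Dp S X -> emb S d X \/ thin S d X.
Proof. by move=> hX; rewrite (embP _ hX); exact: dimge_or_thin. Qed.

Lemma Dp_dimge n d (T : Type) (sT : Sp R T) (P : T -> 'rV[R]_n -> Prop) :
  Dp S (fun p : T * 'rV[R]_n => P p.1 p.2) -> Dp S (fun e => dimge d (P e)).
Proof.
elim: n d T sT P => [|n IH] d T sT P hP /=; have h : Dp2 S P := hP; first by dp.
apply: Dp_or.
  by apply: (@IH _ _ _ (fun e x => exists y, P e (snoc x y))); dp.
case: d => [|d]; first exact: Dp_cst.
by apply: (@IH _ _ _ (fun e x => fat (fun y => P e (snoc x y)))); dp.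
Qed.

Lemma Dp_emb n d (T : Type) (sT : Sp R T) (P : T -> 'rV[R]_n -> Prop) :
  Dp S (fun p : T * 'rV[R]_n => P p.1 p.2) -> Dp S (fun e => emb S d (P e)).
Proof.
move=> hP; have h : Dp2 S P := hP; apply: Dp_ext (Dp_dimge d hP) => e.
by rewrite embP //; dp.
Qed.

(** Without a one-dimensional part no fibre contains an interval, so all fibres are finite, and the
    projection is finite by induction. *)
Lemma infinite_emb1 n (X : 'rV[R]_n -> Prop) : Dp S X -> infinite_set X -> emb S 1 X.
Proof.
move=> hX infX; apply: dimge_emb => //; apply: contrapT => nd; apply: infX.
have [//|] := dimge_or_thin 1 hX.
elim: n X hX nd => [|n IH] X hX /= nd ht.
  apply: (@sub_finite_set _ _ [set 0]); last exact: finite_set1.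
  by move=> x _; apply/rowP => -[].
move: nd => /not_orP[nd1 nd2].
have h1 : Dp S (fun x => exists y, X (snoc x y)) by dp.
have h2 : Dp S (fun x => fat (fun y => X (snoc x y))) by dp.
have nofat x : ~ fat (fun y => X (snoc x y)).
  move=> fx; apply: nd2; apply/(embP _ h2).
  exact: (@emb0 _ _ _ _ (fun x => fat (fun y => X (snoc x y))) x fx).
have fin1 : finite_set [set x | exists y, X (snoc x y)].
  by have [//|ht1] := dimge_or_thin 1 h1; exact: IH h1 nd1 ht1.
apply: (@sub_finite_set _ _
  (\bigcup_(x in [set x | exists y, X (snoc x y)]) [set snoc x y | y in [set y | X (snoc x y)]])).
  move=> z Xz; exists (col' ord_max z); first by exists (z 0 ord_max); rewrite snocK.
  by exists (z 0 ord_max); rewrite /= snocK.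
apply: bigcup_finite => // x _; apply: finite_image.
by apply: contrapT => /infinite_fat h; apply: (nofat x); apply: h; dp.
Qed.

(** Each piece injects into [Rn R d], and the points sought are the preimages of the rational
    points: the image of a [d]-dimensional subset contains a box, hence a rational point. *)
Lemma thin_separable n d (X : 'rV[R]_n -> Prop) : thin S d.+1 X ->
  exists (J : countType) (y : J -> 'rV[R]_n), forall Z : 'rV[R]_n -> Prop, Dp S Z ->
    (forall x, Z x -> X x) -> emb S d Z -> exists j, Z (y j).
Proof.
move=> [I [A [f [hA hf injf cov]]]].
exists (I * seq rat)%type, (fun k => xget 0 [set x | A k.1 x /\ f k.1 x = ratpt d k.2]).
move=> Z hZ ZX hemb.
have [i hi] := emb_sigma hA (fun x Zx => cov x (ZX x Zx)) hemb.
have := hA i; have := hf i => hfi hAi.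
pose W w := exists z, [/\ Z z, A i z & f i z = w].
have hW : Dp S W by rewrite /W; dp.
have embW : emb S d W.
  apply: emb_map hi => //; last by move=> x [Zx Ax]; exists x.
  by move=> x y [_ Ax] [_ Ay]; exact: injf.
have [/hasint_ratpt[s [z [Zz Az fz]]]|/(emb_thin embW)//] := hasint_or_thin hW.
exists (i, s) => /=; case: xgetP => [x _ [Ax fx]|/(_ z)[]//].
by rewrite (injf _ _ _ Ax Az) // fx fz.
Qed.

(* A form of Fubini's theorem: the countable set that meets every d-dimensional
   definable subset of [X] plays the role of a measure. *)
Lemma generic_section n d (X : 'rV[R]_n -> Prop) (U : Rn R d -> Prop)
    (N : 'rV[R]_n -> Rn R d -> Prop) :
  Dp S X -> Dp S U -> Dp S (fun p : 'rV[R]_n * Rn R d => N p.1 p.2) ->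
  thin S d.+1 X -> hasint U ->
  (forall y, X y -> ~ hasint (fun u => U u /\ N y u)) ->
  hasint (fun u => U u /\ ~ emb S d (fun y => X y /\ N y u)).
Proof.
move=> hX hU hN tX iU hn; have hN2 : Dp2 S N := hN.
pose (L := fun u : Rn R d => emb S d (fun y => X y /\ N y u)).
have hL : Dp S L.
  by apply: (@Dp_emb _ _ _ _ (fun u y => X y /\ N y u)); dp.
have covL u : U u -> L u \/ ~ L u by case: (pselect (L u)); auto.
have [hi|hi] := hasint_or hL (Dp_not hL) iU covL; last exact: hi.
(* If the sections were large over a box, each would contain one of the points [y j]. A single [j]
   would then serve a whole box, against [hn]. *)
have [J [y hy]] := thin_separable tX.
have [j|u [Uu Lu]|j hj] := @hasint_sigma _ _ _ _ J _ (fun j u => X (y j) /\ N (y j) u) _ hi.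
- by dp.
- by have [|x []//|j hj] := hy (fun y => X y /\ N y u) _ _ Lu; [dp | exists j].
- have [_ [_ [Xj _]]] := hasint_nonempty hj.
  by case: (hn (y j) Xj); apply: hasint_mono hj => u [[? _] [_ ?]].
Qed.

End RowDimension.

(** * Cells *)

Section Cells.
Context {R : realType} {S : expansion R} {S_omin : o_minimal S}.

Definition rownear n (e : R) (x y : 'rV[R]_n) : Prop :=
  forall i : 'I_n, x 0 i - e < y 0 i /\ y 0 i < x 0 i + e.

Lemma rownear_le n e e' (x y : 'rV[R]_n) : e' <= e -> rownear e' x y -> rownear e x y.
Proof. by move=> ee' h i; have [? ?] := h i; split; lra. Qed.

Lemma within_continuousP n (C : set 'rV[R]_n) (f : 'rV[R]_n -> R) :
  (forall x, C x -> forall eps, 0 < eps -> exists2 e, 0 < e &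
     forall y, C y -> rownear e x y -> f x - eps < f y /\ f y < f x + eps) ->
  {within C, continuous f}.
Proof.
move=> h; apply/subspace_continuousP => x Cx.
apply/cvgrPdist_lt => eps eps0; have [e e0 he] := h x Cx eps eps0.
rewrite near_withinE; apply/nbhs_ballP; exists e => //= y [_ hy] Cy.
have [|h1 h2] := he y Cy.
  by move=> i; have := hy ord0 i; rewrite /ball /= ltr_norml => /andP[? ?]; split; lra.
by change (`|f x - f y| < eps); rewrite ltr_norml; apply/andP; split; lra.
Qed.

(** Extension by 0 makes a function given on [B] a definable function of all vectors, as [Df]
    requires. *)
Definition total_on n (B : set 'rV[R]_n) (f : 'rV[R]_n -> R) x :=
  if `[< B x >] then f x else 0.

Lemma total_onE n (B : set 'rV[R]_n) f x : B x -> total_on B f x = f x.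
Proof. by move=> Bx; rewrite /total_on asboolT. Qed.

Lemma Df_total_on n (B : set 'rV[R]_n) (f : 'rV[R]_n -> R) :
  Dp S B -> definable_continuous S B f -> Df S (total_on B f).
Proof.
move=> hB [/definableP hf _]; rewrite /Df.
apply: (@Dp_ext _ _ _ _ (fun p => (B p.1 /\ cylinder_part B (fun x y => y = f x) (snoc p.1 p.2))
   \/ (~ B p.1 /\ p.2 = 0))); last by dp.
move=> [x y] /=; rewrite /total_on /cylinder_part /= col'_snoc snoc_last.
by case: asboolP => Bx; tauto.
Qed.

Lemma Dp_cylinder_part n (B : set 'rV[R]_n) (P : 'rV[R]_n -> R -> Prop) :
  Dp S B -> Dp2 S P -> Dp S (cylinder_part B P).
Proof. by move=> hB hP; rewrite /cylinder_part; dp. Qed.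

Lemma Dp_graph n (B : set 'rV[R]_n) f :
  definable_continuous S B f -> Dp S (cylinder_part B (fun x y => y = f x)).
Proof. by case=> /definableP. Qed.

Definition bounded_by n (B : set 'rV[R]_n) (f g : option ('rV[R]_n -> R)) x y :=
  (if f is Some f1 then total_on B f1 x < y else True) /\
  (if g is Some g1 then y < total_on B g1 x else True).

Lemma bandE n (B : set 'rV[R]_n) f g : band B f g = cylinder_part B (bounded_by B f g).
Proof.
by apply/seteqP; split=> z; rewrite /band /cylinder_part /bounded_by /= => -[Bz [h1 h2]];
  split=> //; split; move: h1 h2; case: f => [f|//]; case: g => [g|//]; rewrite ?total_onE.
Qed.

Lemma Dp_bounded_by n (B : set 'rV[R]_n) f g :
  Dp S B -> cell_bound S B f -> cell_bound S B g -> Dp2 S (bounded_by B f g).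
Proof.
move=> hB hf hg; rewrite /bounded_by; red; apply: Dp_and.
  by case: f hf => [f /(Df_total_on hB) hf|_]; dp.
by case: g hg => [g /(Df_total_on hB) hg|_]; dp.
Qed.

Lemma cell_definable n (C : set 'rV[R]_n) d : cell S C d -> Dp S C.
Proof.
elim=> [|n' B e f _ hB hf|n' B e f g _ hB hf hg _].
- exact: Dp_cst.
- exact: Dp_graph.
- by rewrite bandE; apply: Dp_cylinder_part => //; exact: Dp_bounded_by.
Qed.

Lemma emb_snoc n d (B : set 'rV[R]_n) (P : 'rV[R]_n -> R -> Prop) :
  emb S d (fun p : 'rV[R]_n * R => B p.1 /\ P p.1 p.2) -> emb S d (cylinder_part B P).
Proof.
apply: (@emb_map _ _ _ _ _ _ _ _ _ (fun p => snoc p.1 p.2)); first by dp.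
- move=> [x y] [x' y'] _ _ /= E; have := congr1 (col' ord_max) E.
  by rewrite !col'_snoc => ->; rewrite -(snoc_last x y) E snoc_last.
- by move=> [x y] /= [Bx Pxy]; rewrite /cylinder_part /= col'_snoc snoc_last.
Qed.

Lemma cell_emb n (C : set 'rV[R]_n) d : cell S C d -> emb S d C.
Proof.
elim=> [|n' B e f cB hB hf|n' B e f g cB hB hf hg fg].
- exact: (@emb0 _ _ _ _ _ 0).
- have hBd := cell_definable cB; have hft := Df_total_on hBd hf.
  have -> : cylinder_part B (fun x y => y = f x) =
      cylinder_part B (fun x y => y = total_on B f x).
    by apply/seteqP; split=> z; rewrite /cylinder_part /= => -[Bz ->]; rewrite total_onE.
  apply: emb_snoc; apply: (@emb_choose _ _ _ _ S_omin _ _ (fun x y => y = total_on B f x)) => //.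
  by move=> x _; exists (total_on B f x).
- have hBd := cell_definable cB; have hfg := Dp_bounded_by hBd hf hg.
  rewrite bandE; apply: emb_snoc; apply: emb_step => // x Bx; rewrite /bounded_by.
  case: f {hf hfg} fg => [f|]; case: g {hg} => [g|] fg.
  + exists (f x), (g x); split; first exact: fg.
    by move=> y h1 h2; rewrite !total_onE.
  + by exists (f x), (f x + 1); split; [lra | move=> y h1 h2; rewrite !total_onE].
  + by exists (g x - 1), (g x); split; [lra | move=> y h1 h2; rewrite !total_onE].
  + by exists 0, 1; split; [lra|].
Qed.

(** Bands have constant bounds. Such cells suffice to witness a dimension, and unlike general bands
    they keep their shape when the base or the interval shrinks. *)
Inductive box_cell : forall n : nat, set 'rV[R]_n -> nat -> Prop :=
| BoxCell0 : @box_cell 0 setT 0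
| BoxCellGraph n (B : set 'rV[R]_n) d f : box_cell B d -> definable_continuous S B f ->
    box_cell (cylinder_part B (fun x y => y = f x)) d
| BoxCellBand n (B : set 'rV[R]_n) d a b : box_cell B d -> a < b ->
    box_cell (cylinder_part B (fun _ y => a < y /\ y < b)) d.+1.

Lemma box_cell_definable n (C : set 'rV[R]_n) d : box_cell C d -> Dp S C.
Proof.
elim=> [|n' B e f _ hB hf|n' B e a b _ hB _].
- exact: Dp_cst.
- exact: Dp_graph.
- by apply: Dp_cylinder_part => //; dp.
Qed.

Lemma box_cell_nonempty n (C : set 'rV[R]_n) d : box_cell C d -> exists x, C x.
Proof.
elim=> [|n' B e f _ [x Bx] hf|n' B e a b _ [x Bx] ab].
- by exists 0.
- by exists (snoc x (f x)); rewrite /cylinder_part /= col'_snoc snoc_last.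
- exists (snoc x ((a + b) / 2)); rewrite /cylinder_part /= col'_snoc snoc_last; split=> //.
  by split; lra.
Qed.

Lemma box_cell_cell n (C : set 'rV[R]_n) d : box_cell C d -> cell S C d.
Proof.
elim=> [|n' B e f _ hB hf|n' B e a b cB hB ab]; [exact: Cell0 | exact: CellGraph |].
have hBd := box_cell_definable cB.
have hc c : definable_continuous S B (fun _ => c).
  split; last by apply: within_continuousP => x _ eps eps0; exists 1 => // y _ _; split; lra.
  by apply/definableP; apply: Dp_cylinder_part => //; dp.
apply: (@CellBand _ _ _ B e (Some (fun _ => a)) (Some (fun _ => b))) => //.
- exact: hc.
- exact: hc.
- by move=> _ _ [<-] [<-].
Qed.

Lemma definable_continuous_sub n (B B' : set 'rV[R]_n) f :
  B' `<=` B -> Dp S B' -> definable_continuous S B f -> definable_continuous S B' f.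
Proof.
move=> sB hB' [/definableP h1 h2]; split; last exact: continuous_subspaceW h2.
apply/definableP; apply: (@Dp_ext _ _ _ _ (fun z => B' (col' ord_max z) /\
    cylinder_part B (fun x y => y = f x) z)); last by dp.
by move=> z; rewrite /cylinder_part /=; split=> [[? []]//|[Bz ->]]; split=> //; split=> //; exact: sB.
Qed.

Lemma rownear_col' n e (x y : 'rV[R]_n.+1) :
  rownear e x y -> rownear e (col' ord_max x) (col' ord_max y).
Proof. by move=> h i; rewrite !mxE; exact: h. Qed.

(** The analogue of [hasint_sigma] for cells. The last clause makes [C'] relatively open in [C], so
    that nearness in [C] can be transferred to the smaller cell when continuity is proved. *)
Lemma box_cell_cover n (C : set 'rV[R]_n) d : box_cell C d ->
  forall (I : countType) (A : I -> 'rV[R]_n -> Prop), (forall i, Dp S (A i)) ->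
  (forall x, C x -> exists i, A i x) ->
  exists i (C' : set 'rV[R]_n), [/\ box_cell C' d, C' `<=` C, forall x, C' x -> A i x &
    forall x, C' x -> exists2 e, 0 < e & forall y, C y -> rownear e x y -> C' y].
Proof.
elim=> [|n' B e f cB IH hf|n' B e a b cB IH ab] I A hA cov.
- have [i hi] := cov 0 Logic.I; exists i, setT; split=> //.
  + exact: BoxCell0.
  + by move=> x _; rewrite (_ : x = 0) //; apply/rowP => -[].
  + by move=> x _; exists 1.
- have hBd := box_cell_definable cB; have hft := Df_total_on hBd hf.
  have [i|x Bx|i [C' [cC' sC' hC' oC']]] := IH I (fun i x => A i (snoc x (total_on B f x))).
  + by have := hA i; dp.
  + by apply: cov; rewrite /cylinder_part /= col'_snoc snoc_last total_onE.
  + exists i, (cylinder_part C' (fun x y => y = f x)); split.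
    * apply: BoxCellGraph => //; apply: definable_continuous_sub hf => //.
      exact: box_cell_definable cC'.
    * by move=> z [/sC' Bz hz].
    * move=> z [Cz hz]; have := hC' _ Cz; rewrite total_onE; last exact: sC'.
      by rewrite -[X in snoc _ X]hz snocK.
    * move=> z [Cz hz]; have [eps eps0 heps] := oC' _ Cz; exists eps => // y [By hy] nzy.
      by split=> //; apply: heps => //; exact: rownear_col'.
- have [[i [p q]]|x Bx|[i [p q]] [C' [cC' sC' hC' oC']]] := IH (I * (rat * rat))%type
    (fun k x => k.2.1 < k.2.2 /\ forall y, ratr k.2.1 < y -> y < ratr k.2.2 ->
       (a < y /\ y < b) /\ A k.1 (snoc x y)).
  + by have := hA i => /= hAi; dp.
  + have fab : fat (fun y => a < y /\ y < b) by exists a, b; split.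
    have [|y [ay yb]|i /fat_rat[p [q [pq hpq]]]] :=
        @fat_sigma _ _ _ I _ (fun i y => A i (snoc x y)) fab.
    * by move=> i; have := hA i; dp.
    * by apply: cov; rewrite /cylinder_part /= col'_snoc snoc_last.
    * by exists (i, (p, q)).
  + have pq : (ratr p : R) < ratr q.
      by have [x /hC'[/= pq _]] := box_cell_nonempty cC'; rewrite ltr_rat.
    exists i, (cylinder_part C' (fun _ y => ratr p < y /\ y < ratr q)); split.
    * exact: BoxCellBand.
    * move=> z [Cz [pz zq]]; have [_ /(_ _ pz zq)[abz _]] := hC' _ Cz.
      by split=> //; exact: sC'.
    * by move=> z [Cz [pz zq]]; have [_ /(_ _ pz zq)[_]] := hC' _ Cz; rewrite snocK.
    * move=> z [Cz [pz zq]]; have [eps eps0 heps] := oC' _ Cz.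
      exists (Num.min eps (Num.min (z 0 ord_max - ratr p) (ratr q - z 0 ord_max))).
        by rewrite !lt_min eps0 !subr_gt0 pz.
      move=> y [By hy] nzy; split.
        apply: heps => //; apply: rownear_col'; apply: rownear_le nzy.
        by rewrite ge_min lexx.
      have := nzy ord_max; set m := Num.min eps _.
      have m1 : m <= z 0 ord_max - ratr p by rewrite /m !ge_min lexx orbT.
      have m2 : m <= ratr q - z 0 ord_max by rewrite /m !ge_min lexx !orbT.
      by move=> [? ?]; split; lra.
Qed.

(* Generic continuity: the discontinuity set is the union of countably many
   definable sets, on each of which the oscillation is bounded below. *)
Lemma box_cell_continuous n (C : set 'rV[R]_n) d (f : 'rV[R]_n -> R) :
  box_cell C d -> Df S f ->
  exists C' : set 'rV[R]_n, [/\ box_cell C' d, C' `<=` C & definable_continuous S C' f].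
Proof.
move=> cC hf; have hC := box_cell_definable cC.
pose D eps x := forall e, 0 < e -> exists y, [/\ C y, rownear e x y &
  (f y <= f x - eps \/ f x + eps <= f y)].
have hD eps : Dp S (D eps) by rewrite /D /rownear; dp.
(* [None] collects the points of continuity relative to [C], [Some k] those where [f] oscillates by
   at least the inverse of [k.+1]. *)
pose A (k : option nat) x := if k is Some k then D (k.+1%:R^-1) x
  else forall eps, 0 < eps -> ~ D eps x.
have hA k : Dp S (A k).
  by case: k => [k|]; [exact: hD | rewrite /A /D /rownear; dp].
have covA x : C x -> exists k, A k x.
  move=> Cx; case: (pselect (A None x)) => [?|]; first by exists None.
  move=> /existsNP[eps /not_implyP[eps0 /contrapT hDx]].
  exists (Some (Num.truncn eps^-1)) => e e0; have [y [Cy nxy hy]] := hDx e e0.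
  exists y; split=> //.
  suff hle : (Num.truncn eps^-1).+1%:R^-1 <= eps by case: hy => hy;
    [left; apply: (le_trans hy); rewrite lerD2l lerN2 | right; apply: le_trans hy; rewrite lerD2l].
  rewrite -[leRHS]invrK lef_pV2 ?posrE ?invr_gt0 ?ltr0n //.
  by apply/ltW; exact: truncnS_gt.
have [k [C1 [cC1 sC1 hC1 oC1]]] := box_cell_cover cC hA covA.
case: k hC1 => [k|] hC1; last first.
  exists C1; split=> //; split.
    by apply/definableP; apply: Dp_cylinder_part; [exact: box_cell_definable cC1|dp].
  apply: within_continuousP => x C1x eps eps0.
  have /existsNP[e /not_implyP[e0 he]] := hC1 x C1x eps eps0.
  exists e => // y C1y nxy; apply: contrapT => hn; apply: he; exists y; split=> //.
    exact: sC1.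
  have [?|h1] := leP (f y) (f x - eps); [by left | right; rewrite leNgt; apply/negP => h2].
  by apply: hn.
exfalso; have [eps eps0 {}hC1] : exists2 eps, 0 < eps & forall x, C1 x -> D eps x.
  by exists (k.+1%:R^-1); [rewrite invr_gt0 ltr0n | exact: hC1].
(* On [C2] the values of [f] lie within an interval of length [eps], while [D eps] provides a nearby
   point, again in [C2], whose value differs by at least [eps]. *)
have [r|x _|r [C2 [cC2 sC2 hC2 oC2]]] := box_cell_cover cC1
    (I := rat) (A := fun r x => ratr r - eps / 2 < f x /\ f x < ratr r + eps / 2).
- by dp.
- have : f x - eps / 2 < f x + eps / 2 by lra.
  by move=> /rat_in_itvoo[r]; rewrite in_itv /= => /andP[? ?]; exists r; split; lra.
- have [x C2x] := box_cell_nonempty cC2.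
  have [e e0 he] := oC2 x C2x; have [e' e'0 he'] := oC1 x (sC2 _ C2x).
  have [|y [Cy nxy hy]] := hC1 x (sC2 _ C2x) (Num.min e e').
    by rewrite lt_min e0.
  have C2y : C2 y.
    apply: he; last by apply: rownear_le nxy; rewrite ge_min lexx.
    by apply: he' => //; apply: rownear_le nxy; rewrite ge_min lexx orbT.
  by have [? ?] := hC2 x C2x; have [? ?] := hC2 y C2y; case: hy; lra.
Qed.

Lemma dimge_box_cell n d (X : set 'rV[R]_n) : Dp S X -> dimge d X ->
  exists2 C : set 'rV[R]_n, box_cell C d & C `<=` X.
Proof.
elim: n d X => [|n IH] d X hX /=.
  move=> [-> X0]; exists setT; first exact: BoxCell0.
  by move=> x _; rewrite (_ : x = 0) //; apply/rowP => -[].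
case=> [/IH h|].
  have [|C cC sC] := h; first by dp.
  have [|C' [cC' sC' cont]] := @box_cell_continuous _ _ _ (fun x => choose_real (fun y => X (snoc x y))) cC.
    by dp.
  exists (cylinder_part C' (fun x y => y = choose_real (fun y => X (snoc x y)))).
    exact: BoxCellGraph.
  move=> z [Cz hz]; rewrite -(snocK z) hz.
  by apply: (@choose_realP _ _ _ (fun y => X (snoc _ y))); [dp | exact: sC (sC' _ Cz)].
case: d => // d /IH h; have [|C cC sC] := h; first by dp.
have [[p q]|x Cx|[p q] [C' [cC' sC' hC' _]]] := box_cell_cover cC (I := (rat * rat)%type)
  (A := fun k x => k.1 < k.2 /\ forall y, ratr k.1 < y -> y < ratr k.2 -> X (snoc x y)).
- by dp.
- by have [p [q [pq hpq]]] := fat_rat (sC x Cx); exists (p, q).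
- have pq : (ratr p : R) < ratr q.
    by have [x /hC'[/= pq _]] := box_cell_nonempty cC'; rewrite ltr_rat.
  exists (cylinder_part C' (fun _ y => ratr p < y /\ y < ratr q)).
    exact: BoxCellBand.
  by move=> z [Cz [pz zq]]; have [_ /(_ _ pz zq)] := hC' _ Cz; rewrite snocK.
Qed.

Lemma has_dim_emb n d (X : set 'rV[R]_n) : has_dim S X d -> emb S d X.
Proof. by move=> [[C sC /cell_emb h] _]; apply: emb_mono h. Qed.

(** A definable set that is not thin satisfies [dimge] and so contains a cell of dimension [d.+1],
    which [has_dim] forbids. *)
Lemma has_dim_thin n d (X : set 'rV[R]_n) : Dp S X -> has_dim S X d -> thin S d.+1 X.
Proof.
move=> hX [_ hd]; have [/(dimge_box_cell hX)[C cC sC]|//] := dimge_or_thin d.+1 hX.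
by have := hd C _ sC (box_cell_cell cC); rewrite ltnn.
Qed.

End Cells.

(** * Definable ordered groups *)

Lemma Df_norm (R : realType) (S : expansion R) (T : Type) (sT : Sp R T) (f : T -> R) :
  Df S f -> Df S (fun x => `|f x|).
Proof.
move=> hf; have -> : (fun x => `|f x|) = (fun x => if `[< 0 <= f x >] then f x else - f x).
  apply/funext => x; case: asboolP => [h|/negP h]; first by rewrite ger0_norm.
  by rewrite ler0_norm // ltW // ltNge.
by dp.
Qed.

(** Here the operations are definable on the whole space, and unit and inverse are part of the data,
    so group words can be used in formulas without guards. *)
Record ordGroup (R : realType) (S : expansion R) (n : nat) := OrdGroup {
  car : 'rV[R]_n -> Prop;
  mul : 'rV[R]_n -> 'rV[R]_n -> 'rV[R]_n;
  inv : 'rV[R]_n -> 'rV[R]_n;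
  one : 'rV[R]_n;
  ltg : 'rV[R]_n -> 'rV[R]_n -> Prop;
  car_def : Dp S car;
  mul_def : Df2 S mul;
  inv_def : Df S inv;
  ltg_def : Dp2 S ltg;
  mul_in : forall x y, car x -> car y -> car (mul x y);
  inv_in : forall x, car x -> car (inv x);
  one_in : car one;
  ogmulA : forall x y z, car x -> car y -> car z -> mul x (mul y z) = mul (mul x y) z;
  ogmul1l : forall x, car x -> mul one x = x;
  ogmul1r : forall x, car x -> mul x one = x;
  ogmulVl : forall x, car x -> mul (inv x) x = one;
  ogmulVr : forall x, car x -> mul x (inv x) = one;
  ltirr : forall x, car x -> ~ ltg x x;
  lttr : forall x y z, car x -> car y -> car z -> ltg x y -> ltg y z -> ltg x z;
  lttot : forall x y, car x -> car y -> [\/ ltg x y, x = y | ltg y x];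
  ltmul2l : forall z x y, car z -> car x -> car y -> ltg x y -> ltg (mul z x) (mul z y);
  ltmul2r : forall z x y, car z -> car x -> car y -> ltg x y -> ltg (mul x z) (mul y z)
}.
Arguments one {R S n}.
Arguments inv_in {R S n o x}.
Arguments mul_in {R S n o x y}.
Arguments one_in {R S n}.

Definition ogroup_data (R : realType) (S : expansion R) n (K : ordGroup S n) :
    orderedGroupData R :=
  @OrderedGroupData R (@GroupData R n (car K) (mul K)) (ltg K).

Section Conversion.
Context {R : realType} {S : expansion R}.

Lemma ogroup_data_ordered n (K : ordGroup S n) :
  definable_ordered_group S (ogroup_data K).
Proof.
have hc := car_def K; have hm := mul_def K; have hl := ltg_def K.
split => /=; try by move=> *; [exact: ltirr | exact: lttr | exact: lttot
  | exact: ltmul2l | exact: ltmul2r].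
- split=> /=.
  + exact/definableP.
  + by apply/definableP; dp.
  + by move=> x y; exact: mul_in.
  + by move=> x y z; exact: ogmulA.
  + exists (one K); split=> [|x Kx|x Kx]; first exact: one_in.
      by rewrite ogmul1l ?ogmul1r.
    by exists (inv K x); [exact: inv_in | rewrite ogmulVl ?ogmulVr].
- by apply/definableP; dp.
- by move=> x; exact: ltirr.
- by move=> x y z; exact: lttr.
- by move=> x y; exact: lttot.
- by move=> x y z; exact: ltmul2l.
- by move=> x y z; exact: ltmul2r.
Qed.

Lemma ordered_ogroup (G : orderedGroupData R) : definable_ordered_group S G ->
  exists K : ordGroup S (gdim G), [/\ car K = carrier G,
    forall x y, carrier G x -> carrier G y -> mul K x y = gmul x y &
    forall x y, carrier G x -> carrier G y -> (ltg K x y <-> olt x y)].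
Proof.
case=> -[/definableP hc /definableP hm mulK mA [e [Ke e1 eV]]] /definableP hl.
move=> irr tr tot ml mr.
pose m x y := if `[< carrier G x /\ carrier G y >] then gmul x y else 0.
pose l x y := [/\ carrier G x, carrier G y & olt x y].
have mE x y : carrier G x -> carrier G y -> m x y = gmul x y.
  by move=> Kx Ky; rewrite /m asboolT.
have m_def : Df2 S m.
  red; rewrite /Df; apply: (@Dp_ext _ _ _ _ (fun p : 'rV[R]_(gdim G) * 'rV[R]_(gdim G) * 'rV[R]_(gdim G) =>
    let z := row_mx (row_mx p.1.1 p.1.2) p.2 in
    ((carrier G (lsubmx (lsubmx z)) /\ carrier G (rsubmx (lsubmx z))) /\
      rsubmx z = gmul (lsubmx (lsubmx z)) (rsubmx (lsubmx z))) \/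
    (~ (carrier G p.1.1 /\ carrier G p.1.2) /\ p.2 = 0))).
    move=> [[x y] w] /=; rewrite !row_mxKl !row_mxKr /m.
    by case: asboolP => hxy; tauto.
  apply: Dp_or; last by dp.
  apply: (@Dp_comp _ _ _ _ _ _ _ (fun p : 'rV[R]_(gdim G) * 'rV[R]_(gdim G) * 'rV[R]_(gdim G) =>
    row_mx (row_mx p.1.1 p.1.2) p.2) hm).
  by dp.
have l_def : Dp2 S l.
  red; apply: (@Dp_ext _ _ _ _ (fun p : 'rV[R]_(gdim G) * 'rV[R]_(gdim G) =>
    let z := row_mx p.1 p.2 in
    [/\ carrier G (lsubmx z), carrier G (rsubmx z) & olt (lsubmx z) (rsubmx z)])).
    by move=> [x y] /=; rewrite row_mxKl row_mxKr.
  apply: (@Dp_comp _ _ _ _ _ _ _ (fun p : 'rV[R]_(gdim G) * 'rV[R]_(gdim G) =>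
    row_mx p.1 p.2) hl).
  by dp.
pose P x y := [/\ carrier G x, carrier G y & m x y = e].
pose i x := xget 0 [set y | P x y].
have i_def : Df S i.
  apply: Df_xget; first by rewrite /P; dp.
  move=> x y y' [Kx Ky h] [_ Ky' h']; rewrite !mE // in h h'.
  have [z Kz [zx _]] := eV x Kx.
  by rewrite -(proj1 (e1 y Ky)) -(proj1 (e1 y' Ky')) -zx -!mA // h h'.
have iP x : carrier G x -> carrier G (i x) /\ gmul x (i x) = e.
  move=> Kx; have [z Kz [_ xz]] := eV x Kx; rewrite /i.
  case: xgetP => [y _ [_ Ky]|/(_ z)[]]; first by rewrite mE.
  by split=> //; rewrite mE.
have iP' x : carrier G x -> gmul (i x) x = e.
  move=> Kx; have [Ki hi] := iP x Kx; have [z Kz [zx xz]] := eV x Kx.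
  suff -> : i x = z by [].
  by rewrite -(proj1 (e1 z Kz)) -(proj1 (e1 _ Ki)) -zx -!mA // hi xz.
have Ki x Kx := proj1 (iP x Kx).
unshelve eexists.
  refine (@OrdGroup R S (gdim G) (carrier G) m i e l hc m_def i_def l_def
    _ _ _ _ _ _ _ _ _ _ _ _ _); rewrite /l.
  - by move=> x y Kx Ky; rewrite mE //; exact: mulK.
  - by [].
  - by [].
  - by move=> x y z Kx Ky Kz; rewrite !mE //; [exact: mA | exact: mulK | exact: mulK].
  - by move=> x Kx; rewrite mE //; exact: (e1 x Kx).1.
  - by move=> x Kx; rewrite mE //; exact: (e1 x Kx).2.
  - by move=> x Kx; rewrite mE //; [exact: iP' | exact: Ki].
  - by move=> x Kx; rewrite mE //; [exact: (iP x Kx).2 | exact: Ki].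
  - by move=> x Kx [_ _]; exact: irr.
  - by move=> x y z Kx Ky Kz [_ _ xy] [_ _ yz]; split=> //; exact: tr xy yz.
  - by move=> x y Kx Ky; have [h|h|h] := tot x y Kx Ky; [exact: Or31|exact: Or32|exact: Or33].
  - by move=> z x y Kz Kx Ky [_ _ xy]; rewrite !mE //; split; [exact: mulK|exact: mulK|exact: ml].
  - by move=> z x y Kz Kx Ky [_ _ xy]; rewrite !mE //; split; [exact: mulK|exact: mulK|exact: mr].
split=> //= x y Kx Ky; rewrite /l; split=> [[]//|h]; by split.
Qed.

End Conversion.

(** * Elementary theory of ordered groups; intervals of small dimension *)

Section GroupTheory.
Context {R : realType} {S : expansion R} {n : nat} (K : ordGroup S n).
Local Notation "x • y" := (mul K x y) (at level 40, left associativity).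
Local Notation "x ≺ y" := (ltg K x y) (at level 70).
Local Notation "x '^~'" := (inv K x) (at level 2, format "x '^~'").
Local Notation e := (one K).

Lemma ogmulKl x y : car K x -> car K y -> x^~ • (x • y) = y.
Proof. by move=> Kx Ky; rewrite ogmulA ?ogmulVl ?ogmul1l //; exact: inv_in. Qed.

Lemma ogmulKVl x y : car K x -> car K y -> x • (x^~ • y) = y.
Proof. by move=> Kx Ky; rewrite ogmulA ?ogmulVr ?ogmul1l //; exact: inv_in. Qed.

Lemma ogmulKr x y : car K x -> car K y -> (x • y) • y^~ = x.
Proof. by move=> Kx Ky; rewrite -ogmulA ?ogmulVr ?ogmul1r //; exact: inv_in. Qed.

Lemma ogmulKVr x y : car K x -> car K y -> (x • y^~) • y = x.
Proof. by move=> Kx Ky; rewrite -ogmulA ?ogmulVl ?ogmul1r //; exact: inv_in. Qed.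

Lemma mul_injl x y z : car K x -> car K y -> car K z -> x • y = x • z -> y = z.
Proof. by move=> Kx Ky Kz E; rewrite -(ogmulKl Kx Ky) E ogmulKl. Qed.

Lemma mul_injr x y z : car K x -> car K y -> car K z -> y • x = z • x -> y = z.
Proof. by move=> Kx Ky Kz E; rewrite -(ogmulKr Ky Kx) E ogmulKr. Qed.

Lemma inv_uniq x y : car K x -> car K y -> x • y = e -> y = x^~.
Proof.
move=> Kx Ky h; apply: (@mul_injl x) => //; first exact: inv_in.
by rewrite ogmulVr.
Qed.

Lemma oginvK x : car K x -> x^~^~ = x.
Proof. by move=> Kx; rewrite -(@inv_uniq x^~ x) ?ogmulVl //; exact: inv_in. Qed.

Lemma oginvM x y : car K x -> car K y -> (x • y)^~ = y^~ • x^~.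
Proof.
move=> Kx Ky; have Ix := inv_in Kx; have Iy := inv_in Ky.
rewrite -(@inv_uniq (x • y) (y^~ • x^~)) //; [exact: mul_in | exact: mul_in |].
by rewrite -ogmulA ?ogmulKVl ?ogmulVr //; exact: mul_in.
Qed.

Lemma oginv1 : e^~ = e.
Proof. by have h := one_in K; rewrite -(@inv_uniq e e) ?ogmul1l. Qed.

Lemma oginv_inj x y : car K x -> car K y -> x^~ = y^~ -> x = y.
Proof. by move=> Kx Ky E; rewrite -(oginvK Kx) E oginvK. Qed.

Lemma ltmul2lE z x y : car K z -> car K x -> car K y -> (z • x ≺ z • y) <-> (x ≺ y).
Proof.
move=> Kz Kx Ky; split=> h; last exact: ltmul2l.
rewrite -(ogmulKl Kz Kx) -(ogmulKl Kz Ky).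
by apply: ltmul2l => //; [exact: inv_in | exact: mul_in | exact: mul_in].
Qed.

Lemma ltmul2rE z x y : car K z -> car K x -> car K y -> (x • z ≺ y • z) <-> (x ≺ y).
Proof.
move=> Kz Kx Ky; split=> h; last exact: ltmul2r.
rewrite -(ogmulKr Kx Kz) -(ogmulKr Ky Kz).
by apply: ltmul2r => //; [exact: inv_in | exact: mul_in | exact: mul_in].
Qed.

Lemma ltinv x : car K x -> (e ≺ x^~) <-> (x ≺ e).
Proof.
move=> Kx; have Ix := inv_in Kx; have Ke := one_in K.
by rewrite -(ltmul2rE Kx Ke Ix) ogmul1l // ogmulVl.
Qed.

Lemma ltinv' x : car K x -> (x^~ ≺ e) <-> (e ≺ x).
Proof. by move=> Kx; rewrite -ltinv ?oginvK //; exact: inv_in. Qed.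

Lemma ltasym x y : car K x -> car K y -> x ≺ y -> y ≺ x -> False.
Proof. by move=> Kx Ky xy yx; exact: (ltirr Kx (lttr Kx Ky Kx xy yx)). Qed.

Lemma ltdiv x y : car K x -> car K y -> (e ≺ x^~ • y) <-> (x ≺ y).
Proof.
move=> Kx Ky; have Ix := inv_in Kx; have Ke := one_in K.
by rewrite -(ltmul2lE Kx Ke) ?ogmulKVl ?ogmul1r //; exact: mul_in.
Qed.

Lemma one_lt_mul x y : car K x -> car K y -> e ≺ x -> e ≺ y -> e ≺ x • y.
Proof.
move=> Kx Ky hx hy; apply: (@lttr _ _ _ K _ x) => //; [exact: one_in | exact: mul_in |].
by rewrite -{1}(ogmul1r Kx); apply: ltmul2l => //; exact: one_in.
Qed.

Fixpoint pow x k := if k is k'.+1 then x • pow x k' else e.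

Lemma pow_in x k : car K x -> car K (pow x k).
Proof. by move=> Kx; elim: k => [|k IH]; [exact: one_in | exact: mul_in]. Qed.

Lemma pow_lt x j k : car K x -> e ≺ x -> (j < k)%N -> pow x j ≺ pow x k.
Proof.
move=> Kx ex; have Ke := one_in K.
have step i : pow x i ≺ pow x i.+1.
  rewrite -{1}(ogmul1l (pow_in i Kx)) /=; apply: ltmul2r => //; exact: pow_in.
elim: k => // k IH; rewrite ltnS leq_eqVlt => /orP[/eqP->|/IH h]; first exact: step.
by apply: lttr h (step k); exact: pow_in.
Qed.

Lemma pow_inj x : car K x -> e ≺ x -> injective (pow x).
Proof.
move=> Kx ex j k E; have [h|h|//] := ltngtP j k; have := pow_lt Kx ex h;
  by rewrite E => /ltirr []; exact: pow_in.
Qed.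

Lemma positive_infinite (X : 'rV[R]_n -> Prop) x : car K x -> e ≺ x ->
  (forall k, X (pow x k)) -> infinite_set X.
Proof.
move=> Kx ex hX finX; apply: infinite_nat.
apply: (@sub_finite_set _ _ (pow x @^-1` X)); first by move=> k _; exact: hX.
apply: finite_preimage => // j k _ _; exact: pow_inj.
Qed.

Definition between a b y := car K y /\ ((a ≺ y /\ y ≺ b) \/ (b ≺ y /\ y ≺ a)).

Lemma Dp_between (T : Type) (sT : Sp R T) (f g h : T -> 'rV[R]_n) :
  Df S f -> Df S g -> Df S h -> Dp S (fun x => between (f x) (g x) (h x)).
Proof.
move=> hf hg hh; have hc := car_def K; have hl := ltg_def K.
by rewrite /between; dp.
Qed.

Lemma between_sym a b y : between a b y -> between b a y.
Proof. by move=> [Ky [h|h]]; split=> //; [right|left]. Qed.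

Context {S_omin : o_minimal S}.

(** For positive [d] this is an equivalence relation with convex classes, invariant under
    translations on both sides; therefore the class of the unit is a convex normal subgroup. *)
Definition close d a b := ~ emb S d (between a b).

Lemma Dp_close d (T : Type) (sT : Sp R T) (f g : T -> 'rV[R]_n) :
  Df S f -> Df S g -> Dp S (fun x => close d (f x) (g x)).
Proof.
move=> hf hg; apply: Dp_not.
apply: (@Dp_emb _ _ _ _ _ _ _ (fun x y => between (f x) (g x) y)).
by apply: Dp_between; dp.
Qed.

Lemma Dp_between1 a b : Dp S (between a b).
Proof. by apply: Dp_between; dp. Qed.

Lemma close_sym d a b : close d a b -> close d b a.
Proof. by move=> h h'; apply: h; apply: emb_mono h' => y; exact: between_sym. Qed.

Lemma emb_single d (a : 'rV[R]_n) : emb S d.+1 (fun y => y = a) -> False.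
Proof.
move/emb_thin; apply; exists unit, (fun _ y => y = a), (fun _ _ => ratpt d [::]); split.
- by move=> _; dp.
- by move=> _; dp.
- by move=> _ x y -> ->.
- by move=> x ->; exists tt.
Qed.

Lemma close_refl d a : car K a -> close d a a.
Proof.
move=> Ka [U [phi [_ _ iU _ UX]]]; have [u /UX [Ky h]] := hasint_nonempty iU.
by case: h => -[h1 h2]; exact: ltasym h1 h2.
Qed.

Lemma close_trans d a b c : car K a -> car K b -> car K c ->
  close d.+1 a b -> close d.+1 b c -> close d.+1 a c.
Proof.
move=> Ka Kb Kc ab bc ac.
have db := Dp_between1 a b; have dc := Dp_between1 b c.
have : emb S d.+1 (fun y => between a b y \/ (between b c y \/ y = b)).
  apply: emb_mono ac => y [Ky h].
  have [yb|yb|yb] := lttot Ky Kb.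
  - case: h => [[h1 h2]|[h1 h2]]; first by left; split=> //; left.
    by right; left; split=> //; right.
  - by right; right.
  - case: h => [[h1 h2]|[h1 h2]]; first by right; left; split=> //; left.
    by left; split=> //; right.
case/emb_or => //; first by dp.
by case/emb_or => //; [dp | exact: emb_single].
Qed.

Lemma close_mull d z a b : car K z -> car K a -> car K b ->
  close d a b -> close d (z • a) (z • b).
Proof.
move=> Kz Ka Kb ab h; apply: ab; move: h; have Iz := inv_in Kz.
have hm := mul_def K.
apply: (@emb_map _ _ _ _ _ _ _ _ _ (fun y => z^~ • y)); first by dp.
- by move=> x y [Kx _] [Ky _]; exact: mul_injl.
- move=> y [Ky h]; have Kzy : car K (z^~ • y) by exact: mul_in.
  split=> //; rewrite -(ltmul2lE Kz Ka Kzy) -(ltmul2lE Kz Kzy Kb).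
  by rewrite -(ltmul2lE Kz Kb Kzy) -(ltmul2lE Kz Kzy Ka) ogmulKVl.
Qed.

Lemma close_mulr d z a b : car K z -> car K a -> car K b ->
  close d a b -> close d (a • z) (b • z).
Proof.
move=> Kz Ka Kb ab h; apply: ab; move: h; have Iz := inv_in Kz.
have hm := mul_def K.
apply: (@emb_map _ _ _ _ _ _ _ _ _ (fun y => y • z^~)); first by dp.
- by move=> x y [Kx _] [Ky _]; exact: mul_injr.
- move=> y [Ky h]; have Kzy : car K (y • z^~) by exact: mul_in.
  split=> //; rewrite -(ltmul2rE Kz Ka Kzy) -(ltmul2rE Kz Kzy Kb).
  by rewrite -(ltmul2rE Kz Kb Kzy) -(ltmul2rE Kz Kzy Ka) ogmulKVr.
Qed.

(** For [d = 2] this is the subgroup [H]. For [d = 1] only finitely many elements lie between [g]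
    and the unit; that case serves to show that one-dimensional groups are densely ordered. *)
Definition small d g := car K g /\ close d e g.

Lemma Dp_small d : Dp S (small d).
Proof.
have hc := car_def K; rewrite /small; apply: Dp_and => //.
by apply: Dp_close; dp.
Qed.

Lemma small1 d : small d e.
Proof. by split; [exact: one_in | apply: close_refl; exact: one_in]. Qed.

Lemma smallM d g h : small d.+1 g -> small d.+1 h -> small d.+1 (g • h).
Proof.
move=> [Kg eg] [Kh eh]; have Ke := one_in K; have Kgh := mul_in Kg Kh; split=> //.
apply: (@close_trans _ _ g) => //.
by rewrite -{1}(ogmul1r Kg); exact: close_mull.
Qed.

Lemma smallV d g : small d g -> small d g^~.
Proof.
move=> [Kg eg]; have Ke := one_in K; have Ig := inv_in Kg; split=> //; apply: close_sym.
by rewrite -(ogmul1r Ig) -{2}(ogmulVl Kg); exact: close_mull.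
Qed.

Lemma smallJ d x g : car K x -> small d g -> small d (x • g • x^~).
Proof.
move=> Kx [Kg eg]; have Ke := one_in K; have Ix := inv_in Kx.
have Kxg := mul_in Kx Kg; split; first exact: mul_in.
rewrite -(ogmulVr Kx) -{1}(ogmul1r Kx); apply: close_mulr => //.
  exact: mul_in.
exact: close_mull.
Qed.

Lemma small_convex d g h : car K h -> small d g -> e ≺ h -> h ≺ g -> small d h.
Proof.
move=> Kh [Kg eg] eh hg; have Ke := one_in K; split=> // hemb; apply: eg.
apply: emb_mono hemb => y [Ky [[h1 h2]|[h1 h2]]]; split=> //.
  by left; split=> //; exact: lttr hg.
by exfalso; apply: (ltasym Kh Ke) => //; exact: lttr h2.
Qed.

(** Initial segments of the positive part [P] are small. By [generic_section], applied to the order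
    relation on [P], generic final segments are small as well, and [P] would be the union of an
    initial segment, a final segment and a point. *)
Lemma small_not_emb d : thin S d.+2 (car K) -> ~ emb S d.+1 (small d.+1).
Proof.
move=> tK hemb; have Ke := one_in K; have hc := car_def K; have hl := ltg_def K.
have hsm := Dp_small d.+1; have hi := inv_def K.
pose P y := small d.+1 y /\ e ≺ y.
have hP : Dp S P by rewrite /P; dp.
have hN : Dp S (fun y => small d.+1 y /\ y ≺ e) by dp.
have embP : emb S d.+1 P.
  have : emb S d.+1 (fun y => P y \/ ((small d.+1 y /\ y ≺ e) \/ y = e)).
    apply: emb_mono hemb => y sy; have Ky := sy.1.
    by have [?|->|?] := lttot Ky Ke; [right; left | right; right | left].
  case/emb_or => //; first by dp.
  case/emb_or => //; [by dp | | by move/emb_single].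
  apply: (emb_map hi); first by move=> x y [[Kx _] _] [[Ky _] _]; exact: oginv_inj.
  by move=> y [sy ye]; split; [exact: smallV | apply/ltinv => //; exact: sy.1].
have below y : P y -> ~ emb S d.+1 (fun z => P z /\ z ≺ y).
  move=> [[Ky ey] lty] h; apply: ey; apply: emb_mono h => z [[[Kz _] ez] zy].
  by split=> //; left.
have [U [phi [hU hphi iU injphi UP]]] := embP.
have [||y Py h|u [Uu hu]] := hasint_nonempty (@generic_section _ _ _ _ _ P U (fun y u => phi u ≺ y) hP hU _ _ iU _).
- by dp.
- by apply: thin_mono tK => y [[]].
- apply: (below y Py); exists (fun u => U u /\ phi u ≺ y), phi; split=> //.
  + by dp.
  + by move=> u v [Uu _] [Uv _]; exact: injphi.
  + by move=> u [/UP].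
- apply: hu; have Pu := UP u Uu.
  have : emb S d.+1 (fun y => (P y /\ phi u ≺ y) \/ ((P y /\ y ≺ phi u) \/ y = phi u)).
    apply: emb_mono embP => y Py.
    by have [?|->|?] := lttot Py.1.1 Pu.1.1; [right; left | right; right | left].
  case/emb_or => //; [by dp | by dp |].
  by case/emb_or; [by dp | by dp | move/(below _ Pu) | move/emb_single].
Qed.

End GroupTheory.

(** * The order topology *)

Lemma Dp_boxnear (R : realType) (S : expansion R) d (T : Type) (sT : Sp R T)
    (f : T -> R) (g h : T -> Rn R d) :
  Df S f -> Df S g -> Df S h -> Dp S (fun x => boxnear (f x) (g x) (h x)).
Proof.
elim: d g h => [|d IH] g h hf hg hh /=; first by dp.
apply: Dp_and; first by apply: (IH (fun x => (g x).1) (fun x => (h x).1)) => //; dp.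
by apply: Dp_lt => //; apply: Df_norm; dp.
Qed.

Lemma locally_constant_itv (R : realType) (P : R -> Prop) (u v : R) : u <= v ->
  (forall x, u <= x -> x <= v -> exists2 e, 0 < e & forall x', u <= x' -> x' <= v ->
     `|x' - x| < e -> (P x' <-> P x)) ->
  (P u <-> P v).
Proof.
move=> uv loc; pose A := [set x | [/\ u <= x, x <= v & forall y, u <= y -> y <= x -> (P y <-> P u)]].
have Au : A u.
  by split=> // y uy yu; rewrite (_ : y = u) //; apply/eqP; rewrite eq_le uy yu.
have Aub : has_ubound A by exists v => x [].
have us : u <= sup A by exact: ub_le_sup.
have sv : sup A <= v by apply: ge_sup; [exists u | move=> x []].
have [e e0 he] := loc _ us sv.
have [x Ax sx] : exists2 x, A x & sup A - e < x by apply: sup_gt; [exists u | lra].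
have xs : x <= sup A by exact: ub_le_sup.
have [ux xv hx] := Ax.
have Psu : P (sup A) <-> P u.
  by rewrite -(hx x) // he // ler0_norm; lra.
have hA : A (Num.min v (sup A + e / 2)).
  split; [by rewrite le_min uv; lra | by rewrite ge_min lexx |].
  move=> y uy; rewrite le_min => /andP[yv ys].
  have [yx|xy] := leP y x; first exact: hx.
  rewrite -Psu; apply: he => //; rewrite ltr_norml; apply/andP; split; lra.
have := ub_le_sup Aub hA; rewrite ge_min => /orP[h|h]; last by lra.
by rewrite -Psu (_ : sup A = v) //; apply/eqP; rewrite eq_le sv.
Qed.

Section Charts.
Context {R : realType} {S : expansion R} {n : nat} (K : ordGroup S n).
Local Notation "x • y" := (mul K x y) (at level 40, left associativity).
Local Notation "x ≺ y" := (ltg K x y) (at level 70).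
Local Notation "x '^~'" := (inv K x) (at level 2, format "x '^~'").
Local Notation e := (one K).
Context {S_omin : o_minimal S}.

(** The last two clauses are the continuity of [phi] with respect to the order topology: preimages
    of rays are open in [U]. *)
Record chart d (U : Rn R d -> Prop) (phi : Rn R d -> 'rV[R]_n) : Prop := Chart {
  chart_in : forall u, U u -> car K (phi u);
  chart_inj : forall u v, U u -> U v -> phi u = phi v -> u = v;
  chart_gt : forall u a, U u -> car K a -> a ≺ phi u ->
    exists2 eps, 0 < eps & forall v, U v -> boxnear eps u v -> a ≺ phi v;
  chart_lt : forall u a, U u -> car K a -> phi u ≺ a ->
    exists2 eps, 0 < eps & forall v, U v -> boxnear eps u v -> phi v ≺ a
}.

Arguments chart d U phi : clear implicits.

(* For fixed [y] the relation between [y] and [phi u] is locally constant for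
   generic [u], hence for generic [u] it is locally constant for generic [y]. *)
Lemma chart_exists d (Z : 'rV[R]_n -> Prop) : thin S d.+1 (car K) ->
  (forall a b, car K a -> car K b -> a <> b -> emb S d (between K a b)) ->
  (forall z, Z z -> car K z) -> emb S d Z ->
  exists U phi, [/\ Dp S U, Df S phi, hasint U, chart d U phi & forall u, U u -> Z (phi u)].
Proof.
move=> tK big ZK [U0 [phi [hU0 hphi iU0 injphi UZ]]].
have hc := car_def K; have hl := ltg_def K.
pose loc y u := exists eps, 0 < eps /\
  ((forall v, U0 v -> boxnear eps u v -> y ≺ phi v) \/
   ((forall v, U0 v -> boxnear eps u v -> phi v ≺ y) \/
    (forall v, U0 v -> boxnear eps u v -> phi v = y))).
have dloc : Dp2 S loc.
  have dn : Dp S (fun p : R * (Rn R d * Rn R d) => boxnear p.1 p.2.1 p.2.2).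
    by apply: Dp_boxnear; dp.
  have dn3 (T : Type) (sT : Sp R T) (f : T -> R) (g h : T -> Rn R d) :
      Df S f -> Df S g -> Df S h -> Dp S (fun x => boxnear (f x) (g x) (h x)).
    exact: Dp_boxnear.
  red; rewrite /loc; eapply Dp_ex; apply: Dp_and; first by dp.
  by do 2?[apply: Dp_or]; eapply Dp_all; apply: Dp_imp; try (by dp);
     apply: Dp_imp; try (by dp); apply: dn3; dp.
pose (U := fun u : Rn R d => U0 u /\ ~ emb S d (fun y => car K y /\ ~ loc y u)).
have iU : hasint U.
  apply: (@generic_section _ _ _ _ _ (car K) U0 (fun y u => ~ loc y u) hc hU0 _ tK iU0).
    by dp.
  move=> y Ky hW.
  pose W u := U0 u /\ ~ loc y u.
  have dW : Dp S W by rewrite /W; dp.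
  have d1 : Dp S (fun u => y ≺ phi u) by dp.
  have d2 : Dp S (fun u => phi u ≺ y) by dp.
  have d3 : Dp S (fun u => phi u = y) by dp.
  have cov u : W u -> y ≺ phi u \/ (phi u ≺ y \/ phi u = y).
    move=> [/UZ /ZK Kp _]; have [?|->|?] := lttot Ky Kp; [by left | by right; right | by right; left].
  (* A box on which one of the three relations holds throughout contains points where the relation
     is locally constant. *)
  have fin (Q : Rn R d -> Prop) : hasint (fun u => W u /\ Q u) ->
      (forall u eps, 0 < eps -> (forall v, U0 v -> boxnear eps u v -> Q v) -> loc y u) -> False.
    move=> /hasint_ball[u [eps eps0 he]] hQ.
    have [[_ nl] _] := he u (boxnear_refl u eps0).
    by apply: nl; apply: (hQ u eps) => // v _ /he[].
  have [h|h] := hasint_or d1 (Dp_or d2 d3) hW cov.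
    by apply: (fin _ h) => u eps eps0 hu; exists eps; split=> //; left.
  have [|h'|h'] := hasint_or d2 d3 h; first by move=> u [].
    apply: (fin (fun u => phi u ≺ y)).
      by apply: hasint_mono h' => u [[]].
    by move=> u eps eps0 hu; exists eps; split=> //; right; left.
  apply: (fin (fun u => phi u = y)).
    by apply: hasint_mono h' => u [[]].
  by move=> u eps eps0 hu; exists eps; split=> //; right; right.
have hU : Dp S U.
  apply: Dp_and => //; apply: Dp_not.
  by apply: (@Dp_emb _ _ _ _ _ _ _ (fun u y => car K y /\ ~ loc y u)); dp.
(* The interval from [a] to [phi u] is large and the exceptional [y] form a small set. Hence some
   good [y] lies strictly between, and it keeps [a] apart from [phi v] for all [v] near [u]. *)
have main u a : U u -> car K a -> a <> phi u -> exists y, [/\ car K y, between K a (phi u) y & loc y u].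
  move=> [Uu hu] Ka ap; apply: contrapT => hn; apply: hu.
  apply: emb_mono (big a (phi u) Ka (ZK _ (UZ _ Uu)) ap) => y hy; have Ky := hy.1.
  by split=> // ly; apply: hn; exists y.
exists U, phi; split=> //; last by move=> u [/UZ].
split.
- by move=> u [/UZ/ZK].
- by move=> u v [Uu _] [Uv _]; exact: injphi.
- move=> u a Uu Ka au; have Uu0 := Uu.1; have Kp := ZK _ (UZ _ Uu0).
  have [E|y [Ky [_ hy] [eps [eps0 he]]]] := main u a Uu Ka _.
    by move: au; rewrite E => /ltirr; exact.
  have {hy} [ay yu] : a ≺ y /\ y ≺ phi u.
    by case: hy => // -[h1 h2]; case: (ltasym Ka Kp au (lttr Kp Ky Ka h1 h2)).
  have hn := boxnear_refl u eps0.
  exists eps => // v [Uv _] nuv; have Kv := ZK _ (UZ _ Uv).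
  case: he => [h|[h|h]]; first exact: lttr ay (h v Uv nuv).
    by case: (ltasym Kp Ky (h u Uu0 hn) yu).
  by move: yu; rewrite (h u Uu0 hn) => /ltirr [].
- move=> u a Uu Ka ua; have Uu0 := Uu.1; have Kp := ZK _ (UZ _ Uu0).
  have [E|y [Ky [_ hy] [eps [eps0 he]]]] := main u a Uu Ka _.
    by move: ua; rewrite E => /ltirr; exact.
  have {hy} [uy ya] : phi u ≺ y /\ y ≺ a.
    by case: hy => // -[h1 h2]; case: (ltasym Ka Kp (lttr Ka Ky Kp h1 h2) ua).
  have hn := boxnear_refl u eps0.
  exists eps => // v [Uv _] nuv; have Kv := ZK _ (UZ _ Uv).
  case: he => [h|[h|h]].
  - by case: (ltasym Kp Ky uy (h u Uu0 hn)).
  - exact: lttr (h v Uv nuv) ya.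
  - by move: uy; rewrite (h u Uu0 hn) => /ltirr [].
Qed.

Lemma chart_path d (U : Rn R d -> Prop) phi (g : R -> Rn R d) (s t : R) y :
  chart d U phi -> s <= t -> (forall x, s <= x -> x <= t -> U (g x)) ->
  (forall x x' eps, `|x' - x| < eps -> boxnear eps (g x) (g x')) ->
  car K y -> (forall x, s <= x -> x <= t -> phi (g x) <> y) ->
  (y ≺ phi (g s) <-> y ≺ phi (g t)).
Proof.
move=> ch st gU cont Ky avoid.
apply: (@locally_constant_itv _ (fun x => y ≺ phi (g x))) => // x sx xt.
have Ux := gU x sx xt; have Kx := chart_in ch Ux.
have [h|h|h] := lttot Ky Kx; last 2 first.
- by case: (avoid x sx xt).
- have [eps eps0 he] := chart_lt ch Ux Ky h; exists eps => // x' sx' xt' nx.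
  have Ux' := gU x' sx' xt'; have h' := he _ Ux' (cont _ _ _ nx).
  split=> h2; first by case: (ltasym Ky (chart_in ch Ux') h2 h').
  by case: (ltasym Ky Kx h2 h).
- have [eps eps0 he] := chart_gt ch Ux Ky h; exists eps => // x' sx' xt' nx.
  by have h' := he _ (gU x' sx' xt') (cont _ _ _ nx).
Qed.

Lemma between_xor a b y : car K a -> car K b -> between K a b y ->
  (y ≺ a <-> y ≺ b) -> False.
Proof.
move=> Ka Kb [Ky [[h1 h2]|[h1 h2]]] [h3 h4].
  by apply: (ltasym Ky Ka) => //; exact: h4.
by apply: (ltasym Ky Kb) => //; exact: h3.
Qed.

(* Two arcs with the same endpoints and otherwise disjoint would both have to
   pass through every point between their endpoints. *)
Lemma no_dense_plane : thin S 3 (car K) -> emb S 2 (car K) ->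
  (forall a b, car K a -> car K b -> a <> b -> emb S 2 (between K a b)) -> False.
Proof.
move=> tK eK big.
have [|U [phi [hU hphi [t1 [t2 [t12 [s1 [s2 [s12 box]]]]]] ch _]]] :=
  chart_exists tK big _ eK; first by [].
have {}box s t : s1 < s -> s < s2 -> t1 < t -> t < t2 -> U (tt, s, t).
  by move=> h1 h2 h3 h4; exact: (box s h1 h2 t h3 h4).
have [a [a' [aa' [sa sa']]]] : exists a a', a < a' /\ (s1 < a /\ a' < s2).
  by exists (s1 + (s2 - s1) / 3), (s1 + (s2 - s1) / 2); split; [|split]; lra.
have [b [b' [bb' [tb tb']]]] : exists b b', b < b' /\ (t1 < b /\ b' < t2).
  by exists (t1 + (t2 - t1) / 3), (t1 + (t2 - t1) / 2); split; [|split]; lra.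
have horiz t x x' eps : `|x' - x| < eps ->
    boxnear eps ((tt, x, t) : Rn R 2) ((tt, x', t) : Rn R 2).
  by move=> h /=; rewrite subrr normr0 h; split=> //; exact: le_lt_trans h.
have vert s x x' eps : `|x' - x| < eps ->
    boxnear eps ((tt, s, x) : Rn R 2) ((tt, s, x') : Rn R 2).
  by move=> h /=; rewrite subrr normr0 h; split=> //; split=> //; exact: le_lt_trans h.
have Uab : U (tt, a, b) by apply: box; lra.
have Ua'b : U (tt, a', b) by apply: box; lra.
have Ka := chart_in ch Uab; have Ka' := chart_in ch Ua'b.
have ne : phi (tt, a, b) <> phi (tt, a', b).
  by move=> /(chart_inj ch Uab Ua'b)[E]; lra.
have [U' [psi [_ _ iU' _ UP]]] := big _ _ Ka Ka' ne.
have [u0 /UP hy] := hasint_nonempty iU'; move: (psi u0) hy => y hy {UP iU' U' psi u0}.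
have Ky := hy.1.
(* The bottom side of a rectangle joins the two corners, so it passes through [y]. *)
have [s [as' sa'' Es]] : exists s, [/\ a <= s, s <= a' & phi (tt, s, b) = y].
  apply: contrapT => hn; apply: (between_xor Ka Ka' hy).
  apply: (@chart_path 2 U phi (fun s => (tt, s, b)) a a' y ch (ltW aa')) => //.
  - by move=> x h1 h2; apply: box; lra.
  - exact: horiz.
  - by move=> x h1 h2 E; apply: hn; exists x.
have Us : U (tt, s, b) by apply: box; lra.
have nya : y <> phi (tt, a, b).
  by move=> E; case: hy => _ [[h _]|[_ h]]; move: h; rewrite E => /ltirr [].
have nya' : y <> phi (tt, a', b).
  by move=> E; case: hy => _ [[_ h]|[h _]]; move: h; rewrite E => /ltirr [].
apply: (between_xor Ka Ka' hy).
(* The other three sides meet the bottom side only in the two corners, where [phi] differs from [y];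
   by injectivity this detour avoids [y]. *)
apply: (iff_trans (B := y ≺ phi (tt, a, b'))).
  apply: (@chart_path 2 U phi (fun t => (tt, a, t)) b b' y ch (ltW bb')) => //.
  - by move=> x h1 h2; apply: box; lra.
  - exact: vert.
  - move=> x h1 h2 E; have Ux : U (tt, a, x) by apply: box; lra.
    by move: E; rewrite -Es => /(chart_inj ch Ux Us)[E _]; apply: nya; rewrite -Es E.
apply: (iff_trans (B := y ≺ phi (tt, a', b'))).
  apply: (@chart_path 2 U phi (fun s => (tt, s, b')) a a' y ch (ltW aa')) => //.
  - by move=> x h1 h2; apply: box; lra.
  - exact: horiz.
  - move=> x h1 h2 E; have Ux : U (tt, x, b') by apply: box; lra.
    by move: E; rewrite -Es => /(chart_inj ch Ux Us)[_ E]; lra.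
apply: iff_sym; apply: (@chart_path 2 U phi (fun t => (tt, a', t)) b b' y ch (ltW bb')) => //.
- by move=> x h1 h2; apply: box; lra.
- exact: vert.
- move=> x h1 h2 E; have Ux : U (tt, a', x) by apply: box; lra.
  by move: E; rewrite -Es => /(chart_inj ch Ux Us)[E _]; apply: nya'; rewrite -Es E.
Qed.

End Charts.
Arguments chart {R S n} K d U phi.

(** * Convex subgroups and cosets *)

Section Cosets.
Context {R : realType} {S : expansion R} {n : nat} (K : ordGroup S n).
Local Notation "x • y" := (mul K x y) (at level 40, left associativity).
Local Notation "x ≺ y" := (ltg K x y) (at level 70).
Local Notation "x '^~'" := (inv K x) (at level 2, format "x '^~'").
Local Notation e := (one K).

Record convex_subgroup (L : 'rV[R]_n -> Prop) : Prop := ConvexSubgroup {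
  sub_def : Dp S L;
  sub_car : forall x, L x -> car K x;
  sub_one : L e;
  sub_mul : forall x y, L x -> L y -> L (x • y);
  sub_inv : forall x, L x -> L x^~;
  sub_convex : forall h g, car K h -> L g -> e ≺ h -> h ≺ g -> L h
}.

Lemma powD x j k : car K x -> pow K x j • pow K x k = pow K x (j + k).
Proof.
move=> Kx; have Ke := one_in K; elim: j => [|j IH] /=; first by rewrite ogmul1l //; exact: pow_in.
by rewrite -IH ogmulA //; exact: pow_in.
Qed.

Context (L : 'rV[R]_n -> Prop) (hL : convex_subgroup L).

Definition same_coset x y := [/\ car K x, car K y & L (x^~ • y)].

Lemma same_coset_refl x : car K x -> same_coset x x.
Proof. by move=> Kx; split=> //; rewrite ogmulVl //; exact: sub_one hL. Qed.

Lemma same_coset_sym x y : same_coset x y -> same_coset y x.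
Proof.
move=> [Kx Ky h]; split=> //; have Ix := inv_in Kx.
by have := sub_inv hL h; rewrite oginvM // oginvK.
Qed.

Lemma same_coset_trans x y z : same_coset x y -> same_coset y z -> same_coset x z.
Proof.
move=> [Kx Ky h] [_ Kz h']; split=> //; have Ix := inv_in Kx; have Iy := inv_in Ky.
have := sub_mul hL h h'.
rewrite -ogmulA //; last exact: mul_in.
by rewrite ogmulKVl.
Qed.

Lemma Dp_same_coset (T : Type) (sT : Sp R T) (f g : T -> 'rV[R]_n) :
  Df S f -> Df S g -> Dp S (fun x => same_coset (f x) (g x)).
Proof.
move=> hf hg; have := car_def K; have := mul_def K; have := inv_def K.
by have := sub_def hL => hLd hi hm hc; rewrite /same_coset; dp.
Qed.

(** Cosets of a convex subgroup are convex, so an element of another coset lies on the same side of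
    all their elements. *)
Lemma coset_lt x x' y y' : same_coset x x' -> same_coset y y' -> ~ same_coset x y ->
  x ≺ y -> x' ≺ y'.
Proof.
have key a b c : same_coset a b -> car K c -> ~ same_coset a c -> a ≺ c -> b ≺ c.
  move=> ab Kc nac ac; have [Ka Kb Lab] := ab.
  have [//|E|cb] := lttot Kb Kc; first by case: nac; rewrite -E.
  case: nac; split=> //; have Ia := inv_in Ka.
  apply: (sub_convex hL (mul_in Ia Kc) Lab); first exact/ltdiv.
  by apply: ltmul2l.
have key' a b c : same_coset a b -> car K c -> ~ same_coset a c -> c ≺ a -> c ≺ b.
  move=> ab Kc nac ca; have [Ka Kb Lab] := ab.
  have [//|E|bc] := lttot Kc Kb; first by case: nac; rewrite E.
  have [_ _ Lba] := same_coset_sym ab.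
  case: nac; apply: same_coset_trans ab _; split=> //; have Ib := inv_in Kb.
  apply: (sub_convex hL (mul_in Ib Kc) Lba); first exact/ltdiv.
  by apply: ltmul2l.
move=> xx' yy' nxy xy; have [Kx Kx' _] := xx'; have [Ky Ky' _] := yy'.
have x'y : x' ≺ y by exact: key xx' Ky nxy xy.
apply: key' yy' Kx' _ x'y => h; apply: nxy.
exact: same_coset_trans xx' (same_coset_sym h).
Qed.

Context {S_omin : o_minimal S}.

Definition rep x := choose_row (same_coset x).

Lemma Df_rep : Df S rep.
Proof.
apply: (@Df_choose_row _ _ _ _ _ (fun x y => same_coset x y)).
by apply: Dp_same_coset; dp.
Qed.

Lemma rep_coset x : car K x -> same_coset x (rep x).
Proof.
move=> Kx; apply: choose_rowP; last by exists x; exact: same_coset_refl.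
by apply: Dp_same_coset; dp.
Qed.

Lemma rep_in x : car K x -> car K (rep x).
Proof. by move=> /rep_coset[]. Qed.

Lemma repP x y : car K x -> car K y -> rep x = rep y <-> same_coset x y.
Proof.
move=> Kx Ky; split=> [E|h].
  by apply: same_coset_trans (rep_coset Kx) _; rewrite E; apply: same_coset_sym; exact: rep_coset.
rewrite /rep; congr choose_row; apply/funext => z; apply/propext; split=> hz.
  exact: same_coset_trans (same_coset_sym h) hz.
exact: same_coset_trans h hz.
Qed.

Lemma rep_rep x : car K x -> rep (rep x) = rep x.
Proof.
move=> Kx; apply/repP => //; first exact: rep_in.
by apply: same_coset_sym; exact: rep_coset.
Qed.

(** A definable copy of the coset space inside the same ambient space; it is the carrier of
    [quotient]. *)
Definition transversal y := car K y /\ rep y = y.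

Lemma Dp_transversal : Dp S transversal.
Proof. by have := car_def K; have := Df_rep; rewrite /transversal => h1 h2; dp. Qed.

(** Multiplication is injective on pairs of a representative and an element of [L], so an interval
    in [L] contributes one more dimension. *)
Lemma emb_transversal_mul d : emb S d transversal -> emb S 1 L -> emb S d.+1 (car K).
Proof.
move=> [U [phi [hU hphi iU injphi UT]]] [V [psi [hV hpsi [a [b [ab hab]]] injpsi VL]]].
have hm := mul_def K.
exists (fun p : Rn R d.+1 => [/\ U p.1, a < p.2 & p.2 < b]),
  (fun p => phi p.1 • psi (tt, p.2)); split.
- by dp.
- by dp.
- exact: hasint_box.
- move=> [u y] [v z] /= [Uu ay yb] [Uv az zb] E.
  have Vy : V (tt, y) by exact: hab.
  have Vz : V (tt, z) by exact: hab.
  have [Ku ru] := UT _ Uu; have [Kv rv] := UT _ Uv.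
  have Ly := VL _ Vy; have Lz := VL _ Vz.
  have Ky := sub_car hL Ly; have Kz := sub_car hL Lz.
  have Iu := inv_in Ku.
  have Euv : phi u = phi v.
    rewrite -ru -rv; apply/repP => //; split=> //.
    have -> : (phi u)^~ • phi v = psi (tt, y) • (psi (tt, z))^~.
      have Ey : psi (tt, y) = ((phi u)^~ • phi v) • psi (tt, z).
        by rewrite -ogmulA // -E ogmulKl.
      by rewrite Ey ogmulKr //; exact: mul_in.
    by apply: (sub_mul hL) => //; exact: (sub_inv hL).
  rewrite (injphi _ _ Uu Uv Euv); congr pair.
  move: E; rewrite Euv => /(mul_injl Kv Ky Kz) /(injpsi _ _ Vy Vz)[] //.
- move=> [u y] /= [Uu ay yb]; have [Ku _] := UT _ Uu.
  by apply: mul_in => //; apply: (sub_car hL); apply: VL; exact: hab.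
Qed.

(** The powers of a positive element outside [L] lie in different cosets: a positive power in [L]
    would, by convexity, put the element itself into [L]. *)
Lemma transversal_infinite x : car K x -> ~ L x -> infinite_set transversal.
Proof.
have Ke := one_in K.
wlog ex : x / e ≺ x => [hw Kx nLx|Kx nLx].
  have [h|h|h] := lttot Ke Kx; first exact: hw h Kx nLx.
    by case: nLx; rewrite -h; exact: sub_one hL.
  apply: (hw x^~); [exact/ltinv | exact: inv_in |].
  by move=> /(sub_inv hL); rewrite oginvK.
move=> finT; apply: infinite_nat.
apply: (@sub_finite_set _ _ ((fun k => rep (pow K x k)) @^-1` transversal)).
  by move=> k _ /=; split; [apply: rep_in | apply: rep_rep]; exact: pow_in.
apply: finite_preimage => // j k _ _.
suff key i m : (i < m)%N -> rep (pow K x i) = rep (pow K x m) -> False.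
  by move=> E; have [h|h|//] := ltngtP j k; [case: (key _ _ h E) | case: (key _ _ h (esym E))].
move=> im /repP; case; try exact: pow_in.
move=> _ _; rewrite -(subnKC (ltnW im)) -powD // ogmulKl; try exact: pow_in.
have : (0 < m - i)%N by rewrite subn_gt0.
case: (m - i)%N => // -[|p] _ Lp.
  by apply: nLx; move: Lp; rewrite /= ogmul1r.
apply: nLx; apply: (sub_convex hL Kx Lp) => //.
by have := @pow_lt _ _ _ K x 1 p.+2 Kx ex isT; rewrite /= (ogmul1r Kx).
Qed.

End Cosets.

(** * One-dimensional groups are o-minimal *)

Lemma finite_set_max (T : Type) (C B : set T) (r : T -> T -> Prop) :
  finite_set B -> B `<=` C -> (exists x, B x) ->
  (forall x y z, C x -> C y -> C z -> r x y -> r y z -> r x z) ->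
  (forall x y, C x -> C y -> [\/ r x y, x = y | r y x]) ->
  exists2 m, B m & forall z, B z -> z = m \/ r z m.
Proof.
move=> finB BC exB tr tot; move: B finB BC exB.
apply: finite_set_rect => [_ [x []]|x B IH BC _].
have Cx : C x by apply: BC; left.
have BC' : B `<=` C by move=> y By; apply: BC; right.
case: (pselect (exists y, B y)) => [exB|nB]; last first.
  exists x; first by left.
  by move=> z [->|Bz]; [left | case: nB; exists z].
have [m Bm hm] := IH BC' exB; have Cm := BC' _ Bm.
have [xm|E|mx] := tot x m Cx Cm.
- by exists m; [right | move=> z [->|/hm //]; right].
- by exists m; [right | move=> z [->|/hm //]; left].
- exists x; first by left.
  move=> z [->|Bz]; [by left | right].
  have [->//|zm] := hm z Bz; exact: (tr z m x (BC' _ Bz) Cm Cx zm mx).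
Qed.

Section OneDimensional.
Context {R : realType} {S : expansion R} {n : nat} (K : ordGroup S n).
Local Notation "x • y" := (mul K x y) (at level 40, left associativity).
Local Notation "x ≺ y" := (ltg K x y) (at level 70).
Local Notation "x '^~'" := (inv K x) (at level 2, format "x '^~'").
Local Notation e := (one K).
Context {S_omin : o_minimal S} (tK : thin S 2 (car K)).

(** By [small_not_emb] these elements form a finite subgroup, and an ordered group with a positive
    element is infinite. *)
Lemma small_eq_one g : small K 1 g -> g = e.
Proof.
have Ke := one_in K.
have fin : finite_set (small K 1).
  apply: contrapT => /(infinite_emb1 (Dp_small K 1)); exact: small_not_emb.
have pos x : small K 1 x -> ~ e ≺ x.
  move=> sx ex; apply: (positive_infinite sx.1 ex _ fin) => k.
  by elim: k => [|k IH]; [exact: small1 | exact: smallM].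
move=> sg; have Kg := sg.1; have [h|//|h] := lttot Ke Kg; first by case: (pos _ sg).
by case: (pos _ (smallV sg)); apply/ltinv.
Qed.

Lemma between_emb1 a b : car K a -> car K b -> a <> b -> emb S 1 (between K a b).
Proof.
move=> Ka Kb ab; apply: contrapT => cl; apply: ab.
have Ia := inv_in Ka.
have : a^~ • b = e.
  apply: small_eq_one; split; first exact: mul_in.
  by rewrite -(ogmulVl Ka); exact: close_mull.
by move=> E; rewrite -(ogmulKVl Ka Kb) E ogmul1r.
Qed.

Context (nt : exists x, car K x /\ x <> e).

Lemma positive_exists : exists g, car K g /\ e ≺ g.
Proof.
have [x [Kx xe]] := nt; have Ke := one_in K; have [h|h|h] := lttot Ke Kx.
- by exists x.
- by case: xe.
- by exists x^~; split; [exact: inv_in | apply/ltinv].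
Qed.

Lemma unbounded_below z : car K z -> exists a, car K a /\ a ≺ z.
Proof.
have Ke := one_in K.
move=> Kz; have [g [Kg eg]] := positive_exists; have Ig := inv_in Kg.
exists (z • g^~); split; first exact: mul_in.
by rewrite -[X in _ ≺ X](ogmul1r Kz); apply: ltmul2l => //; apply/ltinv'.
Qed.

Lemma unbounded_above z : car K z -> exists a, car K a /\ z ≺ a.
Proof.
have Ke := one_in K.
move=> Kz; have [g [Kg eg]] := positive_exists.
exists (z • g); split; first exact: mul_in.
by rewrite -[X in X ≺ _](ogmul1r Kz); apply: ltmul2l.
Qed.

(** The boundary of [X] in the order topology. Its points become the end points of the intervals
    that make up [X]. *)
Definition bd (X : 'rV[R]_n -> Prop) z := car K z /\
  forall a b, car K a -> car K b -> a ≺ z -> z ≺ b ->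
    (exists y, [/\ car K y, a ≺ y, y ≺ b & X y]) /\
    (exists y, [/\ car K y, a ≺ y, y ≺ b & ~ X y]).

Lemma Dp_bd X : Dp S X -> Dp S (bd X).
Proof. by move=> hX; have := car_def K; have := ltg_def K; rewrite /bd => h1 h2; dp. Qed.

Lemma bd_compl X z : bd X z <-> bd (fun y => ~ X y) z.
Proof.
split=> -[Kz h]; split=> // a b Ka Kb az zb; have [h1 h2] := h a b Ka Kb az zb; split=> //.
  by have [y [? ? ? Xy]] := h1; exists y; split=> // nX; exact: nX.
by have [y [? ? ? /contrapT Xy]] := h2; exists y.
Qed.

Lemma not_bd X z : car K z -> ~ bd X z -> exists a b,
  [/\ car K a /\ car K b, a ≺ z, z ≺ b &
    (forall y, car K y -> a ≺ y -> y ≺ b -> X y) \/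
    (forall y, car K y -> a ≺ y -> y ≺ b -> ~ X y)].
Proof.
move=> Kz nb; apply: contrapT => hn; apply: nb; split=> // a b Ka Kb az zb.
split; apply: contrapT => h; apply: hn; exists a, b; split=> //.
  by right=> y Ky ay yb Xy; apply: h; exists y.
by left=> y Ky ay yb; apply: contrapT => nX; apply: h; exists y.
Qed.

Let big := between_emb1.

Lemma chart_between (U : Rn R 1 -> Prop) phi a b u v y : chart K 1 U phi ->
  (forall t, a < t -> t < b -> U (tt, t)) -> a < u -> u <= v -> v < b ->
  between K (phi (tt, u)) (phi (tt, v)) y -> exists s, [/\ u <= s, s <= v & phi (tt, s) = y].
Proof.
move=> ch ab au uv vb hy; apply: contrapT => hn.
have Ku : car K (phi (tt, u)) by apply: (chart_in ch); apply: ab; lra.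
have Kv : car K (phi (tt, v)) by apply: (chart_in ch); apply: ab; lra.
apply: (between_xor Ku Kv hy).
apply: (@chart_path _ _ _ K 1 U phi (fun s => (tt, s)) u v y ch uv).
- by move=> x h1 h2; apply: ab; lra.
- by move=> x x' eps h /=; split.
- exact: hy.1.
- by move=> x h1 h2 E; apply: hn; exists x.
Qed.

(** An injective function with the intermediate value property is monotone: if an end value lay
    between the other two values, it would be taken twice. *)
Lemma chart_monotone (U : Rn R 1 -> Prop) phi a b u t v : chart K 1 U phi ->
  (forall t, a < t -> t < b -> U (tt, t)) -> a < u -> u < t -> t < v -> v < b ->
  between K (phi (tt, u)) (phi (tt, v)) (phi (tt, t)).
Proof.
move=> ch ab au ut tv vb.
have Uu : U (tt, u) by apply: ab; lra.
have Ut : U (tt, t) by apply: ab; lra.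
have Uv : U (tt, v) by apply: ab; lra.
have Ku := chart_in ch Uu; have Kt := chart_in ch Ut; have Kv := chart_in ch Uv.
have nv : ~ between K (phi (tt, u)) (phi (tt, t)) (phi (tt, v)).
  move=> /(chart_between ch ab au (ltW ut) (lt_trans tv vb))[s [us st E]].
  have Us : U (tt, s) by apply: ab; lra.
  by have [E'] := chart_inj ch Us Uv E; lra.
have nu : ~ between K (phi (tt, t)) (phi (tt, v)) (phi (tt, u)).
  move=> /(chart_between ch ab (lt_trans au ut) (ltW tv) vb)[s [us st E]].
  have Us : U (tt, s) by apply: ab; lra.
  by have [E'] := chart_inj ch Us Uu E; lra.
split=> //.
have [h1|h1|h1] := lttot Ku Kt; last 2 first.
- by have [E'] := chart_inj ch Uu Ut h1; lra.
- have [h2|h2|h2] := lttot Kt Kv; last 2 first.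
  + by have [E'] := chart_inj ch Ut Uv h2; lra.
  + by right.
  + have [h3|h3|h3] := lttot Ku Kv.
    * by case: nu; split=> //; left.
    * by have [E'] := chart_inj ch Uu Uv h3; lra.
    * by case: nv; split=> //; right.
- have [h2|h2|h2] := lttot Kt Kv.
  + by left.
  + by have [E'] := chart_inj ch Ut Uv h2; lra.
  + have [h3|h3|h3] := lttot Ku Kv.
    * by case: nv; split=> //; left.
    * by have [E'] := chart_inj ch Uu Uv h3; lra.
    * by case: nu; split=> //; right.
Qed.

(** Otherwise a chart runs inside the boundary, and on a subinterval all its points lie in [X] or
    all lie outside. By [chart_between] this part of the chart fills an order interval around one of
    its points, which then cannot be a boundary point. *)
Lemma bd_finite X : Dp S X -> finite_set (bd X).
Proof.
move=> hX; apply: contrapT => /(infinite_emb1 (Dp_bd hX)) eX.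
have [z [] //|U [phi [hU hphi iU ch UB]]] := chart_exists tK big _ eX.
have d1 : Dp S (fun u => X (phi u)) by dp.
have key (Q : 'rV[R]_n -> Prop) : hasint (fun u => U u /\ Q (phi u)) ->
    (forall z, bd X z -> forall a b, car K a -> car K b -> a ≺ z -> z ≺ b ->
       exists y, [/\ car K y, a ≺ y, y ≺ b & ~ Q y]) -> False.
  move=> [a [b [ab box]]] hQ.
  have Uab t : a < t -> t < b -> U (tt, t) by move=> h1 h2; have [] := box t h1 h2.
  have [u [t [v [au [ut [tv vb]]]]]] : exists u t v, a < u /\ (u < t /\ (t < v /\ v < b)).
    by exists (a + (b - a) / 4), (a + (b - a) / 3), (a + (b - a) / 2);
       split; [|split; [|split]]; lra.
  have Uu : U (tt, u) by apply: Uab; lra.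
  have Ut : U (tt, t) by apply: Uab; lra.
  have Uv : U (tt, v) by apply: Uab; lra.
  have hb := chart_monotone ch Uab au ut tv vb.
  have [y hy nQ] : exists2 y, between K (phi (tt, u)) (phi (tt, v)) y & ~ Q y.
    have Ku := chart_in ch Uu; have Kv := chart_in ch Uv.
    case: (hb) => _ [[h1 h2]|[h1 h2]].
      by have [y [Ky h3 h4 nQ]] := hQ _ (UB _ Ut) _ _ Ku Kv h1 h2; exists y => //; split=> //; left.
    by have [y [Ky h3 h4 nQ]] := hQ _ (UB _ Ut) _ _ Kv Ku h1 h2; exists y => //; split=> //; right.
  have [s [us sv Es]] := chart_between ch Uab au (ltW (lt_trans ut tv)) vb hy.
  by apply: nQ; rewrite -Es; have [] := box s (lt_le_trans au us) (le_lt_trans sv vb).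
have [h|h] := hasint_or d1 (Dp_not d1) iU (fun u _ => EM (X (phi u))).
  by apply: (key X h) => z [_ hz] a b Ka Kb az zb; have [_] := hz a b Ka Kb az zb.
apply: (key (fun y => ~ X y) h) => z [_ hz] a b Ka Kb az zb.
by have [[y [? ? ? Xy]] _] := hz a b Ka Kb az zb; exists y; split=> // nX; exact: nX.
Qed.

(* A cut without boundary point has a nontrivial stabilizer, because it cannot
   split a chart; the stabilizer is a proper convex subgroup, and its cosets
   would make the group two-dimensional. *)
Lemma cut_has_bd X x y : Dp S X -> (forall x, X x -> car K x) ->
  (forall x y, X x -> car K y -> y ≺ x -> X y) -> X x -> car K y -> ~ X y ->
  exists z, bd X z.
Proof.
move=> hX XK ini Xx Ky nXy; apply: contrapT => nobd.
have Kx := XK _ Xx; have Ke := one_in K; have hm := mul_def K; have hc := car_def K.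
have [g [Kg eg]] := positive_exists.
have eK : emb S 1 (car K).
  apply: emb_mono (big Ke Kg _); first by move=> z [].
  by move=> E; move: eg; rewrite -E => /ltirr; exact.
have [//|U [phi [hU hphi [a [b [ab box]]] ch _]]] := chart_exists tK big _ eK.
have [u [v [au [uv vb]]]] : exists u v, a < u /\ (u < v /\ v < b).
  by exists (a + (b - a) / 3), (a + (b - a) / 2); split; [|split]; lra.
have Uu : U (tt, u) by apply: box; lra.
have Uv : U (tt, v) by apply: box; lra.
have Ku := chart_in ch Uu; have Kv := chart_in ch Uv; have Iu := inv_in Ku.
pose h := phi (tt, v) • (phi (tt, u))^~.
have Kh : car K h by exact: mul_in.
(* The path from [u] to [v], translated on the right by [c], leads from [k] to [h • k]. Membership
   in [X] cannot change along it, because [X] has no boundary point. *)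
have hx k : car K k -> (X k <-> X (h • k)).
  move=> Kk; pose c := (phi (tt, u))^~ • k; have Kc : car K c by exact: mul_in.
  have Ic := inv_in Kc.
  have -> : h • k = phi (tt, v) • c by rewrite /h /c ogmulA.
  rewrite -{1}(ogmulKVl Ku Kk) -/c.
  apply: (@locally_constant_itv _ (fun s => X (phi (tt, s) • c))) => [|s us sv]; first exact: ltW.
  have Us : U (tt, s) by apply: box; lra.
  have Ks := chart_in ch Us; have Ksc := mul_in Ks Kc.
  have [|p [q [[Kp Kq] ps sq hpq]]] := not_bd (X := X) Ksc.
    by move=> hb; apply: nobd; exists (phi (tt, s) • c).
  have ps' : p • c^~ ≺ phi (tt, s).
    by rewrite -(ogmulKr Ks Kc); apply: ltmul2r.
  have sq' : phi (tt, s) ≺ q • c^~.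
    by rewrite -(ogmulKr Ks Kc); apply: ltmul2r.
  have [e1 e10 h1] := chart_gt ch Us (mul_in Kp Ic) ps'.
  have [e2 e20 h2] := chart_lt ch Us (mul_in Kq Ic) sq'.
  exists (Num.min e1 e2); first by rewrite lt_min e10.
  move=> s' us' s'v; rewrite lt_min => /andP[n1 n2].
  have Us' : U (tt, s') by apply: box; lra.
  have Ks' := chart_in ch Us'; have Ksc' := mul_in Ks' Kc.
  have l1 : p ≺ phi (tt, s') • c.
    by rewrite -(ogmulKVr Kp Kc); apply: ltmul2r => //; [exact: mul_in | apply: h1 => //=].
  have l2 : phi (tt, s') • c ≺ q.
    by rewrite -(ogmulKVr Kq Kc); apply: ltmul2r => //; [exact: mul_in | apply: h2 => //=].
  case: hpq => hpq; first by split=> _; exact: hpq.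
  by split=> h'; exfalso; [exact: (hpq _ Ksc' l1 l2 h') | exact: (hpq _ Ksc ps sq h')].
have ne1 : h <> e.
  move=> E; have : phi (tt, v) = phi (tt, u) by rewrite -(ogmulKVr Kv Ku) -/h E ogmul1l.
  by move/(chart_inj ch Uv Uu) => -[]; lra.
(* The stabilizer of the cut under left multiplication. *)
pose L k := car K k /\ forall z, car K z -> (X z <-> X (k • z)).
have sL : convex_subgroup K L.
  split.
  - by rewrite /L; dp.
  - by move=> k [].
  - by split=> // z Kz; rewrite ogmul1l.
  - move=> k l [Kk hk] [Kl hl]; split=> [|z Kz]; first exact: mul_in.
    by rewrite -ogmulA //; exact: iff_trans (hl z Kz) (hk _ (mul_in Kl Kz)).
  - move=> k [Kk hk]; have Ik := inv_in Kk; split=> // z Kz.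
    by have := hk _ (mul_in Ik Kz); rewrite ogmulKVl // => h'; exact: (iff_sym h').
  - move=> k l Kk [Kl hl] ek kl; split=> // z Kz; split=> [Xz|].
      by apply: (ini (l • z)); [exact: (hl z Kz).1 | exact: mul_in | exact: ltmul2r].
    by move=> Xkz; apply: (ini _ _ Xkz) => //; have := ltmul2r Kz Ke Kk ek; rewrite ogmul1l.
have Lh : L h by [].
(* This translation takes [x], which lies in the cut, to [y], which does not; so the stabilizer is
   proper. *)
have nL : ~ L (y • x^~).
  move=> [Kyx] /(_ x Kx)[/(_ Xx) + _]; rewrite ogmulKVr //; exact: nXy.
have Lpos : exists2 k, L k & e ≺ k.
  have [?|?|?] := lttot Ke Kh; [by exists h | by case: ne1 |].
  by exists h^~; [exact: (sub_inv sL) | apply/ltinv].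
have [k Lk ek] := Lpos.
have infL : infinite_set L.
  apply: (positive_infinite (sub_car sL Lk) ek) => j.
  by elim: j => [|j IH]; [exact: (sub_one sL) | exact: (sub_mul sL)].
have eL : emb S 1 L by exact: (infinite_emb1 (sub_def sL) infL).
have eT : emb S 1 (transversal K L).
  apply: (infinite_emb1 (Dp_transversal sL)).
  exact: (transversal_infinite sL (mul_in Ky (inv_in Kx)) nL).
have eK2 : emb S 2 (car K) by exact: (emb_transversal_mul sL eT eL).
exact: (emb_thin eK2 tK).
Qed.

(** Reduces a change of membership to the case of a cut: the boundary point comes from the set of
    elements up to which [X] has not failed since [z]. *)
Lemma constant_aux X z w : Dp S X -> car K z -> car K w -> z ≺ w -> X z -> ~ X w ->
  exists b, [/\ bd X b, z ≺ b \/ z = b & b ≺ w \/ b = w].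
Proof.
move=> hX Kz Kw zw Xz nXw; have hc := car_def K; have hl := ltg_def K.
(* The first alternative makes [Y] closed downwards, as [cut_has_bd] requires. *)
pose Y k := car K k /\
  (k ≺ z \/ forall j, car K j -> z ≺ j \/ z = j -> j ≺ k \/ j = k -> X j).
have hY : Dp S Y by rewrite /Y; dp.
have Yz : Y z.
  split=> //; right=> j Kj [zj|<- //] [jz|E]; first by case: (ltasym Kz Kj zj jz).
  by move: zj; rewrite E => /ltirr [].
have above k : car K k -> w ≺ k \/ w = k -> ~ Y k.
  move=> Kk wk [_ [kz|h]].
    case: wk => [wk|E]; last by apply: (ltasym Kz Kw zw); rewrite E.
    exact: (ltasym Kz Kw zw (lttr Kw Kk Kz wk kz)).
  by apply: nXw; apply: h => //; left.
have Yini k l : Y k -> car K l -> l ≺ k -> Y l.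
  move=> [Kk h] Kl lk; split=> //; case: h => [kz|h]; first by left; exact: lttr lk kz.
  right=> j Kj zj jl; apply: h => //; left.
  by case: jl => [jl|-> //]; exact: lttr jl lk.
have [b hb] := cut_has_bd hY (fun x => @proj1 _ _) Yini Yz Kw (above w Kw (or_intror erefl)).
have Kb := hb.1.
have zb : z ≺ b \/ z = b.
  have [?|?|bz] := lttot Kz Kb; [by left | by right | exfalso].
  have [a [Ka ab]] := unbounded_below Kb.
  have [_ [y [Ky _ yz nY]]] := hb.2 a z Ka Kz ab bz.
  by apply: nY; split=> //; left.
have bw : b ≺ w \/ b = w.
  have [?|?|wb] := lttot Kb Kw; [by left | by right | exfalso].
  have [a [Ka ba]] := unbounded_above Kb.
  have [[y [Ky wy _ Yy]] _] := hb.2 w a Kw Ka wb ba.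
  by apply: (above y Ky _ Yy); left.
exists b; split=> //; apply: contrapT => nb.
have [p [q [[Kp Kq] pb bq hpq]]] := not_bd Kb nb.
have [[k [Kk pk kq [_ Yk]]] [l [Kl pl lq nYl]]] := hb.2 p q Kp Kq pb bq.
have zq : z ≺ q by case: zb => [zb|-> //]; exact: lttr zb bq.
(* If [X] fails all around [b], this contradicts [k] in [Y]. If [X] holds all around [b], the
   failure [j] that keeps [l] out of [Y] lies at or below [p], hence below [k], with the same
   contradiction. *)
case: hpq => hpq; last first.
  have [kz|zk|zk] := lttot Kk Kz.
  - by apply: (hpq z) => //; exact: lttr pk kz.
  - by apply: (hpq z) => //; rewrite -zk.
  - case: Yk => [kz|h]; first exact: ltasym Kk Kz kz zk.
    by apply: (hpq k) => //; apply: h => //; [left | right].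
have [j [Kj zj jl nXj]] : exists j, [/\ car K j, z ≺ j \/ z = j, j ≺ l \/ j = l & ~ X j].
  apply: contrapT => hn; apply: nYl; split=> //; right=> j Kj zj jl.
  by apply: contrapT => nXj; apply: hn; exists j.
have jq : j ≺ q by case: jl => [jl|-> //]; exact: lttr jl lq.
have jp : ~ p ≺ j by move=> pj; apply: nXj; exact: hpq.
have jk : j ≺ k.
  by have [h|h|h] := lttot Kp Kj; [case: jp | rewrite -h | exact: lttr h pk].
case: Yk => [kz|h]; last by apply: nXj; apply: h => //; left.
case: zj => [zj|E]; first exact: (ltasym Kz Kj zj (lttr Kj Kk Kz jk kz)).
by apply: (ltasym Kj Kk jk); rewrite -E.
Qed.

Lemma constant_between_bd X z w : Dp S X -> car K z -> car K w -> z ≺ w ->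
  (forall b, bd X b -> z ≺ b \/ z = b -> b ≺ w \/ b = w -> False) -> (X z <-> X w).
Proof.
move=> hX Kz Kw zw nb; split=> h; apply: contrapT => h'.
  by have [b [hb zb bw]] := constant_aux hX Kz Kw zw h h'; exact: nb hb zb bw.
have [|b [hb zb bw]] := constant_aux (Dp_not hX) Kz Kw zw h'; first by move=> /(_ h).
exact: nb ((bd_compl X b).2 hb) zb bw.
Qed.

(** A non-boundary point of [A] lies in the interval between the neighbouring boundary points, and
    there membership in [A] is constant. So [A] consists of boundary points and of intervals between
    boundary points or infinite ends. *)
Theorem one_dimensional_o_minimal : o_minimal_group S (ogroup_data K).
Proof.
have hc := car_def K; have hl := ltg_def K.
split; first exact: ogroup_data_ordered.
  have [g [Kg eg]] := positive_exists.
  by apply: (positive_infinite Kg eg) => k; exact: pow_in.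
move=> A /= AK /definableP hA.
have finB := bd_finite hA.
pose J (p : option 'rV[R]_n * option 'rV[R]_n) := open_interval (car K) (ltg K) p.1 p.2.
(* The admissible end points; there are finitely many, hence finitely many intervals. *)
pose E : set (option 'rV[R]_n) := None |` Some @` bd A.
have finE : finite_set E by rewrite /E finite_setU; split; [exact: finite_set1 | exact: finite_image].
have EK o : E o -> in_opt (car K) o by case=> [->|[z [Kz _] <-]].
exists ((J @` [set p | (E p.1 /\ E p.2) /\ J p `<=` A]) `|` (fun z => [set z]) @` [set z | bd A z /\ A z]).
split.
- rewrite finite_setU; split; apply: finite_image.
    apply: (@sub_finite_set _ _ (E `*` E)); last exact: finite_setX.
    by move=> p [].
  by apply: sub_finite_set finB => z [].
- move=> B [[[a b] [[/= Ea Eb] _] <-]|[z [[Kz _] _] <-]]; last by left; exists z.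
  by right; exists a, b; split=> //; exact: EK.
- apply/seteqP; split=> [x Ax|x [B [[p [_ pA] <-]|[z [_ Az] <-]]]]; last 2 first.
  + exact: pA.
  + by move=> ->.
  have Kx := AK _ Ax.
  case: (pselect (bd A x)) => [bx|nbx].
    by exists [set x] => //; right; exists x.
  have [a [Ea ax amax]] : exists a, [/\ E a, (if a is Some u then u ≺ x else True) &
      forall z, bd A z -> z ≺ x -> if a is Some u then z = u \/ z ≺ u else False].
    case: (pselect (exists z, bd A z /\ z ≺ x)) => [ex|nex]; last first.
      by exists None; split=> //; [left | move=> z bz zx; apply: nex; exists z].
    have [||||m [bm mx] hm] := @finite_set_max _ (car K) [set z | bd A z /\ z ≺ x] (ltg K) _ _ ex.
    - by apply: sub_finite_set finB => z [].
    - by move=> z [[]].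
    - by move=> u v w; exact: lttr.
    - by move=> u v; exact: lttot.
    exists (Some m); split=> //; first by right; exists m.
    by move=> z bz zx; exact: hm.
  have [b [Eb xb bmin]] : exists b, [/\ E b, (if b is Some u then x ≺ u else True) &
      forall z, bd A z -> x ≺ z -> if b is Some u then z = u \/ u ≺ z else False].
    case: (pselect (exists z, bd A z /\ x ≺ z)) => [ex|nex]; last first.
      by exists None; split=> //; [left | move=> z bz zx; apply: nex; exists z].
    have [||||m [bm mx] hm] := @finite_set_max _ (car K) [set z | bd A z /\ x ≺ z] (fun u v => v ≺ u) _ _ ex.
    - by apply: sub_finite_set finB => z [].
    - by move=> z [[]].
    - by move=> u v w Ku Kv Kw h1 h2; exact: lttr h2 h1.
    - by move=> u v Ku Kv; have [?|?|?] := lttot Ku Kv; [exact: Or33 | exact: Or32 | exact: Or31].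
    exists (Some m); split=> //; first by right; exists m.
    by move=> z bz zx; exact: hm.
  have Jx : J (a, b) x by split.
  have Ka := EK _ Ea; have Kb := EK _ Eb.
  have nbd z : J (a, b) z -> ~ bd A z.
    move=> [Kz /= az zb] bz; have [zx|E1|xz] := lttot Kz Kx.
    - have := amax z bz zx; case: a {Ea ax amax Jx} Ka az => //= u Ku uz [E1|zu].
        by move: uz; rewrite E1 => /ltirr; exact.
      exact: ltasym Ku Kz uz zu.
    - by apply: nbx; rewrite -E1.
    - have := bmin z bz xz; case: b {Eb xb bmin Jx} Kb zb => //= u Ku zu [E1|uz].
        by move: zu; rewrite E1 => /ltirr; exact.
      exact: ltasym Ku Kz uz zu.
  have Jconv p q r : J (a, b) p -> J (a, b) q -> car K r ->
      p ≺ r \/ p = r -> r ≺ q \/ r = q -> J (a, b) r.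
    move=> [Kp /= ap _] [Kq /= _ qb] Kr pr rq; split=> //=.
      case: a {Ea ax amax Jx nbd} Ka ap => //= u Ku up.
      by case: pr => [pr|<- //]; exact: lttr up pr.
    case: b {Eb xb bmin Jx nbd} Kb qb => //= u Ku qu.
    by case: rq => [rq|-> //]; exact: lttr rq qu.
  exists (J (a, b)) => //; left; exists (a, b) => //; split=> //= w Jw.
  have Kw : car K w by case: Jw.
  have [wx|-> //|xw] := lttot Kw Kx.
    apply/(constant_between_bd hA Kw Kx wx) => // z bz wz zx.
    exact: (nbd z (Jconv w x z Jw Jx bz.1 wz zx) bz).
  apply/(constant_between_bd hA Kx Kw xw) => // z bz xz zw.
  exact: (nbd z (Jconv x w z Jx Jw bz.1 xz zw) bz).
Qed.

End OneDimensional.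

(** * Convex subgroups and their quotients as ordered groups *)

Section SubQuotient.
Context {R : realType} {S : expansion R} {n : nat} (K : ordGroup S n).
Context (L : 'rV[R]_n -> Prop) (hL : convex_subgroup K L).
Local Notation "x • y" := (mul K x y) (at level 40, left associativity).
Local Notation "x ≺ y" := (ltg K x y) (at level 70).
Local Notation "x '^~'" := (inv K x) (at level 2, format "x '^~'").
Local Notation e := (one K).

Definition subgroup : ordGroup S n.
Proof.
pose proof (sub_car hL) as LK.
refine (@OrdGroup R S n L (mul K) (inv K) e (ltg K) (sub_def hL)
  (mul_def K) (inv_def K) (ltg_def K) _ _ _ _ _ _ _ _ _ _ _ _ _).
- exact: sub_mul hL.
- exact: sub_inv hL.
- exact: sub_one hL.
- by move=> x y z /LK Kx /LK Ky /LK Kz; exact: ogmulA.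
- by move=> x /LK; exact: ogmul1l.
- by move=> x /LK; exact: ogmul1r.
- by move=> x /LK; exact: ogmulVl.
- by move=> x /LK; exact: ogmulVr.
- by move=> x /LK; exact: ltirr.
- by move=> x y z /LK Kx /LK Ky /LK Kz; exact: lttr.
- by move=> x y /LK Kx /LK Ky; exact: lttot.
- by move=> z x y /LK Kz /LK Kx /LK Ky; exact: ltmul2l.
- by move=> z x y /LK Kz /LK Kx /LK Ky; exact: ltmul2r.
Defined.

Context (normalL : forall x g, car K x -> L g -> L (x • g • x^~)).
Context {S_omin : o_minimal S}.
Local Notation rep := (rep K L).

Lemma same_coset_mul x x' y y' : same_coset K L x x' -> same_coset K L y y' ->
  same_coset K L (x • y) (x' • y').
Proof.
move=> [Kx Kx' Lx] [Ky Ky' Ly]; split; [exact: mul_in | exact: mul_in |].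
have Ix := inv_in Kx; have Iy := inv_in Ky; have Ixx' := mul_in Ix Kx'.
(* The quotient of the two products is the conjugate of [x^~ • x'] by [y^~], times [y^~ • y']; this
   is where normality enters. *)
have := sub_mul hL (normalL Iy Lx) Ly; rewrite oginvK //.
have -> : y^~ • (x^~ • x') • y • (y^~ • y') = (x • y)^~ • (x' • y') => //.
rewrite oginvM // -(ogmulA (mul_in Iy Ixx') Ky) ?ogmulKVl //; last exact: mul_in.
by rewrite -!ogmulA //; exact: mul_in.
Qed.

Lemma transversal_neq x y : transversal K L x -> transversal K L y -> x <> y ->
  ~ same_coset K L x y.
Proof. by move=> [Kx rx] [Ky ry] xy /(repP hL Kx Ky); rewrite rx ry. Qed.

Lemma same_coset_cancel_l z x y : car K z -> car K x -> car K y ->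
  same_coset K L (z • x) (z • y) -> same_coset K L x y.
Proof.
move=> Kz Kx Ky [_ _ h]; split=> //; have Ix := inv_in Kx; have Iz := inv_in Kz.
by move: h; rewrite oginvM // -ogmulA ?ogmulKl //; exact: mul_in.
Qed.

Lemma same_coset_cancel_r z x y : car K z -> car K x -> car K y ->
  same_coset K L (x • z) (y • z) -> same_coset K L x y.
Proof.
move=> Kz Kx Ky h; have Iz := inv_in Kz.
by have := same_coset_mul h (same_coset_refl hL Iz); rewrite !ogmulKr.
Qed.

Lemma transversal_rep x : car K x -> transversal K L (rep x).
Proof. by move=> Kx; split; [exact: rep_in | exact: rep_rep]. Qed.

(** The order on representatives is that of [K]; by [coset_lt] it is compatible with replacing a
    product by its representative. *)
Definition quotient : ordGroup S n.
Proof.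
pose proof (fun x (Tx : transversal K L x) => proj1 Tx) as Kin.
pose proof (mul_def K) as hm; pose proof (inv_def K) as hi; pose proof (Df_rep hL) as hr.
pose proof (fun x (Kx : car K x) => same_coset_sym hL (rep_coset hL Kx)) as rc.
pose proof (fun x (Kx : car K x) => same_coset_refl hL Kx) as rf.
refine (@OrdGroup R S n (transversal K L) (fun x y => rep (x • y)) (fun x => rep x^~)
  (rep e) (ltg K) (Dp_transversal hL) _ _ (ltg_def K) _ _ _ _ _ _ _ _ _ _ _ _ _).
- by dp.
- by dp.
- by move=> x y /Kin Kx /Kin Ky; apply: transversal_rep; exact: mul_in.
- by move=> x /Kin Kx; apply: transversal_rep; exact: inv_in.
- by apply: transversal_rep; exact: one_in.
- move=> x y z /Kin Kx /Kin Ky /Kin Kz.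
  have Kxy := mul_in Kx Ky; have Kyz := mul_in Ky Kz.
  apply/(repP hL).
  + by apply: mul_in => //; exact: rep_in.
  + by apply: mul_in => //; exact: rep_in.
  + apply: (same_coset_trans hL (same_coset_mul (rf x Kx) (rc _ Kyz))).
    rewrite ogmulA //; apply: same_coset_sym => //.
    exact: (same_coset_mul (rc _ Kxy) (rf z Kz)).
- move=> x Tx; have Kx := Kin x Tx; rewrite -[RHS](proj2 Tx).
  have Ke := one_in K; apply/(repP hL); [by apply: mul_in => //; exact: rep_in | by [] |].
  by rewrite -[X in same_coset _ _ _ X](ogmul1l Kx); apply: same_coset_mul; [exact: rc | exact: rf].
- move=> x Tx; have Kx := Kin x Tx; rewrite -[RHS](proj2 Tx).
  have Ke := one_in K; apply/(repP hL); [by apply: mul_in => //; exact: rep_in | by [] |].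
  by rewrite -[X in same_coset _ _ _ X](ogmul1r Kx); apply: same_coset_mul; [exact: rf | exact: rc].
- move=> x Tx; have Kx := Kin x Tx; have Ix := inv_in Kx; have Ke := one_in K.
  apply/(repP hL) => //; first by apply: mul_in => //; exact: rep_in.
  by rewrite -(ogmulVl Kx); apply: same_coset_mul; [exact: rc | exact: rf].
- move=> x Tx; have Kx := Kin x Tx; have Ix := inv_in Kx; have Ke := one_in K.
  apply/(repP hL) => //; first by apply: mul_in => //; exact: rep_in.
  by rewrite -(ogmulVr Kx); apply: same_coset_mul; [exact: rf | exact: rc].
- by move=> x /Kin; exact: ltirr.
- by move=> x y z /Kin Kx /Kin Ky /Kin Kz; exact: lttr.
- by move=> x y /Kin Kx /Kin Ky; exact: lttot.
- move=> z x y /Kin Kz Tx Ty xy; have Kx := Kin x Tx; have Ky := Kin y Ty.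
  have nxy : ~ same_coset K L x y.
    by apply: transversal_neq => // E; move: xy; rewrite E => /ltirr; exact.
  apply: (coset_lt hL (rep_coset hL (mul_in Kz Kx)) (rep_coset hL (mul_in Kz Ky))).
    by move/same_coset_cancel_l => h; apply: nxy; exact: h.
  exact: ltmul2l.
- move=> z x y /Kin Kz Tx Ty xy; have Kx := Kin x Tx; have Ky := Kin y Ty.
  have nxy : ~ same_coset K L x y.
    by apply: transversal_neq => // E; move: xy; rewrite E => /ltirr; exact.
  apply: (coset_lt hL (rep_coset hL (mul_in Kx Kz)) (rep_coset hL (mul_in Ky Kz))).
    by move/same_coset_cancel_r => h; apply: nxy; exact: h.
  exact: ltmul2r.
Defined.

End SubQuotient.

(** * Two-dimensional groups *)

Section TwoDimensional.
Context {R : realType} {S : expansion R} {n : nat} (K : ordGroup S n).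
Context {S_omin : o_minimal S}.
Local Notation "x • y" := (mul K x y) (at level 40, left associativity).
Local Notation "x ≺ y" := (ltg K x y) (at level 70).
Local Notation "x '^~'" := (inv K x) (at level 2, format "x '^~'").
Local Notation e := (one K).

Lemma small_convex_subgroup d : convex_subgroup K (small K d.+1).
Proof.
split.
- exact: Dp_small.
- by move=> x [].
- exact: small1.
- by move=> x y; exact: smallM.
- by move=> x; exact: smallV.
- by move=> h g Kh sg eh hg; exact: small_convex sg eh hg.
Qed.

Lemma small_normal d x g : car K x -> small K d g -> small K d (x • g • x^~).
Proof. exact: smallJ. Qed.

Local Notation H := (small_convex_subgroup 1).

Context (tK : thin S 3 (car K)) (eK : emb S 2 (car K)).

(** If [H] were trivial, translation would make every interval two-dimensional, the situation
    excluded by [no_dense_plane]. *)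
Lemma small_nontrivial : exists x, small K 2 x /\ x <> e.
Proof.
apply: contrapT => hn; apply: (no_dense_plane tK eK) => a b Ka Kb ab.
apply: contrapT => cl; apply: ab; have Ia := inv_in Ka.
have E : a^~ • b = e.
  apply: contrapT => ne; apply: hn; exists (a^~ • b); split=> //.
  split; first exact: mul_in.
  by rewrite -(ogmulVl Ka); exact: close_mull.
by rewrite -(ogmulKVl Ka Kb) E ogmul1r.
Qed.

Lemma small_o_minimal : o_minimal_group S (ogroup_data (subgroup H)).
Proof.
have tH : thin S 2 (small K 2).
  by have [/(small_not_emb tK)|] := emb_or_thin 2 (Dp_small K 2).
exact: (@one_dimensional_o_minimal _ _ _ (subgroup H) S_omin tH small_nontrivial).
Qed.

Lemma emb1_small : emb S 1 (small K 2).
Proof.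
apply: infinite_emb1; first exact: Dp_small.
by have [_] := small_o_minimal.
Qed.

(** A two-dimensional transversal together with the one-dimensional [H] would give dimension three.
    The transversal is infinite because [H], having smaller dimension, is not the whole group. *)
Lemma quotient_o_minimal :
  o_minimal_group S (ogroup_data (quotient H (@small_normal 2))).
Proof.
have hT := Dp_transversal H.
have tT : thin S 2 (transversal K (small K 2)).
  have [eT|//] := emb_or_thin 2 hT.
  have e3 : emb S 3 (car K) by exact: (emb_transversal_mul H eT emb1_small).
  by case: (emb_thin e3 tK).
have [x [Kx nx]] : exists x, car K x /\ ~ small K 2 x.
  apply: contrapT => hn; apply: (small_not_emb tK); apply: emb_mono eK => x Kx.
  by apply: contrapT => nx; apply: hn; exists x.
apply: one_dimensional_o_minimal => //=.
apply: contrapT => hn; apply: (transversal_infinite H Kx nx).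
apply: (@sub_finite_set _ _ [set rep K (small K 2) e]); last exact: finite_set1.
by move=> y Ty /=; apply: contrapT => ne; apply: hn; exists y.
Qed.

End TwoDimensional.

(** * The additive and the multiplicative group of the reals *)

Section RealGroups.
Context {R : realType} {S : expansion R}.

Lemma Df_inv (T : Type) (sT : Sp R T) (f : T -> R) : Df S f -> Df S (fun x => (f x)^-1).
Proof.
move=> hf; rewrite /Df; apply: (@Dp_ext _ _ _ _ (fun p : T * R =>
  (f p.1 = 0 /\ p.2 = 0) \/ f p.1 * p.2 = 1)); last by dp.
move=> [x y] /=; split=> [[[-> ->]|E]|->]; first by rewrite invr0.
  have f0 : f x != 0 by apply/eqP => f0; move: E; rewrite f0 mul0r => /eqP; rewrite eq_sym oner_eq0.
  by apply: (mulfI f0); rewrite E divff.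
have [->|f0] := eqVneq (f x) 0; first by left; rewrite invr0.
by right; rewrite divff.
Qed.

Definition row1 (r : R) : 'rV[R]_1 := const_mx r.

Lemma row1E r i j : row1 r i j = r. Proof. by rewrite mxE. Qed.

Lemma row1K (x : 'rV[R]_1) : row1 (x 0 0) = x.
Proof. by apply/rowP => i; rewrite mxE (ord1 i). Qed.

Lemma Df_row1 (T : Type) (sT : Sp R T) (f : T -> R) : Df S f -> Df S (fun x => row1 (f x)).
Proof.
move=> hf; apply: Df_row => i.
by have -> : (fun x => row1 (f x) 0 i) = f by apply/funext => x; rewrite row1E.
Qed.

Lemma Df_totalize n m (A : set 'rV[R]_n) (f : 'rV[R]_n -> 'rV[R]_m) :
  Dp S A -> definable_map S A f -> Df S (fun x => if `[< A x >] then f x else 0).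
Proof.
move=> hA /definableP hf; rewrite /Df; apply: (@Dp_ext _ _ _ _ (fun p : 'rV[R]_n * 'rV[R]_m =>
  let z := row_mx p.1 p.2 in
  (A (lsubmx z) /\ rsubmx z = f (lsubmx z)) \/ (~ A p.1 /\ p.2 = 0))).
  by move=> [x y] /=; rewrite row_mxKl row_mxKr; case: asboolP => Ax; tauto.
apply: Dp_or; last by dp.
apply: (@Dp_comp _ _ _ _ _ _ _ (fun p : 'rV[R]_n * 'rV[R]_m => row_mx p.1 p.2) hf).
by dp.
Qed.

Lemma definable_mapP n m (A : set 'rV[R]_n) (f : 'rV[R]_n -> 'rV[R]_m) :
  Dp S A -> Df S f -> definable_map S A f.
Proof. by move=> hA hf; apply/definableP; dp. Qed.

Lemma thin_row1 (X : 'rV[R]_1 -> Prop) : thin S 2 X.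
Proof.
exists unit, (fun _ _ => True), (fun _ x => (tt, x 0 0)); split.
- by move=> _; exact: Dp_cst.
- by move=> _; dp.
- by move=> _ x y _ _ [E]; rewrite -(row1K x) -(row1K y) E.
- by move=> x _; exists tt.
Qed.

Lemma Df_rowop (f : R -> R -> R) : Df2 S f ->
  Df2 S (fun x y : 'rV[R]_1 => \row_i f (x 0 i) (y 0 i)).
Proof.
move=> hf; apply: Df_row => i.
have -> : (fun p : 'rV[R]_1 * 'rV[R]_1 => (\row_j f (p.1 0 j) (p.2 0 j)) 0 i) =
    (fun p => f (p.1 0 i) (p.2 0 i)) by apply/funext => p; rewrite mxE.
by dp.
Qed.

Definition add_group : ordGroup S 1.
Proof.
refine (@OrdGroup R S 1 (fun _ => True) (fun x y => x + y) (fun x => - x) 0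
  (fun x y => x 0 0 < y 0 0) _ _ _ _ _ _ _ _ _ _ _ _ _ _ _ _ _) => //.
- by dp.
- have -> : (fun x y : 'rV[R]_1 => x + y) = (fun x y => \row_i (x 0 i + y 0 i)).
    by apply/funext => x; apply/funext => y; apply/rowP => i; rewrite !mxE.
  by apply: (@Df_rowop (fun x y => x + y)); dp.
- apply: Df_row => i.
  have -> : (fun x : 'rV[R]_1 => (- x) 0 i) = (fun x => - x 0 i).
    by apply/funext => x; rewrite mxE.
  by dp.
- by dp.
- by move=> *; rewrite addrA.
- by move=> *; rewrite add0r.
- by move=> *; rewrite addr0.
- by move=> *; rewrite addNr.
- by move=> *; rewrite subrr.
- by move=> x _; rewrite ltxx.
- by move=> x y z _ _ _; exact: lt_trans.
- move=> x y _ _; have [h|h|h] := ltgtP (x 0 0) (y 0 0).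
  + exact: Or31.
  + exact: Or33.
  + by apply: Or32; rewrite -(row1K x) h row1K.
- by move=> z x y _ _ _; rewrite !mxE ltrD2l.
- by move=> z x y _ _ _; rewrite !mxE ltrD2r.
Defined.

Definition mul_group : ordGroup S 1.
Proof.
refine (@OrdGroup R S 1 (fun x => 0 < x 0 0) (fun x y => \row_i (x 0 i * y 0 i))
  (fun x => \row_i (x 0 i)^-1) (row1 1)
  (fun x y => x 0 0 < y 0 0) _ _ _ _ _ _ _ _ _ _ _ _ _ _ _ _ _).
- by dp.
- by apply: (@Df_rowop (fun x y => x * y)); dp.
- apply: Df_row => i.
  have -> : (fun x : 'rV[R]_1 => (\row_i (x 0 i)^-1) 0 i) = (fun x => (x 0 i)^-1).
    by apply/funext => x; rewrite mxE.
  by apply: Df_inv; dp.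
- by dp.
- by move=> x y hx hy; rewrite mxE mulr_gt0.
- by move=> x hx; rewrite mxE invr_gt0.
- by rewrite row1E.
- by move=> x y z _ _ _; apply/rowP => i; rewrite !mxE mulrA.
- by move=> x _; apply/rowP => i; rewrite !mxE mul1r.
- by move=> x _; apply/rowP => i; rewrite !mxE mulr1.
- by move=> x hx; apply/rowP => i; rewrite !mxE (ord1 i) mulVf // gt_eqF.
- by move=> x hx; apply/rowP => i; rewrite !mxE (ord1 i) divff // gt_eqF.
- by move=> x _; rewrite ltxx.
- by move=> x y z _ _ _; exact: lt_trans.
- move=> x y _ _; have [h|h|h] := ltgtP (x 0 0) (y 0 0).
  + exact: Or31.
  + exact: Or33.
  + by apply: Or32; rewrite -(row1K x) h row1K.
- by move=> z x y hz _ _; rewrite !mxE ltr_pM2l.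
- by move=> z x y hz _ _; rewrite !mxE ltr_pM2r.
Defined.

Context {S_omin : o_minimal S}.

Lemma add_group_o_minimal : o_minimal_group S (ogroup_data add_group).
Proof.
apply: (@one_dimensional_o_minimal _ _ _ add_group S_omin (@thin_row1 _)).
by exists (row1 1); split=> //= /rowP/(_ 0); rewrite !mxE => /eqP; rewrite oner_eq0.
Qed.

Lemma mul_group_o_minimal : o_minimal_group S (ogroup_data mul_group).
Proof.
apply: (@one_dimensional_o_minimal _ _ _ mul_group S_omin (@thin_row1 _)).
exists (row1 2); split=> /=; first by rewrite row1E.
by move=> /rowP/(_ 0); rewrite !mxE => E; lra.
Qed.

Lemma additive_natmul (f : R -> R) : (forall x y, f (x + y) = f x + f y) ->
  forall k x, f (x *+ k) = f x *+ k.
Proof.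
move=> fD; have f0 : f 0 = 0.
  by have := fD 0 0; rewrite addr0 => /eqP; rewrite -subr_eq0 opprD addNKr oppr_eq0 => /eqP.
by elim=> [|k IH] x; rewrite ?mulr0n // !mulrS fD IH.
Qed.

Lemma additive_opp (f : R -> R) : (forall x y, f (x + y) = f x + f y) ->
  forall x, f (- x) = - f x.
Proof.
move=> fD x; have f0 := additive_natmul fD 0 0; rewrite !mulr0n in f0.
by apply/eqP; rewrite -addr_eq0 -fD addNr f0.
Qed.

Lemma small_fraction (x d : R) : 0 < d -> exists k, `|x| < d *+ k.+1.
Proof.
move=> d0; exists (Num.truncn (`|x| / d)).
by rewrite -mulr_natr mulrC -ltr_pdivrMr //; exact: truncnS_gt.
Qed.

(* The kernel of [f - f 1 * id] is definable and contains the integers, so it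
   contains an interval. *)
Lemma additive_linear (f : R -> R) : Df S f -> (forall x y, f (x + y) = f x + f y) ->
  forall x, f x = f 1 * x.
Proof.
move=> hf fD; pose g x := f x - f 1 * x.
have gD x y : g (x + y) = g x + g y by rewrite /g fD; ring.
have hg : Dp S (fun x => g x = 0) by rewrite /g; dp.
have [a [b [ab h]]] : fat (fun x => g x = 0).
  apply: (infinite_fat hg) => fin; apply: infinite_nat.
  apply: (@sub_finite_set _ _ ((fun k => k%:R : R) @^-1` [set x | g x = 0])).
    by move=> k _ /=; rewrite (additive_natmul gD) /g mulr1 subrr mul0rn.
  by apply: finite_preimage => // i j _ _ /eqP; rewrite eqr_nat => /eqP.
have near0 t : `|t| < (b - a) / 2 -> g t = 0.
  rewrite ltr_norml => /andP[h1 h2].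
  have E1 : g ((a + b) / 2) = 0 by apply: h; lra.
  have E2 : g ((a + b) / 2 + t) = 0 by apply: h; lra.
  by move: E2; rewrite gD E1 add0r.
move=> x; suff : g x = 0 by move=> /eqP; rewrite subr_eq0 => /eqP.
have [|k hk] := @small_fraction x ((b - a) / 2); first by lra.
have -> : x = (x / k.+1%:R) *+ k.+1 by rewrite -mulr_natr divfK // pnatr_eq0.
rewrite (additive_natmul gD) near0 ?mul0rn // normrM normfV [`|k.+1%:R|]ger0_norm ?ler0n //.
by rewrite ltr_pdivrMr ?ltr0n // mulr_natr.
Qed.

(** No definability is assumed: the lemma is applied to the logarithm of a definable function while
    the logarithm is not yet known to be definable. *)
Lemma additive_monotone_linear (g : R -> R) eps : (forall x y, g (x + y) = g x + g y) ->
  0 < eps -> (forall x, 0 < x -> x < eps -> 0 <= g x) -> forall x, g x = g 1 * x.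
Proof.
move=> gD eps0 pos; have gN := additive_opp gD; have gn := additive_natmul gD.
have g0 : g 0 = 0 by have := gn 0%N 0; rewrite !mulr0n.
have pos' x : 0 <= x -> 0 <= g x.
  rewrite le_eqVlt => /orP[/eqP<-|x0]; first by rewrite g0.
  have [k hk] := small_fraction x eps0.
  have -> : x = (x / k.+1%:R) *+ k.+1 by rewrite -mulr_natr divfK // pnatr_eq0.
  rewrite gn mulrn_wge0 // pos ?divr_gt0 ?ltr0n //.
  by rewrite ltr_pdivrMr ?ltr0n // mulr_natr -(gtr0_norm x0).
have gz (m : int) : g m%:~R = g 1 * m%:~R.
  have gp (k : nat) : g k%:R = g 1 * k%:R by rewrite gn mulr_natr.
  by case: m => k; rewrite ?NegzE ?mulrNz ?gN -?pmulrn gp // mulrN.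
move=> x; apply/eqP; rewrite -subr_eq0; apply/eqP; apply: contrapT => /eqP ne.
have d0 : 0 < `|g x - g 1 * x| by rewrite normr_gt0.
have [k hk] := small_fraction (g 1) d0.
(* The fractional part of [x *+ k.+1] has a value of [g] between 0 and [g 1]. This bounds the error
   multiplied by [k.+1] by [g 1], against the choice of [k]. *)
pose m := Num.floor (x *+ k.+1).
have m1 : m%:~R <= x *+ k.+1 by exact: floor_le.
have m2 : x *+ k.+1 < m%:~R + 1 by rewrite -[1]/(1%:~R) -intrD; exact: floorD1_gt.
have g1 : 0 <= g 1 by apply: pos'.
have e1 : 0 <= g (x *+ k.+1 - m%:~R) by apply: pos'; lra.
have e2 : 0 <= g (1 - (x *+ k.+1 - m%:~R)) by apply: pos'; lra.
move: e1 e2; rewrite !gD !gN !gD gN gz gn => e1 e2.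
have m1' : g 1 * m%:~R <= g 1 * (x *+ k.+1) by rewrite ler_wpM2l.
have m2' : g 1 * (x *+ k.+1) <= g 1 * (m%:~R + 1) by rewrite ler_wpM2l // ltW.
have : `|(g x - g 1 * x) *+ k.+1| <= g 1.
  rewrite mulrnBl -mulrnAr ler_norml; apply/andP; split; lra.
by rewrite normrMn => h; move: hk; rewrite (ger0_norm g1) ltNge h.
Qed.

(** By o-minimality [1 <= f x] is decided in one way just to the right of 0, so [ln] of [f], or its
    negative, is additive and nonnegative there. *)
Lemma multiplicative_exp (f : R -> R) : Df S f -> (forall x, 0 < f x) ->
  (forall x y, f (x + y) = f x * f y) -> forall y, f y = expR (ln (f 1) * y).
Proof.
move=> hf f0 fM y; pose g x := ln (f x).
have gD x x' : g (x + x') = g x + g x' by rewrite /g fM lnM ?posrE.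
have hd : Dp S (fun x => 1 <= f x) by dp.
suff h : g y = g 1 * y by rewrite -h lnK ?posrE.
have [eps eps0 [h|h]] := Dp_germ hd 0.
  apply: (@additive_monotone_linear g eps) => // x x0 xe; apply: ln_ge0; apply: h => //.
  by rewrite add0r.
suff : - g y = - g 1 * y by rewrite mulNr => /oppr_inj.
apply: (@additive_monotone_linear (fun x => - g x) eps) => // [x x'|x x0 xe].
  by rewrite gD opprD.
rewrite oppr_ge0 ln_le0 //.
have := h x x0; rewrite add0r => /(_ xe) /negP.
by rewrite -ltNge => /ltW.
Qed.

(** An isomorphism between the two groups is the exponential of a multiple of the variable; the
    factor is nonzero by injectivity and can be scaled away. *)
Lemma expR_definable : definably_isomorphic S (ogroup_data add_group) (ogroup_data mul_group) ->
  Df S (@expR R).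
Proof.
move=> [f [[hf fin fM] [_ finj _]]].
have hf' : Df S f.
  have := Df_totalize (car_def add_group) hf.
  by congr (Df _ _); apply/funext => x; rewrite asboolT.
pose h r := f (row1 r) 0 0.
have hh : Df S h by rewrite /h; dp; apply: Df_row1; dp.
have h0 r : 0 < h r by exact: fin.
have row1D r r' : row1 (r + r') = row1 r + row1 r' by apply/rowP => i; rewrite !mxE.
have hM r r' : h (r + r') = h r * h r' by rewrite /h row1D fM //= mxE.
have hE := multiplicative_exp hh h0 hM.
have c0 : ln (h 1) != 0.
  apply/eqP => c0; have : h 1 = h 0 by rewrite (hE 1) (hE 0) c0 !mul0r.
  move=> E; have : row1 1 = row1 0.
    by apply: finj; rewrite ?inE // -[LHS]row1K -[RHS]row1K -/(h 1) -/(h 0) E.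
  by move=> /rowP/(_ 0); rewrite !row1E => /eqP; rewrite oner_eq0.
have -> : @expR R = (fun y => h (y * (ln (h 1))^-1)).
  by apply/funext => y; rewrite hE mulrCA divff // mulr1.
by dp.
Qed.

End RealGroups.

(** * Ordered extensions of the line by the line *)

Section Model.
Context {R : realType} {S : expansion R}.

Lemma row2P (x y : 'rV[R]_2) : x 0 0 = y 0 0 -> x 0 1 = y 0 1 -> x = y.
Proof.
move=> h0 h1; apply/rowP => -[[|[|//]] hi].
- by have -> : Ordinal hi = 0 by exact: val_inj.
- by have -> : Ordinal hi = 1 by exact: val_inj.
Qed.

Definition row2 (a b : R) : 'rV[R]_2 := \row_i (if i == 0 then a else b).

Lemma row20 a b : row2 a b 0 0 = a. Proof. by rewrite mxE. Qed.
Lemma row21 a b : row2 a b 0 1 = b. Proof. by rewrite mxE. Qed.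

Lemma Df_row2 (T : Type) (sT : Sp R T) (f g : T -> R) :
  Df S f -> Df S g -> Df S (fun x => row2 (f x) (g x)).
Proof.
move=> hf hg; apply: Df_row => i.
have -> : (fun x => row2 (f x) (g x) 0 i) = (fun x => if i == 0 then f x else g x).
  by apply/funext => x; rewrite mxE.
by case: (i == 0).
Qed.

Lemma semidirect_mul0 eps (z w : 'rV[R]_2) :
  semidirect_mul eps z w 0 0 = z 0 0 + expR (eps * z 0 1) * w 0 0.
Proof. by rewrite mxE. Qed.

Lemma semidirect_mul1 eps (z w : 'rV[R]_2) : semidirect_mul eps z w 0 1 = z 0 1 + w 0 1.
Proof. by rewrite mxE. Qed.

(** Makes the plane the case [eps = 0], so that [section_iso] covers all three models. *)
Lemma plane_semidirect : plane R = semidirect 0.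
Proof.
rewrite /plane /semidirect /additive_group.
suff -> : semidirect_mul 0 = (fun x y : 'rV[R]_2 => x + y) by [].
apply/funext => x; apply/funext => y; apply: row2P; rewrite ?semidirect_mul0 ?semidirect_mul1 !mxE //.
by rewrite mul0r expR0 mul1r.
Qed.

Lemma revlex_total (x y : 'rV[R]_2) : [\/ revlex x y, x = y | revlex y x].
Proof.
have [h|h|h] := ltgtP (x 0 1) (y 0 1).
- by apply: Or31; left.
- by apply: Or33; left.
- have [h'|h'|h'] := ltgtP (x 0 0) (y 0 0).
  + by apply: Or31; right.
  + by apply: Or33; right.
  + by apply: Or32; exact: row2P.
Qed.

Lemma semidirect_ordered eps : Df S (@expR R) ->
  definable_ordered_group S (semidirect (R := R) eps).
Proof.
move=> hexp; split=> /=.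
- split=> /=.
  + by apply/definableP; exact: Dp_cst.
  + apply/definableP.
    have hm : Df2 S (semidirect_mul eps).
      change (Df S (fun q : 'rV[R]_2 * 'rV[R]_2 =>
        row2 (q.1 0 0 + expR (eps * q.1 0 1) * q.2 0 0) (q.1 0 1 + q.2 0 1))).
      by apply: Df_row2; dp.
    apply: (@Dp_ext _ _ _ _ (fun z : 'rV[R]_(2 + 2 + 2) =>
      rsubmx z = semidirect_mul eps (lsubmx (lsubmx z)) (rsubmx (lsubmx z)))).
      by move=> z; split=> [|[]].
    by dp.
  + by [].
  + move=> x y z _ _ _; apply: row2P; rewrite ?semidirect_mul0 ?semidirect_mul1 ?addrA //.
    by rewrite [eps * (_ + _)]mulrDr expRD; ring.
  + exists 0; split=> // x _.
      split; apply: row2P; rewrite ?semidirect_mul0 ?semidirect_mul1 !mxE ?mulr0 ?expR0; ring.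
    exists (row2 (- (expR (- (eps * x 0 1)) * x 0 0)) (- x 0 1)) => //.
    split; apply: row2P; rewrite ?semidirect_mul0 ?semidirect_mul1 ?row20 ?row21 ?mxE; try ring.
      by rewrite mulrN; ring.
    by rewrite mulrN mulrA -expRD subrr expR0; ring.
- by apply/definableP; rewrite /revlex; dp.
- by move=> x _ [|[_]]; rewrite ltxx.
- move=> x y z _ _ _ [h1|[h1 h1']] [h2|[h2 h2']].
  + by left; exact: lt_trans h1 h2.
  + by left; rewrite -h2.
  + by left; rewrite h1.
  + by right; split; [rewrite h1 | exact: lt_trans h1' h2'].
- by move=> x y _ _; exact: revlex_total.
- move=> z x y _ _ _ [h|[h h']]; [left|right; split]; rewrite ?semidirect_mul0 ?semidirect_mul1.
  + by rewrite ltrD2l.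
  + by rewrite h.
  + by rewrite ltrD2l ltr_pM2l ?expR_gt0.
- move=> z x y _ _ _ [h|[h h']]; [left|right; split]; rewrite ?semidirect_mul0 ?semidirect_mul1.
  + by rewrite ltrD2r.
  + by rewrite h.
  + by rewrite h ltrD2r.
Qed.

End Model.

Section Extension.
Context {R : realType} {S : expansion R} {S_omin : o_minimal S}.
Context {n : nat} (K : ordGroup S n).
Local Notation "x • y" := (mul K x y) (at level 40, left associativity).
Local Notation "x ≺ y" := (ltg K x y) (at level 70).
Local Notation "x '^~'" := (inv K x) (at level 2, format "x '^~'").
Local Notation e := (one K).

Context (i : R -> 'rV[R]_n) (p : 'rV[R]_n -> R).
Context (i_def : Df S i) (i_in : forall x, car K (i x))
  (iD : forall x y, i (x + y) = i x • i y)
  (i_mono : forall x y, x < y -> i x ≺ i y).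
Context (p_def : Df S p)
  (pM : forall x y, car K x -> car K y -> p (x • y) = p x + p y)
  (p_surj : forall r, exists2 g, car K g & p g = r)
  (p_i : forall x, p (i x) = 0)
  (p_ker : forall g, car K g -> p g = 0 -> exists x, i x = g)
  (p_mono : forall x y, car K x -> car K y -> p x < p y -> x ≺ y).

Ltac kin := repeat first
  [ assumption | apply: mul_in | apply: inv_in | apply: one_in | apply: i_in ].

Lemma i_inj x y : i x = i y -> x = y.
Proof.
by move=> E; have [h|h|//] := ltgtP x y; have := i_mono h; rewrite E => /ltirr [].
Qed.

Lemma i0 : i 0 = e.
Proof.
have h0 := i_in 0; have h1 := one_in K.
by apply: (mul_injl (K := K) h0 h0 h1); rewrite -iD addr0 ogmul1r.
Qed.

Lemma iN x : i (- x) = (i x)^~.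
Proof. by apply: inv_uniq => //; rewrite -iD subrr i0. Qed.

Lemma p_one : p e = 0. Proof. by rewrite -i0 p_i. Qed.

Lemma pV x : car K x -> p x^~ = - p x.
Proof.
move=> Kx; apply/eqP; rewrite -addr_eq0 addrC -pM //; last exact: inv_in.
by rewrite ogmulVr // p_one.
Qed.

Definition iinv g := xget 0 [set x | i x = g].

Lemma iinv_def : Df S iinv.
Proof.
apply: Df_xget; first by dp.
by move=> g x y <- /i_inj.
Qed.

Lemma iinvK x : iinv (i x) = x.
Proof. by rewrite /iinv; case: xgetP => [y _ /i_inj//|/(_ x)[]]. Qed.

Lemma iinvP g : car K g -> p g = 0 -> i (iinv g) = g.
Proof. by move=> Kg pg; have [x <-] := p_ker Kg pg; rewrite iinvK. Qed.

Lemma cosetP g h : car K g -> car K h -> p g = p h -> exists x, h = g • i x.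
Proof.
move=> Kg Kh E; have Ig := inv_in Kg; have Kgh := mul_in Ig Kh.
have [|x hx] := p_ker Kgh; first by rewrite pM // pV // E addNr.
by exists x; rewrite hx ogmulKVl.
Qed.

(** Conjugation by [g] on the kernel, read on the line through [i]. *)
Definition act g x := iinv (g • i x • g^~).

Lemma actE g x : car K g -> i (act g x) = g • i x • g^~.
Proof.
move=> Kg; have Ig := inv_in Kg; have Kgi := mul_in Kg (i_in x).
by apply: iinvP; [exact: mul_in | rewrite !pM // pV // p_i addr0 subrr].
Qed.

Lemma act_comm g x : car K g -> g • i x = i (act g x) • g.
Proof. by move=> Kg; rewrite actE // ogmulKVr //; exact: mul_in. Qed.

Lemma act_uniq g x y : car K g -> g • i x = i y • g -> act g x = y.
Proof.
move=> Kg; rewrite act_comm // => E; apply: i_inj.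
by apply: (mul_injr (K := K) Kg _ _ E).
Qed.

Lemma actD g x y : car K g -> act g (x + y) = act g x + act g y.
Proof.
move=> Kg; apply: act_uniq => //.
by rewrite !iD ogmulA // (@act_comm g x) // -ogmulA // (@act_comm g y) // ogmulA.
Qed.

Lemma act_linear g x : car K g -> act g x = act g 1 * x.
Proof.
move=> Kg; apply: additive_linear => [|y z]; last exact: actD.
have hm := mul_def K; have hj := iinv_def; have hi := inv_def K.
by rewrite /act; dp.
Qed.

Lemma act_mul g h : car K g -> car K h -> act (g • h) 1 = act g 1 * act h 1.
Proof.
move=> Kg Kh; rewrite -act_linear //; apply: act_uniq; first exact: mul_in.
by rewrite -ogmulA // act_comm // ogmulA // act_comm // ogmulA.
Qed.

Lemma act_i x y : act (i x) y = y.
Proof. by apply: act_uniq => //; rewrite -!iD addrC. Qed.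

Lemma act_gt0 g : car K g -> 0 < act g 1.
Proof.
move=> Kg; have Ig := inv_in Kg; have K1 := mul_in Kg (i_in 1); have Ke := one_in K.
have h : e ≺ i (act g 1).
  rewrite actE // -(ogmulVr Kg); apply: ltmul2r => //.
  rewrite -[X in X ≺ _](ogmul1r Kg); apply: ltmul2l => //.
  by rewrite -i0; exact: i_mono.
have [//|h'|h'] := ltgtP 0 (act g 1).
  by have := i_mono h'; rewrite i0 => /(ltasym Ke (i_in _) h).
by move: h; rewrite -h' i0 => /(ltirr Ke).
Qed.

(** The kernel is commutative, so the factor by which [g] acts depends only on [p g]. As a function
    of [p g] it is definable, positive and multiplicative, hence exponential. *)
Lemma act_exp : exists c, forall g x, car K g -> g • i x = i (expR (c * p g) * x) • g.
Proof.
have hm := mul_def K; have hj := iinv_def; have hi := inv_def K; have hc := car_def K.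
pose alpha r := xget 0 [set y | exists g, [/\ car K g, p g = r & act g 1 = y]].
have uniq r y y' : (exists g, [/\ car K g, p g = r & act g 1 = y]) ->
    (exists g, [/\ car K g, p g = r & act g 1 = y']) -> y = y'.
  move=> [g [Kg pg <-]] [h [Kh ph <-]].
  have [|x ->] := @cosetP g h Kg Kh; first by rewrite pg ph.
  by rewrite act_mul // act_i mulr1.
have alphaE g : car K g -> alpha (p g) = act g 1.
  move=> Kg; rewrite /alpha; case: xgetP => [y _ hy|/(_ (act g 1))[]]; last by exists g.
  by apply: (uniq (p g)) => //; exists g.
have alpha_def : Df S alpha.
  by apply: Df_xget; [rewrite /act; dp | exact: uniq].
have alpha_exp : forall y, alpha y = expR (ln (alpha 1) * y).
  apply: multiplicative_exp => // [r|r r'].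
    by have [g Kg <-] := p_surj r; rewrite alphaE // act_gt0.
  have [g Kg <-] := p_surj r; have [h Kh <-] := p_surj r'.
  by rewrite -pM // !alphaE //; [exact: act_mul | exact: mul_in].
exists (ln (alpha 1)) => g x Kg.
by rewrite -alpha_exp alphaE // -act_linear // act_comm.
Qed.

(* For fixed [g] the commutators [[h, g]] define an additive map of [p h], which
   vanishes at [p g]. *)
Lemma central_abelian : (forall g x, car K g -> g • i x = i x • g) ->
  forall g h, car K g -> car K h -> g • h = h • g.
Proof.
move=> cen g h Kg Kh; apply/esym.
have hm := mul_def K; have hc := car_def K.
case: (eqVneq (p g) 0) => [pg|pg]; first by have [x <-] := p_ker Kg pg; rewrite cen.
(* [i y] is the commutator of [g] with an element over [r]. *)
pose P r y := exists h, [/\ car K h, p h = r & h • g = i y • (g • h)].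
have P_ex k : car K k -> exists y, k • g = i y • (g • k).
  move=> Kk; have Kkg := mul_in Kk Kg; have Kgk := mul_in Kg Kk; have Igk := inv_in Kgk.
  have [||y hy] := @p_ker ((k • g) • (g • k)^~); first by kin.
    by rewrite pM ?pV ?pM //; ring.
  by exists y; rewrite hy ogmulKVr.
have uniq r y y' : P r y -> P r y' -> y = y'.
  move=> [k [Kk pk Ek]] [k' [Kk' pk' Ek']].
  have [|t E] := @cosetP k k' Kk Kk'; first by rewrite pk pk'.
  have Kgk := mul_in Kg Kk; have Kit := i_in t.
  apply: i_inj; apply: (mul_injr (K := K) (mul_in Kit Kgk)) => //.
  have E2 : k' = i t • k by rewrite E cen.
  have h1 : k' • g = i t • (i y • (g • k)) by rewrite E2 -ogmulA // Ek.
  have h2 : g • k' = i t • (g • k) by rewrite E2 ogmulA // cen // ogmulA.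
  by rewrite ogmulA // -iD [y + t]addrC iD -ogmulA // -h1 Ek' h2.
pose kap r := xget 0 [set y | P r y].
have kapE k y : car K k -> k • g = i y • (g • k) -> kap (p k) = y.
  move=> Kk Ek; have Pk : P (p k) y by exists k.
  by rewrite /kap; case: xgetP => [z _ hz|/(_ y)//]; exact: uniq hz Pk.
have kap_def : Df S kap by apply: Df_xget; [rewrite /P; dp | exact: uniq].
have kapD r r' : kap (r + r') = kap r + kap r'.
  have [k Kk <-] := p_surj r; have [k' Kk' <-] := p_surj r'.
  have [y Ey] := P_ex k Kk; have [y' Ey'] := P_ex k' Kk'.
  rewrite -pM // (kapE _ _ Kk Ey) (kapE _ _ Kk' Ey'); apply: kapE; first exact: mul_in.
  have Kgk' := mul_in Kg Kk'; have Kgk := mul_in Kg Kk.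
  rewrite -ogmulA // Ey' (ogmulA Kk (i_in y') Kgk') (cen k y' Kk) -(ogmulA (i_in y') Kk Kgk').
  rewrite (ogmulA Kk Kg Kk') Ey -(ogmulA (i_in y) Kgk Kk') (ogmulA Kg Kk Kk').
  by rewrite (ogmulA (i_in y') (i_in y) (mul_in Kgk Kk')) -iD [y' + y]addrC.
have kg : kap (p g) = 0.
  by apply: kapE => //; rewrite i0 ogmul1l //; exact: mul_in.
have k1 : kap 1 = 0.
  have E : kap (p g) = kap 1 * p g by exact: additive_linear.
  move: E; rewrite kg => /esym/eqP; rewrite mulf_eq0 (negbTE pg) orbF => /eqP; exact.
have [y Ey] := P_ex h Kh; rewrite Ey.
rewrite -(kapE _ _ Kh Ey) (additive_linear kap_def kapD) k1 mul0r i0 ogmul1l //.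
exact: mul_in.
Qed.

(* The centralizer of an element outside the kernel is a complement. *)
Lemma centralizer_section c : c != 0 ->
  (forall g x, car K g -> g • i x = i (expR (c * p g) * x) • g) ->
  exists s : R -> 'rV[R]_n, [/\ Df S s, forall r, car K (s r),
    forall r r', s (r + r') = s r • s r' & forall r, p (s r) = r].
Proof.
move=> c0 hact; have hm := mul_def K; have hc := car_def K.
have [g0 Kg pg] := p_surj 1.
pose P r g := [/\ car K g, p g = r & g • g0 = g0 • g].
have ec : expR c != 1 by rewrite -expR0 (inj_eq (@expR_inj R)).
have uniq r g h : P r g -> P r h -> g = h.
  move=> [Kh ph Eh] [Kk pk Ek]; have [|x E] := @cosetP g h Kh Kk; first by rewrite ph pk.
  (* Two elements over [r] that commute with [g0] differ by some [i x] which also commutes with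
     [g0]. As [g0] lies over 1, it acts as [expR c], which is not 1; so [x = 0]. *)
  have hx : i x • g0 = g0 • i x.
    have Kx := i_in x.
    apply: (mul_injl (K := K) Kh); [kin | kin |].
    by rewrite ogmulA // -E Ek E !ogmulA // Eh.
  have : i x = i (expR c * x).
    apply: (mul_injr (K := K) Kg) => //.
    by rewrite hx hact // pg mulr1.
  move/i_inj => /eqP; rewrite -subr_eq0 -{1}[x]mul1r -mulrBl mulf_eq0 subr_eq0 eq_sym (negbTE ec) /=.
  by move=> /eqP x0; rewrite E x0 i0 ogmul1r.
have ex r : exists g, P r g.
  have [h Kh ph] := p_surj r.
  have Kgh := mul_in Kg Kh; have Khg := mul_in Kh Kg; have Ihg := inv_in Khg.
  have [||w hw] := @p_ker ((g0 • h) • (h • g0)^~); first by kin.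
    by rewrite pM ?pV ?pM //; ring.
  have {}hw : g0 • h = i w • (h • g0) by rewrite hw ogmulKVr.
  (* The element [i x • h] commutes with [g0] exactly when [expR c * x + w = x]. *)
  pose x := w / (1 - expR c).
  have hx : expR c * x + w = x.
    by rewrite /x; field; rewrite subr_eq0 eq_sym.
  exists (i x • h); split; [exact: mul_in | by rewrite pM // p_i add0r |].
  rewrite ogmulA // hact // pg mulr1 -[RHS]ogmulA // hw ogmulA // -iD hx.
  by rewrite ogmulA.
pose s r := xget 0 [set g | P r g].
have sP r : P r (s r).
  by have [g hg] := ex r; rewrite /s; case: xgetP => // /(_ g).
exists s; split.
- by apply: Df_xget; [rewrite /P; dp | exact: uniq].
- by move=> r; have [] := sP r.
- move=> r r'; have [Ks ps cs] := sP r; have [Ks' ps' cs'] := sP r'.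
  apply: (uniq (r + r')) => //; split; [exact: mul_in | by rewrite pM // ps ps' |].
  by rewrite -ogmulA // cs' ogmulA // cs ogmulA.
- by move=> r; have [] := sP r.
Qed.

(** Each element is uniquely [i x • s r] and is sent to the pair of [x] and [lam * r]. Scaling by a
    positive [lam] keeps the order and turns the exponent [c] into [eps]; the values used later are
    the absolute value of [c], or 1 when [c = 0]. *)
Lemma section_iso c lam eps (s : R -> 'rV[R]_n) : Df S (@expR R) ->
  (forall g x, car K g -> g • i x = i (expR (c * p g) * x) • g) ->
  0 < lam -> eps * lam = c ->
  [/\ Df S s, forall r, car K (s r), forall r r', s (r + r') = s r • s r' &
    forall r, p (s r) = r] ->
  definably_ordered_isomorphic S (ogroup_data K) (semidirect (R := R) eps).
Proof.
move=> hexp hact lam0 elc [s_def s_in sD ps].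
have hm := mul_def K; have hc := car_def K; have hj := iinv_def; have hi := inv_def K.
have lamI : injective ( *%R lam) by apply: mulfI; rewrite gt_eqF.
pose F g := row2 (iinv (g • (s (p g))^~)) (lam * p g).
have F_def : Df S F by apply: Df_row2; dp.
have decomp g : car K g -> exists x r, g = i x • s r.
  move=> Kg; have Ks := s_in (p g); have Is := inv_in Ks.
  have [||x hx] := @p_ker (g • (s (p g))^~); first by kin.
    by rewrite pM // pV // ps subrr.
  by exists x, (p g); rewrite hx ogmulKVr.
have pxr x r : p (i x • s r) = r by rewrite pM // p_i ps add0r.
have FE x r : F (i x • s r) = row2 x (lam * r).
  by rewrite /F pxr ogmulKr // iinvK.
have Fmul x r x' r' : (i x • s r) • (i x' • s r') =
    i (x + expR (c * r) * x') • s (r + r').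
  have hh : s r • i x' = i (expR (c * r) * x') • s r by rewrite hact // ps.
  have Kss := mul_in (s_in r) (s_in r'); have Kis := mul_in (i_in x') (s_in r').
  rewrite sD iD -(ogmulA (i_in x) (s_in r) Kis) (ogmulA (s_in r) (i_in x') (s_in r')) hh.
  by rewrite -(ogmulA (i_in _) (s_in r) (s_in r')) (ogmulA (i_in x) (i_in _) Kss).
have Forder x r x' r' : revlex (F (i x • s r)) (F (i x' • s r')) -> i x • s r ≺ i x' • s r'.
  rewrite !FE /revlex !row20 !row21 => -[|[]].
    rewrite ltr_pM2l // => h; apply: p_mono; [by kin | by kin |].
    by rewrite !pxr.
  move=> /lamI -> h.
  by apply: ltmul2r => //; exact: i_mono.
split.
- exact: ogroup_data_ordered.
- exact: semidirect_ordered.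
exists F; split.
- split=> //.
  + exact: definable_mapP.
  + move=> g h /= /decomp[x [r ->]] /decomp[x' [r' ->]].
    rewrite Fmul !FE /=; apply: row2P; rewrite ?semidirect_mul0 ?semidirect_mul1 ?row20 ?row21.
      by rewrite -elc mulrA.
    by rewrite mulrDr.
- split=> //.
  + move=> g h; rewrite !inE /= => /decomp[x [r ->]] /decomp[x' [r' ->]].
    rewrite !FE => E; have := congr1 (fun z : 'rV[R]_2 => z 0 0) E.
    have := congr1 (fun z : 'rV[R]_2 => z 0 1) E; rewrite !row20 !row21.
    by move=> /lamI -> ->.
  + move=> z _; exists (i (z 0 0) • s (z 0 1 / lam)); first by rewrite /=; kin.
    rewrite FE; apply: row2P; rewrite ?row20 ?row21 //.
    by rewrite mulrCA divff ?mulr1 // gt_eqF.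
(* Both orders are total, so preservation in one direction together with injectivity gives the
   equivalence. *)
- move=> g h /= /decomp[x [r ->]] /decomp[x' [r' ->]]; split; last exact: Forder.
  have K1 : car K (i x • s r) by kin.
  have K2 : car K (i x' • s r') by kin.
  move=> lt12; have [//|E|/Forder lt21] := revlex_total (F (i x • s r)) (F (i x' • s r')).
    move: E lt12; rewrite !FE => E; have := congr1 (fun z : 'rV[R]_2 => z 0 0) E.
    have := congr1 (fun z : 'rV[R]_2 => z 0 1) E; rewrite !row20 !row21.
    move=> /lamI -> ->.
    by move=> /ltirr [].
  by case: (ltasym K1 K2 lt12 lt21).
Qed.

End Extension.

(** * Classification *)

Section Line.
Context {R : realType} {S : expansion R} {S_omin : o_minimal S}.
Context {n : nat} (K : ordGroup S n).

(** Every positive real is a multiple of one smaller than [eps], so positivity near 0 spreads to all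
    positive reals. *)
Lemma hom_increasing (i : R -> 'rV[R]_n) eps : (forall x, car K (i x)) ->
  (forall x y, i (x + y) = mul K (i x) (i y)) -> 0 < eps ->
  (forall x, 0 < x -> x < eps -> ltg K (one K) (i x)) ->
  forall x y, x < y -> ltg K (i x) (i y).
Proof.
move=> i_in iD eps0 pos.
have mulrn k x : ltg K (one K) (i x) -> ltg K (one K) (i (x *+ k.+1)).
  move=> hx; elim: k => [|k IH] //; rewrite mulrS iD.
  exact: one_lt_mul.
have pos' x : 0 < x -> ltg K (one K) (i x).
  move=> x0; have [k hk] := small_fraction x eps0.
  have -> : x = (x / k.+1%:R) *+ k.+1 by rewrite -mulr_natr divfK // pnatr_eq0.
  apply: mulrn; apply: pos; first by rewrite divr_gt0 ?ltr0n.
  by rewrite ltr_pdivrMr ?ltr0n // mulr_natr -(gtr0_norm x0).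
move=> x y xy; have -> : y = x + (y - x) by rewrite addrC subrK.
rewrite iD -[X in ltg K X _](ogmul1r (i_in x)).
by apply: ltmul2l => //; [exact: one_in | apply: pos'; rewrite subr_gt0].
Qed.

(** The given isomorphism need not respect the orders. By o-minimality the images of small positive
    reals are all above the unit or all not above it, so the map or its composition with negation is
    increasing. *)
Lemma increasing_parametrization :
  definably_isomorphic S (ogroup_data (@add_group R S)) (ogroup_data K) ->
  exists i : R -> 'rV[R]_n, [/\ Df S i, forall x, car K (i x),
    forall x y, i (x + y) = mul K (i x) (i y),
    forall x y, x < y -> ltg K (i x) (i y) & forall g, car K g -> exists x, i x = g].
Proof.
move=> [f [[hf fin fM] [_ finj fsurj]]]; have Ke := one_in K; have hl := ltg_def K.
have hf' : Df S f.
  have := Df_totalize (car_def add_group) hf.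
  by congr (Df _ _); apply/funext => x; rewrite asboolT.
pose i r := f (row1 r).
have i_def : Df S i by have hs := @Df_row1 R S; rewrite /i; dp; apply: Df_row1; dp.
have i_in r : car K (i r) by exact: fin.
have iD r r' : i (r + r') = mul K (i r) (i r').
  have /= <- := fM (row1 r) (row1 r') Logic.I Logic.I.
  by rewrite /i; congr f; apply/rowP => k; rewrite !mxE.
have i_inj r r' : i r = i r' -> r = r'.
  move=> /finj E; have := E (in_setT _) (in_setT _) => /rowP/(_ 0).
  by rewrite !row1E.
have i_surj g : car K g -> exists x, i x = g.
  by move=> /fsurj[v _ <-]; exists (v 0 0); rewrite /i row1K.
have i0 : i 0 = one K.
  by apply: (mul_injl (K := K) (i_in 0) (i_in 0) Ke); rewrite -iD addr0 ogmul1r.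
have iN x : i (- x) = inv K (i x).
  by apply: inv_uniq => //; rewrite -iD subrr i0.
have hd : Dp S (fun x => ltg K (one K) (i x)) by dp.
have [eps eps0 [h|h]] := Dp_germ hd 0.
  exists i; split=> //; apply: (hom_increasing i_in iD eps0) => x x0 xe.
  by apply: h; rewrite ?add0r.
(* Small positive reals are not sent above the unit, so the parametrization is reversed. *)
exists (fun x => i (- x)); split=> //.
- by dp.
- by move=> x y; rewrite opprD.
- apply: (hom_increasing _ _ eps0) => [x|x y|x x0 xe] //; first by rewrite opprD.
  rewrite iN; apply/ltinv => //; have [h'|h'|//] := lttot Ke (i_in x).
    by case: (h x x0 _ h'); rewrite add0r.
  by move: x0; rewrite (i_inj x 0) ?ltxx // i0 h'.
- by move=> g /i_surj[x <-]; exists (- x); rewrite opprK.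
Qed.

End Line.

Section Classification.
Context {R : realType} {S : expansion R} {S_omin : o_minimal S}.
Context {n : nat} (K : ordGroup S n).

(** The sign of the exponent [c] decides between the models; a section comes from the splitting
    hypothesis if [c = 0] and from a centralizer otherwise. *)
Lemma extension_classification (i : R -> 'rV[R]_n) (p : 'rV[R]_n -> R) :
  Df S (@expR R) ->
  (forall (E : groupData R) (i : 'rV[R]_1 -> 'rV[R]_(gdim E))
     (p : 'rV[R]_(gdim E) -> 'rV[R]_1),
     abelian_group E -> definable_extension S i p -> splits S p) ->
  Df S i -> (forall x, car K (i x)) -> (forall x y, i (x + y) = mul K (i x) (i y)) ->
  (forall x y, x < y -> ltg K (i x) (i y)) ->
  Df S p -> (forall x y, car K x -> car K y -> p (mul K x y) = p x + p y) ->
  (forall r, exists2 g, car K g & p g = r) ->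
  (forall x, p (i x) = 0) -> (forall g, car K g -> p g = 0 -> exists x, i x = g) ->
  (forall x y, car K x -> car K y -> p x < p y -> ltg K x y) ->
  [\/ definably_ordered_isomorphic S (ogroup_data K) (plane R),
      definably_ordered_isomorphic S (ogroup_data K) (semidirect 1)
    | definably_ordered_isomorphic S (ogroup_data K) (semidirect (-1))].
Proof.
move=> hexp split_ext i_def i_in iD i_mono p_def pM p_surj p_i p_ker p_mono.
have [c hact] := act_exp i_def i_in iD i_mono p_def pM p_surj p_i p_ker.
have iso := section_iso i_def i_in iD i_mono p_def pM p_i p_ker p_mono hexp hact.
have hc := car_def K.
have [c0|c0] := eqVneq c 0; last first.
  have [s hs] := centralizer_section i_in iD i_mono p_def pM p_surj p_i p_ker c0 hact.
  have [c_lt0|c_gt0|E] := ltgtP c 0; last by rewrite E eqxx in c0.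
    by apply: Or33; apply: (iso (- c) (-1) s) => //; [rewrite oppr_gt0 | rewrite mulrN mulN1r opprK].
  by apply: Or32; apply: (iso c 1 s) => //; rewrite mul1r.
have cen g x : car K g -> mul K g (i x) = mul K (i x) g.
  by move=> Kg; rewrite hact // c0 mul0r expR0 mul1r.
have ab := central_abelian i_def i_in iD i_mono p_def pM p_surj p_i p_ker cen.
(* For [c = 0] the kernel is central, hence the group is abelian, and it is presented in the form
   required by the hypothesis on extensions. *)
have [] := @split_ext (ogroup_data K) (fun v => i (v 0 0)) (fun g => row1 (p g)).
- by move=> x y; exact: ab.
- split; first by have [] := ogroup_data_ordered K.
  split.
  + split.
    * by apply: definable_mapP => /=; [exact: Dp_cst | dp].
    * by move=> x _; exact: i_in.
    * by move=> x y _ _ /=; rewrite mxE iD.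
  + split.
    * by apply: definable_mapP => //=; apply: Df_row1; dp.
    * by [].
    * by move=> x y Kx Ky /=; apply/rowP => k; rewrite !mxE pM.
  + by move=> x y /(i_inj i_in i_mono) E; rewrite -(row1K x) -(row1K y) E.
  + by move=> r; have [g Kg pg] := p_surj (r 0 0); exists g => //; rewrite pg row1K.
  + move=> g Kg; split=> [/rowP/(_ 0)|[r <-]].
      by rewrite row1E mxE => /(p_ker g Kg)[x <-]; exists (row1 x); rewrite row1E.
    by rewrite p_i; apply/rowP => k; rewrite !mxE.
move=> s [hs s_in sM] ps.
have s_def : Df S s.
  have := Df_totalize (Dp_cst S _ True) hs.
  by congr (Df _ _); apply/funext => x; rewrite asboolT.
apply: Or31; rewrite plane_semidirect.
apply: (iso 1 0 (fun r => s (row1 r))) => //; first by rewrite mul0r c0.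
split.
- by apply: (@Df_comp _ _ _ _ _ _ _ _ s) => //; apply: Df_row1; dp.
- by move=> r; exact: s_in.
- move=> r r'; have /= <- := sM (row1 r) (row1 r') Logic.I Logic.I.
  by congr s; apply/rowP => k; rewrite !mxE.
- by move=> r; have /rowP/(_ 0) := ps (row1 r); rewrite !row1E.
Qed.

Lemma two_dimensional_extension :
  thin S 3 (car K) -> emb S 2 (car K) ->
  (forall G H : orderedGroupData R, o_minimal_group S G -> o_minimal_group S H ->
     definably_isomorphic S G H) ->
  exists (i : R -> 'rV[R]_n) (p : 'rV[R]_n -> R),
    [/\ [/\ Df S i, forall x, car K (i x), forall x y, i (x + y) = mul K (i x) (i y)
          & forall x y, x < y -> ltg K (i x) (i y)],
        [/\ Df S p, forall x y, car K x -> car K y -> p (mul K x y) = p x + p y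
          & forall r, exists2 g, car K g & p g = r],
        forall x, p (i x) = 0, forall g, car K g -> p g = 0 -> exists x, i x = g
      & forall x y, car K x -> car K y -> p x < p y -> ltg K x y].
Proof.
move=> tK eK iso.
have H_omin : o_minimal_group S (ogroup_data (subgroup (small_convex_subgroup K 1))).
  exact: small_o_minimal.
have T_omin : o_minimal_group S
    (ogroup_data (quotient (small_convex_subgroup K 1) (@small_normal R S n K 2))).
  exact: quotient_o_minimal.
(* From here on only a convex normal subgroup [L] matters, with both [L] and its quotient
   o-minimal. *)
move: (small_convex_subgroup K 1) (@small_normal R S n K 2) H_omin T_omin.
move: (small K 2) => L hL nL H_omin T_omin.
have [i [i_def i_in iD i_mono i_surj]] :=
  increasing_parametrization (iso _ _ add_group_o_minimal H_omin).
have [q [q_def q_in qD q_mono q_surj]] :=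
  increasing_parametrization (iso _ _ add_group_o_minimal T_omin).
rewrite /= in i_in iD i_mono i_surj q_in qD q_mono q_surj.
have hr := Df_rep hL; have Ke := one_in K.
have q_inj x y : q x = q y -> x = y.
  by move=> E; have [h|h|//] := ltgtP x y; have := q_mono _ _ h; rewrite E => /ltirr [];
    have [] := q_in y.
(* The projection to the quotient followed by the inverse of its parametrization [q]. *)
pose p g := xget 0 [set r | q r = rep K L g].
have p_def : Df S p.
  by apply: Df_xget; [dp | move=> g r r' <- /q_inj].
have pP g : car K g -> q (p g) = rep K L g.
  move=> Kg; have [r hr'] := q_surj _ (transversal_rep hL Kg).
  by rewrite /p; case: xgetP => [//|/(_ r)].
have p_uniq g r : car K g -> q r = rep K L g -> p g = r.
  by move=> Kg; rewrite -pP // => /q_inj.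
have q_rep r : rep K L (q r) = q r by have [] := q_in r.
have Kq r : car K (q r) by have [] := q_in r.
have pq r : p (q r) = r by apply: p_uniq.
have q0 : q 0 = rep K L (one K).
  have Tq := q_in 0; have := qD 0 0; rewrite addr0 => E.
  rewrite -[LHS]q_rep; apply/(repP hL) => //.
  have : rep K L (q 0) = rep K L (mul K (q 0) (q 0)) by rewrite q_rep.
  move/(repP hL (Kq 0) (mul_in (Kq 0) (Kq 0))) => h; apply: same_coset_sym => //.
  by apply: (same_coset_cancel_l (z := q 0)) => //; rewrite ogmul1r.
have pE g h : car K g -> car K h -> p g = p h <-> same_coset K L g h.
  by move=> Kg Kh; rewrite -(repP hL Kg Kh) -!pP //; split=> [->//|/q_inj].
have i_L g : L g <-> exists x, i x = g.
  by split=> [/i_surj //|[x <-]]; exact: i_in.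
have Ki x : car K (i x) by exact: (sub_car hL (i_in x)).
have p1 : p (one K) = 0 by apply: p_uniq.
have coset1 g : same_coset K L (one K) g <-> L g.
  have e1 : inv K (one K) = one K by exact: oginv1.
  split=> [[_ Kg]|Lg]; first by rewrite e1 ogmul1l.
  have Kg := sub_car hL Lg; split=> //; by rewrite e1 ogmul1l.
exists i, p; split.
- by split.
- split=> // [x y Kx Ky|r]; last by exists (q r).
  have Kxy := mul_in Kx Ky; have Krx : car K (rep K L x) by exact: (rep_in hL).
  have Kry : car K (rep K L y) by exact: (rep_in hL).
  apply: p_uniq => //; rewrite qD !pP //; apply/(repP hL) => //; first exact: mul_in.
  by apply: (same_coset_mul hL nL); apply: (same_coset_sym hL); exact: rep_coset.
- by move=> x; rewrite -p1; apply/esym/pE => //; exact/coset1.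
- by move=> g Kg; rewrite -p1 => /esym/(pE _ _ Ke Kg)/coset1/i_L.
- move=> x y Kx Ky /q_mono; rewrite !pP // => h.
  apply: (coset_lt hL (same_coset_sym hL (rep_coset hL Kx)) (same_coset_sym hL (rep_coset hL Ky)) _ h).
  move=> /(repP hL (rep_in hL Kx) (rep_in hL Ky)); rewrite !rep_rep // => E.
  by move: h; rewrite E => /ltirr []; exact: rep_in.
Qed.

End Classification.

Theorem mainTheorem6 (R : realType) (S : expansion R)
    (S_omin : o_minimal S)
    (omin_groups_iso : forall G H : orderedGroupData R,
       o_minimal_group S G -> o_minimal_group S H ->
       definably_isomorphic S G H)
    (extensions_split : forall (E : groupData R)
         (i : 'rV[R]_1 -> 'rV[R]_(gdim E)) (p : 'rV[R]_(gdim E) -> 'rV[R]_1),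
       abelian_group E -> definable_extension S i p -> splits S p)
    (G : orderedGroupData R)
    (G_ordered : definable_ordered_group S G)
    (G_dim2 : has_dim S (carrier G) 2) :
  [\/ definably_ordered_isomorphic S G (plane R),
      definably_ordered_isomorphic S G (semidirect 1)
    | definably_ordered_isomorphic S G (semidirect (-1))].
Proof.
have [K [carE mulE ltE]] := ordered_ogroup G_ordered.
have hexp : Df S (@expR R).
  apply: expR_definable.
  exact: omin_groups_iso add_group_o_minimal mul_group_o_minimal.
have Gd : Dp S (carrier G) by have [[/definableP]] := G_ordered.
have tK : thin S 3 (car K) by rewrite carE; exact: has_dim_thin.
have eK : emb S 2 (car K) by rewrite carE; exact: has_dim_emb.
have [i [p [[? ? ? ?] [? ? ?] ? ? ?]]] := two_dimensional_extension tK eK omin_groups_iso.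
(* [K] and [G] have the same carrier and agree on it, so an isomorphism from one is an isomorphism
   from the other. *)
have transfer M : definably_ordered_isomorphic S (ogroup_data K) M ->
    definably_ordered_isomorphic S G M.
  move=> [_ Mo [f [[f_def f_in fM] f_bij f_lt]]].
  rewrite /= carE in f_def f_in fM f_bij f_lt.
  split=> //; exists f; split=> //.
    by split=> // x y Gx Gy; rewrite -fM // mulE.
  by move=> x y Gx Gy; rewrite -ltE // f_lt.
have [h|h|h] := @extension_classification R S S_omin _ K i p hexp extensions_split
  ltac:(assumption) ltac:(assumption) ltac:(assumption) ltac:(assumption)
  ltac:(assumption) ltac:(assumption) ltac:(assumption) ltac:(assumption)
  ltac:(assumption) ltac:(assumption).
- by apply: Or31; exact: transfer.
- by apply: Or32; exact: transfer.
- by apply: Or33; exact: transfer.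
Qed.
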